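(* Let $(A,\tau_A)$ and $(B,\tau_B)$ be tracial von Neumann algebras. If $(A,\tau_A)$ and $(B,\tau_B)$ are von Neumann orbit equivalent, then $A$ and $B$ are von Neumann equivalent.
   Context: A tracial von Neumann algebra $(A,\tau_A)$ is a von Neumann algebra $A$ with a faithful normal tracial state $\tau_A$. A (Hilbert) $M$-$N$-bimodule is a Hilbert space with commuting normal unital left action of $M$ and right action of $N$ (i.e. a normal unital $*$-homomorphism of $M$ and a normal unital $*$-anti-homomorphism of $N$ into the bounded operators, with commuting ranges). $\overline{\otimes}$ denotes the von Neumann algebra tensor product, and $B^{\mathrm{op}}$ the opposite algebra. Von Neumann orbit equivalence. $(A,\tau_A)$ and $(B,\tau_B)$ are von Neumann orbit equivalent if there exist a tracial von Neumann algebra $(Q,\tau_Q)$, a Hilbert $A\overline{\otimes}Q$-$B$-bimodule $\mathcal{H}$, and a vector $\xi\in\mathcal{H}$ such that (1) $\langle(a\otimes x)\xi,\xi\rangle=\tau_A(a)\tau_Q(x)$ and $\langle y\xi b,\xi\rangle=\tau_Q(y)\tau_B(b)$ for all $a\in A$, $x,y\in Q$, $b\in B$ (where $y\in Q$ acts as $1\otimes y$); (2) $\overline{\mathrm{Span}((A\overline{\otimes}Q)\xi)}=\mathcal{H}=\overline{\mathrm{Span}(Q\xi B)}$. Von Neumann equivalence. Let $\mathcal{M}$ be a semi-finite von Neumann algebra with $A\subset\mathcal{M}$ and $B^{\mathrm{op}}\subset\mathcal{M}$. A fundamental domain for $A$ inside of $\mathcal{M}$ consists of a realization of the standard representation $A\subset\mathcal{B}(L^2(A))$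 as an intermediate von Neumann subalgebra $A\subset\mathcal{B}(L^2(A))\subset\mathcal{M}$ (that is, an embedding of $\mathcal{B}(L^2(A))$ as a von Neumann subalgebra of $\mathcal{M}$ whose restriction to $A$, acting on $L^2(A)$ by left multiplication, is the given inclusion $A\subset\mathcal{M}$). The fundamental domain is finite if finite-rank projections in $\mathcal{B}(L^2(A))$ are mapped to finite projections in $\mathcal{M}$. The same definitions apply to $B^{\mathrm{op}}\subset\mathcal{M}$. $\mathcal{M}$ is a von Neumann coupling between $A$ and $B$ if $B^{\mathrm{op}}\subset A'\cap\mathcal{M}$ and each of the inclusions $A\subset\mathcal{M}$ and $B^{\mathrm{op}}\subset\mathcal{M}$ has a finite fundamental domain. $A$ and $B$ are von Neumann equivalent if there exists a von Neumann coupling between them. *)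

(* Defs.v *)
From HB Require Import structures.
From mathcomp Require Import all_boot all_order all_algebra.
From mathcomp Require Import complex.
From mathcomp Require Import all_classical all_reals all_analysis.

Set Implicit Arguments.
Unset Strict Implicit.
Unset Printing Implicit Defensive.

Import Order.TTheory GRing.Theory Num.Theory.
Import numFieldNormedType.Exports.

Local Open Scope classical_set_scope.
Local Open Scope ring_scope.

(* The scalar field is R[i] for a realType R. The order on R[i] is the partial
   order of a numFieldType: x <= y means that y - x is a nonnegative real. *)

Record hilbert (R : realType) := Hilbert {
  hspace :> completeNormedModType R[i];
  inner : {dot hspace for Num.conj};  (* linear in the first variable *)
  norm_inner : forall u : hspace, `|u| ^+ 2 = inner u u }.

Notation "'[ u , v ]" := (inner _ u v) : ring_scope.

Section Operators.
Variables (R : realType) (H : hilbert R).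
Implicit Types (S T U p s : H -> H) (X M D : set (H -> H)).

Definition bounded_op : set (H -> H) :=
  [set T | linear T /\ exists c : R[i], forall u, `|T u| <= c * `|u|].

Definition is_adjoint S T :=
  bounded_op S /\ bounded_op T /\ forall u v, '[S u, v] = '[u, T v].

Definition op_le S T := forall u, '[S u, u] <= '[T u, u].

Definition commutant X : set (H -> H) :=
  [set T | bounded_op T /\ forall S, X S -> S \o T = T \o S].

(* Von Neumann algebras are concrete: unital *-closed sets of bounded operators
   that are equal to their bicommutant. *)
Definition von_neumann M :=
  (forall S T, M S -> is_adjoint S T -> M T) /\
  commutant (commutant M) = M.

Definition is_projection p := is_adjoint p p /\ p \o p = p.

Definition finite_rank T := exists (n : nat) (e : 'I_n -> H),
  forall u, exists c : 'I_n -> R[i], T u = \sum_i c i *: e i.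

(* Murray-von Neumann finiteness: v^* v = p and v v^* <= p imply v v^* = p. *)
Definition finite_projection M p :=
  M p /\ is_projection p /\
  forall v w, M v -> is_adjoint v w ->
    w \o v = p -> op_le (v \o w) p -> v \o w = p.

(* There is no type III direct summand: every nonzero central projection
   majorizes a nonzero finite projection. *)
Definition semifinite M :=
  forall z, M z -> commutant M z -> is_projection z -> z <> cst 0 ->
    exists p, finite_projection M p /\ p <> cst 0 /\ op_le p z.

Definition is_lub M D s :=
  M s /\ (forall T, D T -> op_le T s) /\
  forall U, M U -> (forall T, D T -> op_le T U) -> op_le s U.

(* An increasing net of self-adjoint elements of M, as an upward directed set. *)
Definition directed_sa M D :=
  D !=set0 /\ (forall T, D T -> M T /\ is_adjoint T T) /\
  forall S T, D S -> D T -> exists U, D U /\ op_le S U /\ op_le T U.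

Definition lspan (X : set H) : set H :=
  [set u | exists (n : nat) (c : 'I_n -> R[i]) (x : 'I_n -> H),
    (forall i, X (x i)) /\ u = \sum_i c i *: x i].

(* The product of M when op = false, and of the opposite algebra of M when
   op = true. M and its opposite have the same elements, linear structure,
   involution, unit and order, hence the same suprema; only the product
   distinguishes them. *)
Definition mulo (op : bool) S T := if op then T \o S else S \o T.

End Operators.

(* A trace is a total function on operators; only its values on the algebra
   are constrained or used. *)
Record tracial_von_neumann (R : realType) := TracialVonNeumann {
  tspace : hilbert R;
  talg : set (tspace -> tspace);
  trace : (tspace -> tspace) -> R[i];
  talg_vn : von_neumann talg;
  traceD : forall S T, talg S -> talg T ->
    trace (S \+ T) = trace S + trace T;
  traceZ : forall (c : R[i]) S, talg S ->
    trace (fun u => c *: S u) = c * trace S;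
  trace1 : trace id = 1;
  trace_ge0 : forall S T, talg S -> is_adjoint S T -> 0 <= trace (T \o S);
  trace_faithful : forall S T, talg S -> is_adjoint S T ->
    trace (T \o S) = 0 -> S = cst 0;
  trace_tracial : forall S T, talg S -> talg T ->
    trace (S \o T) = trace (T \o S);
  trace_normal : forall D s, directed_sa talg D -> is_lub talg D s ->
    (forall T, D T -> trace T <= trace s) /\
    forall r, (forall T, D T -> trace T <= r) -> trace s <= r }.

Arguments tspace {R}.
Arguments talg {R}.
Arguments trace {R}.

(* Normal unital *-homomorphisms M -> N (op = false), respectively
   *-anti-homomorphisms M -> N, i.e. *-homomorphisms from the opposite of M
   to N (op = true). Only the values of f on M matter. *)
Definition normal_hom (R : realType) (H K : hilbert R) (op : bool)
    (M : set (H -> H)) (N : set (K -> K)) (f : (H -> H) -> (K -> K)) :=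
  (forall S, M S -> N (f S)) /\
  (forall S T, M S -> M T -> f (S \+ T) = f S \+ f T) /\
  (forall (c : R[i]) S, M S -> f (fun u => c *: S u) = (fun u => c *: f S u)) /\
  f id = id /\
  (forall S T, M S -> M T -> f (mulo op S T) = f S \o f T) /\
  (forall S T, M S -> is_adjoint S T -> is_adjoint (f S) (f T)) /\
  (forall D s, directed_sa M D -> is_lub M D s -> is_lub N (f @` D) (f s)).

(* Inclusions of von Neumann algebras, M in N or the opposite of M in N. *)
Definition vn_embedding (R : realType) (H K : hilbert R) (op : bool)
    (M : set (H -> H)) (N : set (K -> K)) (f : (H -> H) -> (K -> K)) :=
  normal_hom op M N f /\ forall S T, M S -> M T -> f S = f T -> S = T.

(* The Hilbert space tensor product of H and K, determined up to a unique
   unitary, with the operators S (x) T that it carries. *)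
Record hilbert_tensor (R : realType) (H K : hilbert R) := HilbertTensor {
  tens_space :> hilbert R;
  tens : H -> K -> tens_space;
  tens_linearl : forall v, linear (tens^~ v);
  tens_linearr : forall u, linear (tens u);
  tens_inner : forall u v u' v', '[tens u v, tens u' v'] = '[u, u'] * '[v, v'];
  tens_dense : closure (lspan [set tens p.1 p.2 | p in [set: H * K]]) = setT;
  tens_op : (H -> H) -> (K -> K) -> (tens_space -> tens_space);
  tens_op_bounded : forall S T, bounded_op S -> bounded_op T ->
    bounded_op (tens_op S T);
  tens_opE : forall S T u v, bounded_op S -> bounded_op T ->
    tens_op S T (tens u v) = tens (S u) (T v) }.

Arguments tens_op {R H K}.

Definition vn_tensor (R : realType) (H K : hilbert R) (L : hilbert_tensor H K)
    (M : set (H -> H)) (N : set (K -> K)) : set (L -> L) :=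
  commutant (commutant
    [set T | exists x y, M x /\ N y /\ T = tens_op L x y]).

Arguments vn_tensor {R H K}.

(* The space L^2(A) (op = false), or L^2 of the opposite of A (op = true), with
   the action of the algebra by left multiplication; determined up to a unique
   unitary as the completion of the algebra for <a, b> = trace (b^* a). *)
Record standard_rep (R : realType) (op : bool) (A : tracial_von_neumann R) :=
    StandardRep {
  l2_space :> hilbert R;
  l2_vec : (tspace A -> tspace A) -> l2_space;
  l2_vecD : forall a b, talg A a -> talg A b ->
    l2_vec (a \+ b) = l2_vec a + l2_vec b;
  l2_vecZ : forall (c : R[i]) a, talg A a ->
    l2_vec (fun u => c *: a u) = c *: l2_vec a;
  l2_inner : forall a b b', talg A a -> talg A b -> is_adjoint b b' ->
    '[l2_vec a, l2_vec b] = trace A (mulo op b' a);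
  l2_dense : closure [set l2_vec a | a in talg A] = setT;
  l2_left : (tspace A -> tspace A) -> (l2_space -> l2_space);
  l2_left_bounded : forall a, talg A a -> bounded_op (l2_left a);
  l2_leftE : forall a b, talg A a -> talg A b ->
    l2_left a (l2_vec b) = l2_vec (mulo op a b) }.

Arguments l2_left {R op A}.

(* For iota an inclusion in M of A (op = false) or of its opposite
   (op = true). *)
Definition has_finite_fundamental_domain (R : realType) (H : hilbert R)
    (op : bool) (A : tracial_von_neumann R) (M : set (H -> H))
    (iota : (tspace A -> tspace A) -> (H -> H)) :=
  exists (L : standard_rep op A) (theta : (L -> L) -> (H -> H)),
    vn_embedding false (@bounded_op R L) M theta /\
    (forall a, talg A a -> theta (l2_left L a) = iota a) /\
    (forall p, is_projection p -> finite_rank p ->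
       finite_projection M (theta p)).

Definition von_neumann_equivalent (R : realType)
    (A B : tracial_von_neumann R) :=
  exists (H : hilbert R) (M : set (H -> H))
    (iA : (tspace A -> tspace A) -> (H -> H))
    (iB : (tspace B -> tspace B) -> (H -> H)),
    von_neumann M /\ semifinite M /\
    vn_embedding false (talg A) M iA /\ vn_embedding true (talg B) M iB /\
    (forall a b, talg A a -> talg B b -> iA a \o iB b = iB b \o iA a) /\
    has_finite_fundamental_domain false M iA /\
    has_finite_fundamental_domain true M iB.

(* A Hilbert M-N-bimodule: the left action l of M and the right action r of N,
   r b being the operator u |-> u b. *)
Definition bimodule (R : realType) (H K L : hilbert R)
    (M : set (H -> H)) (N : set (K -> K))
    (l : (H -> H) -> (L -> L)) (r : (K -> K) -> (L -> L)) :=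
  normal_hom false M (@bounded_op R L) l /\
  normal_hom true N (@bounded_op R L) r /\
  forall x b, M x -> N b -> l x \o r b = r b \o l x.

Definition von_neumann_orbit_equivalent (R : realType)
    (A B : tracial_von_neumann R) :=
  exists (Q : tracial_von_neumann R)
    (AQ : hilbert_tensor (tspace A) (tspace Q)) (H : hilbert R)
    (l : (AQ -> AQ) -> (H -> H))
    (r : (tspace B -> tspace B) -> (H -> H)) (xi : H),
    bimodule (vn_tensor AQ (talg A) (talg Q)) (talg B) l r /\
    (forall a x, talg A a -> talg Q x ->
       '[l (tens_op AQ a x) xi, xi] = trace A a * trace Q x) /\
    (forall y b, talg Q y -> talg B b ->
       '[l (tens_op AQ id y) (r b xi), xi] = trace Q y * trace B b) /\
    closure (lspan [set l T xi | T in vn_tensor AQ (talg A) (talg Q)]) = setT /\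
    closure (lspan [set u | exists y b, talg Q y /\ talg B b /\
                      u = l (tens_op AQ id y) (r b xi)]) = setT.

(* Main.v *)
From HB Require Import structures.
From mathcomp Require Import all_boot all_order all_algebra.
From mathcomp Require Import complex.
From mathcomp Require Import all_classical all_reals all_analysis.
From mathcomp Require Import ring lra.
Require Import Defs.

(**
An orbit equivalence gives a Hilbert space H on which A and Q act from the left
and B acts from the right, together with a vector xi.  The von Neumann coupling
is M, the commutant of Q on H; it contains A and the opposite of B, and these
commute.

The point is that H is a tensor product of the completion of A with the
completion of Q, and also of the completion of B with that of Q.  Let C be A or
the opposite of B, let pi and rho be the actions of C and Q, and let L be the
closure of the orbit of xi under C; L is the standard representation space of
C.  The state of xi is the product of the two traces, hence
<rho y e, rho z f> = <rho y xi, rho z xi> <e, f> for e and f in L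
[inner_tensor], which says that rho y e is the tensor product of y and e.  So
every bounded T on L has an amplification T (x) 1 in M, determined by its
restriction to L [amplification_exists, coupling_ext], and T |-> T (x) 1 is the
required embedding of B(L) in M [coupling_fundamental_domain].

Finite-rank projections p become finite projections because the commutant of Q
has a trace on the corner p (x) 1.  In terms of an orthonormal basis of the range
of p, it is the sum of the corresponding vector functionals, and the trace
property is inherited from the trace of Q by approximating v e_i by sums of
vectors rho y e_j [corner_trace_le].  If v* v = q and v v* <= q, then the
difference has trace zero and so vanishes [finite_below].  A central projection
z of M majorizes the finite projection z (p (x) 1), where p projects L onto the
line of xi; this one is not zero because xi is cyclic for pi and rho
[coupling_semifinite].

One half of the cyclicity has to be derived.  The hypothesis is that xi is cyclic
for the von Neumann tensor product of A and Q, whereas the argument for C = A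
uses that it is cyclic for the algebraic tensor product.  The bridge is that a
normal representation l of X'' satisfies l(X)' = l(X'')'
[commutant_normal_image].  Here normality means preservation of suprema of
increasing nets.  Following Dixmier, a vector functional of l is dominated, on
the corner cut out by a positive element found by Zorn's lemma, by a vector
functional of the given representation of X''.  This produces enough
intertwiners between the two representations [intertwiner_exists] to transport
commutation with X into commutation with X''.

Suprema of increasing nets are handled through Vigier's theorem [vigier]: in a
commutant they are limits of quadratic forms.  The passage from a to a (x) 1
preserves such limits [ampliation_weak_sup].
*)

Set Implicit Arguments.
Unset Strict Implicit.
Unset Printing Implicit Defensive.

Import Order.TTheory GRing.Theory Num.Theory.
Import numFieldNormedType.Exports.

Local Open Scope classical_set_scope.
Local Open Scope ring_scope.

(** * Inner products and bounded maps *)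

Section InnerProduct.
Variables (R : realType) (H : hilbert R).
Implicit Types (u v w : H) (a : R[i]).

Lemma innerC u v : '[u, v] = ('[v, u])^*.
Proof. by rewrite (hermC (inner H)) expr0 mul1r. Qed.

Lemma innerDl u v w : '[u + v, w] = '[u, w] + '[v, w].
Proof. exact: linearDl. Qed.

Lemma innerBl u v w : '[u - v, w] = '[u, w] - '[v, w].
Proof. exact: linearBl. Qed.

Lemma innerZl a u w : '[a *: u, w] = a * '[u, w].
Proof. exact: linearZl_LR. Qed.

Lemma innerDr u v w : '[w, u + v] = '[w, u] + '[w, v].
Proof. exact: linearDr. Qed.

Lemma innerBr u v w : '[w, u - v] = '[w, u] - '[w, v].
Proof. exact: linearBr. Qed.

Lemma innerZr a u w : '[w, a *: u] = a^* * '[w, u].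
Proof. exact: linearZr_LR. Qed.

Lemma inner0l u : '[0, u] = 0. Proof. exact: linear0l. Qed.
Lemma inner0r u : '[u, 0] = 0. Proof. exact: linear0r. Qed.

Lemma inner_suml (I : Type) (r : seq I) (P : pred I) (F : I -> H) w :
  '[\sum_(i <- r | P i) F i, w] = \sum_(i <- r | P i) '[F i, w].
Proof.
by rewrite (big_morph (fun u => '[u, w]) (fun x y => innerDl x y w) (inner0l w)).
Qed.

Lemma inner_sumr (I : Type) (r : seq I) (P : pred I) (F : I -> H) w :
  '[w, \sum_(i <- r | P i) F i] = \sum_(i <- r | P i) '[w, F i].
Proof.
by rewrite (big_morph (fun u => '[w, u]) (fun x y => innerDr x y w) (inner0r w)).
Qed.

Lemma inner_ge0 u : 0 <= '[u, u].
Proof. by rewrite -norm_inner exprn_ge0. Qed.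

Lemma inner_eq0 u : '[u, u] = 0 -> u = 0.
Proof. by rewrite -norm_inner => /eqP; rewrite expf_eq0 normr_eq0 => /eqP. Qed.

Lemma inner_extl u v : (forall w, '[u, w] = '[v, w]) -> u = v.
Proof.
move=> uv; apply/eqP; rewrite -subr_eq0; apply/eqP/inner_eq0.
by rewrite innerBl uv subrr.
Qed.

End InnerProduct.

Section Forms.
Variable (R : realType).

(** The Cauchy-Schwarz inequality in terms of the coefficients a, b, c of a
    nonnegative form on the span of two vectors: it serves both for the inner
    product and for the form of a positive operator. *)
Lemma discriminant (a b c : R[i]) : 0 <= a -> 0 <= c ->
  (forall s t : R[i],
     0 <= s * s^* * a + s * t^* * b + t * s^* * b^* + t * t^* * c) ->
  `|b| ^+ 2 <= a * c.
Proof.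
move=> a0 c0 h; rewrite normCK.
have ca := geC0_conj a0; have cc := geC0_conj c0.
(* s = c, t = - b, and then s = - b^*, t = a, settle the cases where c or a
   is not zero; if both are zero, s = 1 and t = - b give - 2 |b|^2 >= 0. *)
have hA : 0 <= c * (a * c - b * b^*).
  have := h c (- b); rewrite cc rmorphN /=.
  by congr (0 <= _); ring.
have hC : 0 <= a * (a * c - b * b^*).
  have := h (- b^*) a; rewrite ca rmorphN /= conjCK.
  by congr (0 <= _); ring.
move: a0; rewrite le0r => /orP[/eqP a0|a0]; last first.
  by move: hC; rewrite pmulr_rge0 // subr_ge0.
move: c0; rewrite le0r => /orP[/eqP c0|c0]; last first.
  by move: hA; rewrite pmulr_rge0 // subr_ge0.
have := h 1 (- b); rewrite a0 c0 !rmorphN rmorph1 /= !(mulr0, add0r, addr0, mul1r, mulr1).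
rewrite mulNr mulNr [b^* * b]mulrC -opprD oppr_ge0 -mulr2n -mulr_natr => hb.
rewrite -(@ler_pM2r _ 2%:R) ?ltr0n // mul0r; exact: hb.
Qed.

End Forms.

Section Norm.
Variables (R : realType) (H : hilbert R).
Implicit Types (u v w : H) (a : R[i]).

Lemma cauchy_schwarz u v : `|'[u, v]| <= `|u| * `|v|.
Proof.
rewrite -(@ler_pXn2r _ 2) // ?nnegrE ?mulr_ge0 // exprMn !norm_inner.
apply: discriminant; rewrite ?inner_ge0 // => s t.
have := inner_ge0 (s *: u + t *: v).
rewrite !(innerDl, innerDr, innerZl, innerZr) (innerC v u).
by congr (0 <= _); ring.
Qed.

End Norm.

Section BoundedMaps.
Variable (R : realType).

Lemma ler_mul_norm (x c y : R[i]) : 0 <= x -> 0 <= y -> x <= c * y -> x <= `|c| * y.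
Proof.
move=> x0 y0 xcy; rewrite -(ger0_norm y0) -normrM ger0_norm //.
exact: le_trans xcy.
Qed.

Definition bounded_map (H K : hilbert R) (T : H -> K) :=
  linear T /\ exists c : R[i], forall u, `|T u| <= c * `|u|.

Section Basics.
Variables (H K : hilbert R) (T : H -> K).
Hypothesis bT : bounded_map T.

Lemma bmapP a u v : T (a *: u + v) = a *: T u + T v. Proof. exact: bT.1. Qed.
Lemma bmap0 : T 0 = 0.
Proof. by have := bmapP (-1) 0 0; rewrite !scaleN1r oppr0 addr0 addNr. Qed.
Lemma bmapZ a u : T (a *: u) = a *: T u.
Proof. by rewrite -[a *: u]addr0 bmapP bmap0 addr0. Qed.
Lemma bmapD u v : T (u + v) = T u + T v.
Proof. by rewrite -[u]scale1r bmapP !scale1r. Qed.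
Lemma bmapN u : T (- u) = - T u. Proof. by rewrite -scaleN1r bmapZ scaleN1r. Qed.
Lemma bmapB u v : T (u - v) = T u - T v. Proof. by rewrite bmapD bmapN. Qed.
Lemma bmap_sum (I : Type) (r : seq I) (P : pred I) (F : I -> H) :
  T (\sum_(i <- r | P i) F i) = \sum_(i <- r | P i) T (F i).
Proof. by rewrite (big_morph T bmapD bmap0). Qed.

Lemma bmap_bound : exists2 c : R[i], 0 < c & forall u, `|T u| <= c * `|u|.
Proof.
have [_ [c cP]] := bT; exists (`|c| + 1); first by rewrite ltr_wpDl.
move=> u; apply: le_trans (_ : `|c| * `|u| <= _); last by rewrite ler_wpM2r ?lerDl.
exact: ler_mul_norm.
Qed.

End Basics.

Lemma bmap_id (H : hilbert R) : bounded_map (id : H -> H).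
Proof. by split => //; exists 1 => u; rewrite mul1r. Qed.

Lemma bmap_cst0 (H K : hilbert R) : bounded_map (cst 0 : H -> K).
Proof.
split; first by move=> a u v; rewrite scaler0 addr0.
by exists 0 => u; rewrite normr0 mul0r.
Qed.

Lemma bmap_comp (H K L : hilbert R) (T : H -> K) (S : K -> L) :
  bounded_map T -> bounded_map S -> bounded_map (S \o T).
Proof.
move=> bT bS; split; first by move=> a u v /=; rewrite bmapP // bmapP.
have [c c0 cP] := bmap_bound bT; have [d d0 dP] := bmap_bound bS.
exists (d * c) => u /=; apply: le_trans (dP _) _.
by rewrite -mulrA ler_wpM2l // ltW.
Qed.

Lemma bmap_add (H K : hilbert R) (S T : H -> K) :
  bounded_map S -> bounded_map T -> bounded_map (S \+ T).
Proof.
move=> bS bT; split; first by move=> a u v /=; rewrite (bmapP bS) (bmapP bT) scalerDr addrACA.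
have [c c0 cP] := bmap_bound bS; have [d d0 dP] := bmap_bound bT.
by exists (c + d) => u /=; apply: le_trans (ler_normD _ _) _; rewrite mulrDl lerD.
Qed.

Lemma bmap_scale (H K : hilbert R) (a : R[i]) (S : H -> K) :
  bounded_map S -> bounded_map (fun u => a *: S u).
Proof.
move=> bS; split.
  by move=> b u v /=; rewrite (bmapP bS) scalerDr !scalerA mulrC.
have [c c0 cP] := bmap_bound bS.
by exists (`|a| * c) => u; rewrite normrZ -mulrA ler_wpM2l.
Qed.

Lemma bmap_sub (H K : hilbert R) (S T : H -> K) :
  bounded_map S -> bounded_map T -> bounded_map (S \- T).
Proof.
move=> bS bT; have -> : S \- T = S \+ (fun u => (-1) *: T u).
  by apply/funext => u /=; rewrite scaleN1r.
by apply/bmap_add/bmap_scale.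
Qed.

End BoundedMaps.

Section Closure.
Variables (R : realType).

Lemma closureP (H : hilbert R) (X : set H) u : closure X u <->
  forall e : R[i], 0 < e -> exists2 v, X v & `|u - v| < e.
Proof.
split.
  move=> Xu e e0; have /Xu[v [Xv uv]] : nbhs u (ball u e) by exact: nbhsx_ballx.
  by exists v => //; rewrite -ball_normE in uv.
move=> h A /nbhs_ballP[e e0 eA]; have [v Xv uv] := h e e0.
by exists v; split => //; apply: eA; rewrite -ball_normE.
Qed.

Definition subspace_of (H : hilbert R) (X : set H) :=
  X 0 /\ forall a u v, X u -> X v -> X (a *: u + v).

Section Subspace.
Variables (H : hilbert R) (X : set H).
Hypothesis sX : subspace_of X.

Lemma subspaceZ a u : X u -> X (a *: u).
Proof. by case: sX => X0 XP Xu; rewrite -[_ *: _]addr0; exact: XP. Qed.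

Lemma subspaceD u v : X u -> X v -> X (u + v).
Proof. by case: sX => X0 XP Xu Xv; rewrite -[u]scale1r; exact: XP. Qed.

Lemma subspaceB u v : X u -> X v -> X (u - v).
Proof. by move=> Xu Xv; rewrite -scaleN1r addrC; case: sX => _; exact. Qed.

End Subspace.

Lemma subspace_sum (H : hilbert R) (X : set H) n (c : 'I_n -> R[i]) (x : 'I_n -> H) :
  subspace_of X -> (forall i, X (x i)) -> X (\sum_i c i *: x i).
Proof.
move=> [X0 XP] Xx; elim/big_ind: _ => // [u v Xu Xv|i _].
  by rewrite -[u]scale1r; apply: XP.
by rewrite -[_ *: _]addr0; apply: XP.
Qed.

Lemma lspan_sub (H : hilbert R) (X Y : set H) :
  subspace_of Y -> X `<=` Y -> lspan X `<=` Y.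
Proof. by move=> sY XY u [n [c [x [Xx ->]]]]; apply: subspace_sum => // i; apply/XY. Qed.

Lemma sub_lspan (H : hilbert R) (X : set H) : X `<=` lspan X.
Proof.
by move=> u Xu; exists 1%N, (fun=> 1), (fun=> u); rewrite big_ord1 scale1r.
Qed.

Lemma subspace_closure (H : hilbert R) (X : set H) :
  subspace_of X -> subspace_of (closure X).
Proof.
move=> [X0 XP]; split; first exact: subset_closure.
move=> a u v /closureP Xu /closureP Xv; apply/closureP => e e0.
have d0 : 0 < `|a| + 1 by rewrite ltr_wpDl.
have [u' Xu' uu'] := Xu (e / (`|a| + 1)) (divr_gt0 e0 d0) .
have := Xu (e / 2 / (`|a| + 1)); case; first by rewrite !divr_gt0.
move=> {Xu'} {}u' Xu' {}uu'; have := Xv (e / 2); case; first by rewrite divr_gt0.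
move=> v' Xv' vv'; exists (a *: u' + v'); first exact: XP.
rewrite opprD addrACA -scalerBr; apply: le_lt_trans (ler_normD _ _) _.
rewrite [ltRHS](splitr e) ler_ltD // normrZ.
apply: le_trans (_ : (`|a| + 1) * `|u - u'| <= _); first by rewrite ler_wpM2r // lerDl.
by rewrite mulrC -ler_pdivlMr // ltW.
Qed.

Lemma closure_sub_closed (H : hilbert R) (X Y : set H) :
  closed Y -> X `<=` Y -> closure X `<=` Y.
Proof. by move=> /closure_id {2}-> XY; exact: closureS. Qed.

Lemma closed_eq_bmap (H K : hilbert R) (S T : H -> K) :
  bounded_map S -> bounded_map T -> closed [set u | S u = T u].
Proof.
move=> bS bT u /closureP h; have bST := bmap_sub bS bT.
have [c c0 cP] := bmap_bound bST; apply/eqP; rewrite -subr_eq0 -normr_le0.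
apply/ler_addgt0Pl => e e0; rewrite addr0.
have [v /= vE uv] := h (e / c) (divr_gt0 e0 c0).
have -> : S u - T u = (S \- T) (u - v) by rewrite bmapB //= vE subrr subr0.
by apply: le_trans (cP _) _; rewrite mulrC -ler_pdivlMr // ltW.
Qed.

Lemma closed_inner (H : hilbert R) (v : H) : closed [set u : H | '[u, v] = 0].
Proof.
move=> u /closureP h; apply/eqP; rewrite -normr_le0.
apply/ler_addgt0Pl => e e0; rewrite addr0.
have d0 : 0 < `|v| + 1 by rewrite ltr_wpDl.
have [w /= wE uw] := h (e / (`|v| + 1)) (divr_gt0 e0 d0).
have -> : '[u, v] = '[u - w, v] by rewrite innerBl wE subr0.
apply: le_trans (cauchy_schwarz _ _) _.
apply: le_trans (_ : `|u - w| * (`|v| + 1) <= _); first by rewrite ler_wpM2l // lerDl.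
by rewrite -ler_pdivlMr // ltW.
Qed.

End Closure.

Section ClosureInduction.
Variables (R : realType) (H K : hilbert R).

Lemma closure_inner0 (X : set H) u v :
  (forall x, X x -> '[x, v] = 0) -> closure X u -> '[u, v] = 0.
Proof.
move=> h; exact: (@closure_sub_closed R H X [set x | '[x, v] = 0] (@closed_inner R H v) h u).
Qed.

Lemma closure_bmap_eq (X : set H) (S T : H -> K) u : bounded_map S -> bounded_map T ->
  (forall x, X x -> S x = T x) -> closure X u -> S u = T u.
Proof.
move=> bS bT h.
exact: (@closure_sub_closed R H X [set x | S x = T x] (closed_eq_bmap bS bT) h u).
Qed.

End ClosureInduction.

(** * Nearest points, Riesz representation and extension of maps *)

Section Scalars.
Variable R : realType.
Local Notation re := (@complex.Re R).
Local Notation im := (@complex.Im R).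
Local Open Scope complex_scope.

Lemma re_le (x y : R[i]) : x <= y -> re x <= re y.
Proof. by rewrite lecE => /andP[]. Qed.

Lemma re_lt (x y : R[i]) : x < y -> re x < re y.
Proof. by rewrite ltcE => /andP[]. Qed.

Lemma reD (x y : R[i]) : re (x + y) = re x + re y.
Proof. by case: x y => a b [c d]. Qed.

Lemma reN (x : R[i]) : re (- x) = - re x.
Proof. by case: x. Qed.

Lemma reB (x y : R[i]) : re (x - y) = re x - re y.
Proof. by rewrite reD reN. Qed.

Lemma reZ (a : R) (x : R[i]) : re (a%:C * x) = a * re x.
Proof. by case: x => c d /=; rewrite mul0r subr0. Qed.

Lemma re_conj (x : R[i]) : re (x^*)%R = re x.
Proof. by case: x. Qed.

Lemma reK (x : R[i]) : 0 <= x -> (re x)%:C = x.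
Proof. by move=> /ger0_real; exact: RRe_real. Qed.

Lemma re_sum (I : Type) (r : seq I) (P : pred I) (F : I -> R[i]) :
  re (\sum_(i <- r | P i) F i) = \sum_(i <- r | P i) re (F i).
Proof. by rewrite (big_morph re reD (erefl : re 0 = 0)). Qed.

End Scalars.

Section Completeness.
Variables (R : realType) (H : hilbert R).
Local Notation re := (@complex.Re R).
Local Open Scope complex_scope.

(** Completeness is used only through this form of Cantor's intersection theorem:
    nearest points, extensions by continuity and limits of nets of operators all
    come with a filter basis. *)
Lemma cantor_intersection (I : Type) (D : set I) (B : I -> set H) :
  D !=set0 ->
  (forall i j, D i -> D j -> exists2 k, D k & B k `<=` B i `&` B j) ->
  (forall i, D i -> B i !=set0) ->
  (forall e : R[i], 0 < e -> exists2 i, D i &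
     forall u v, B i u -> B i v -> `|u - v| < e) ->
  exists l : H, forall i, D i -> closure (B i) l.
Proof.
move=> D0 Ddir B0 Bsmall; pose F := filter_from D B.
have FF : Filter F by apply: filter_from_filter.
have PF : ProperFilter F by apply: filter_from_proper.
have : cauchy F.
  apply: cauchy_exP => e e0; have [i Di small] := Bsmall e e0.
  have [u Bu] := B0 i Di; exists u; exists i => // v Bv.
  by rewrite -ball_normE; exact: small.
move=> /cauchy_cvg Fl; exists (lim F) => i Di A lA.
have [j Dj BjA] : F A by exact: Fl.
have [k Dk kij] := Ddir i j Di Dj; have [u Bu] := B0 k Dk.
by exists u; have [Biu Bju] := kij u Bu; split => //; exact: BjA.
Qed.

Definition nsq (u : H) : R := re '[u, u].

Lemma nsqE u : (nsq u)%:C = `|u| ^+ 2.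
Proof. by rewrite reK ?inner_ge0 // norm_inner. Qed.

Lemma nsq_lt u (e : R) : 0 <= e -> nsq u < e ^+ 2 -> `|u| < e%:C.
Proof.
move=> e0 h; rewrite -(@ltr_pXn2r _ 2) ?nnegrE ?ler0c // -nsqE.
by rewrite -rmorphXn ltcR.
Qed.

Lemma nsq_ge0 u : 0 <= nsq u.
Proof. exact: (re_le (inner_ge0 u)). Qed.

Lemma nsqD u v : nsq (u + v) = nsq u + 2 * re '[u, v] + nsq v.
Proof.
rewrite /nsq innerDl !innerDr !reD (innerC v u) re_conj; ring.
Qed.

Lemma nsqZ (a : R) u : nsq (a%:C *: u) = a ^+ 2 * nsq u.
Proof.
rewrite /nsq innerZl innerZr reZ; have -> : (a%:C)^*%R = a%:C.
  exact: conjc_real.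
by rewrite reZ mulrA expr2.
Qed.

Lemma nsqN u : nsq (- u) = nsq u.
Proof. by rewrite /nsq -scaleN1r innerZl innerZr !rmorphN rmorph1 !mulN1r opprK. Qed.

Lemma nsqB u v : nsq (u - v) = nsq u - 2 * re '[u, v] + nsq v.
Proof. by rewrite nsqD nsqN -scaleN1r innerZr !rmorphN rmorph1 mulN1r reN; ring. Qed.

(** The vectors of X that nearly minimize the distance to u form small sets, by
    the parallelogram law. *)
Lemma projection_theorem (X : set H) (u : H) : subspace_of X -> closed X ->
  exists2 e, X e & forall v, X v -> '[u - e, v] = 0.
Proof.
move=> sX cX; have [X0 XP] := sX.
pose E := [set nsq (u - v) | v in X].
have hE : has_inf E.
  split; first by exists (nsq (u - 0)), 0.
  by exists 0 => _ [v Xv <-]; exact: nsq_ge0.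
pose d := inf E.
have dle v : X v -> d <= nsq (u - v).
  by move=> Xv; apply: ge_inf; [exact: hE.2 | exists v].
pose B (e : R) := [set v | X v /\ nsq (u - v) < d + e].
have Bpar e v w : B e v -> B e w -> nsq (v - w) < 4 * e.
  move=> [Xv dv] [Xw dw].
  have Xm : X (2^-1%:C *: (v + w)) by apply: subspaceZ => //; exact: subspaceD.
  have := dle _ Xm; rewrite -(ler_pM2l (_ : 0 < 4)) //.
  have -> : 4 * nsq (u - 2^-1%:C *: (v + w)) = nsq ((u - v) + (u - w)).
    rewrite (_ : 4 = 2 ^+ 2) -?nsqZ; last by ring.
    rewrite scalerBr scalerA -rmorphM /= mulfV // scale1r opprD addrACA.
    by rewrite rmorphMn /= scaler_nat mulr2n.
  have -> : v - w = (u - w) - (u - v) by rewrite [RHS]addrC opprB subrKA.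
  by rewrite nsqB nsqD (innerC (u - w)) re_conj; lra.
have [|i j i0 j0|i i0|e e0|e eP] := @cantor_intersection R [set e | 0 < e] B.
- by exists 1 => /=.
- exists (Num.min i j) => [|v [Xv]]; first by rewrite /= lt_min i0.
  by move=> h; split; split => //; apply: lt_le_trans h _; rewrite lerD2l ge_min lexx ?orbT.
- have [_ [v Xv <-] vd] := inf_adherent i0 hE.
  by exists v.
- have re0 : 0 < re e := re_lt e0.
  exists (re e ^+ 2 / 4) => [|v w Bv Bw]; first by rewrite /= divr_gt0 ?exprn_gt0.
  rewrite -(reK (ltW e0)); apply: nsq_lt; first exact: ltW.
  by apply: lt_le_trans (Bpar _ _ _ Bv Bw) _; rewrite mulrC divfK.
have Xe : X e.
  have X1 := eP 1 ltr01.
  by apply: closure_sub_closed X1 => // v [].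
have de : nsq (u - e) <= d.
  apply/ler_addgt0Pl => k k0; rewrite [leRHS]addrC.
  have dk : 0 <= d + k.
    rewrite addr_ge0 ?(ltW k0) //; apply: lb_le_inf; first exact: hE.1.
    by move=> _ [v _ <-]; exact: nsq_ge0.
  rewrite -lecR nsqE -[leRHS]/(real_complex _ (d + k)) -(sqr_sqrtr dk) rmorphXn /=.
  rewrite ler_pXn2r ?nnegrE ?ler0c ?sqrtr_ge0 //.
  apply/ler_addgt0Pl => a a0; have /closureP/(_ _ a0)[w [Xw wd] ew] := eP k k0.
  have -> : u - e = (w - e) + (u - w) by rewrite [RHS]addrC subrKA.
  apply: le_trans (ler_normD _ _) _; rewrite lerD //; first by rewrite distrC ltW.
  rewrite ltW //; apply: nsq_lt; first exact: sqrtr_ge0.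
  by rewrite sqr_sqrtr.
exists e => // v Xv; set b := '[u - e, v].
(* Moving from e along v does not decrease the distance to u.  The step s b
   with s = 1 / (|v|^2 + 1) then forces b = 0. *)
have key (a : R[i]) : 2 * re (a^*%R * b) <= nsq (a *: v).
  have := dle (e + a *: v); rewrite opprD addrA nsqB innerZr -/b.
  move=> /(_ _); have Xav : X (e + a *: v) by apply: subspaceD => //; apply: subspaceZ.
  by move=> /(_ Xav); lra.
pose s := (nsq v + 1)^-1; have s0 : 0 < s by rewrite invr_gt0 ltr_wpDl ?nsq_ge0.
have := key (s%:C * b); rewrite -scalerA nsqZ /nsq innerZl innerZr.
have -> : (s%:C * b)^*%R * b = s%:C * `|b| ^+ 2.
  by rewrite rmorphM /= normCKC -mulrA; congr (_ * _); exact: conjc_real.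
rewrite reZ [b * _]mulrA -normCK -norm_inner -nsqE mulrC.
have := add_Re2_Im2 b; set m := _ + _ => mE.
have m0 : 0 <= m by rewrite addr_ge0 ?sqr_ge0.
rewrite -mE -rmorphM /= expr2 => h.
have : 2 * m <= s * nsq v * m by rewrite -(ler_pM2l s0); lra.
have : s * nsq v <= 1 by rewrite /s mulrC ler_pdivrMr ?mul1r ?lerDl // ltr_wpDl ?nsq_ge0.
move=> sv h2; have : s * nsq v * m <= m by rewrite -[leRHS]mul1r ler_wpM2r.
move=> h3; have m00 : m = 0 by apply/eqP; rewrite eq_le m0 andbT; lra.
by move: mE; rewrite m00 => /esym/eqP; rewrite expf_eq0 normr_eq0 => /eqP.
Qed.

End Completeness.

Section Riesz.
Variable R : realType.
Local Open Scope complex_scope.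

(** The representing vector is a multiple of the component, orthogonal to the
    kernel of f, of a vector outside this kernel. *)
Lemma riesz (H : hilbert R) (f : H -> R[i]) :
  (forall a u v, f (a *: u + v) = a * f u + f v) ->
  (exists c, forall u, `|f u| <= c * `|u|) ->
  exists w, forall u, f u = '[u, w].
Proof.
move=> fP [c cP]; have f0 : f 0 = 0.
  by have := fP (-1) 0 0; rewrite scaler0 addr0 mulN1r addNr.
have fZ a u : f (a *: u) = a * f u by rewrite -[a *: u]addr0 fP f0 addr0.
have fB u v : f (u - v) = f u - f v by rewrite -scaleN1r addrC fP mulN1r addrC.
pose X := [set u | f u = 0].
have sX : subspace_of X.
  by split => //= a u v /= fu fv; rewrite /X /= fP fu fv mulr0 addr0.
have cX : closed X.
  move=> u /closureP h; apply/eqP; rewrite -normr_le0.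
  apply/ler_addgt0Pl => e e0; rewrite addr0.
  have d0 : 0 < `|c| + 1 by rewrite ltr_wpDl.
  have [w /= wE uw] := h (e / (`|c| + 1)) (divr_gt0 e0 d0).
  have -> : f u = f (u - w) by rewrite fB wE subr0.
  apply: le_trans (ler_mul_norm _ _ (cP _)) _ => //.
  apply: le_trans (_ : (`|c| + 1) * `|u - w| <= _); first by rewrite ler_wpM2r ?lerDl.
  by rewrite mulrC -ler_pdivlMr // ltW.
have [all0|] := pselect (forall u, f u = 0); first by exists 0 => u; rewrite inner0r.
move=> /existsNP[u0 /eqP fu0].
have [e Xe eP] := projection_theorem u0 sX cX.
pose z := u0 - e; have fz : f z = f u0 by rewrite fB Xe subr0.
have zz : '[z, z] != 0.
  by apply/eqP => /inner_eq0 z0; move: fu0; rewrite -fz z0 f0 eqxx.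
exists ((f z / '[z, z])^*%R *: z) => u.
rewrite innerZr conjCK.
have -> : '[u, z] = f u / f z * '[z, z]; last by rewrite -fz in fu0; field; rewrite fu0.
have Xu : X (u - (f u / f z) *: z) by rewrite /X /= fB fZ divfK ?subrr // fz.
have := eP _ Xu; rewrite -/z innerC innerBl innerZl => /eqP.
by rewrite conjC_eq0 subr_eq0 => /eqP.
Qed.

Lemma adjoint_exists (H K : hilbert R) (T : H -> K) : bounded_map T ->
  exists2 S : K -> H, bounded_map S & forall u v, '[T u, v] = '[u, S v].
Proof.
move=> bT; have [c c0 cP] := bmap_bound bT.
have ex v : exists w, forall u, '[T u, v] = '[u, w].
  apply: riesz; first by move=> a x y; rewrite (bmapP bT) innerDl innerZl.
  exists (c * `|v|) => u; apply: le_trans (cauchy_schwarz _ _) _.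
  by rewrite mulrAC ler_wpM2r.
have [S SP] := choice ex; exists S => //; split.
  move=> a x y; apply: inner_extl => w.
  rewrite innerDl innerZl !(innerC (S _)) -!SP innerDr innerZr rmorphD rmorphM.
  by rewrite /= conjCK.
exists c => v; have [->|] := eqVneq (S v) 0; first by rewrite normr0 mulr_ge0 // ltW.
rewrite -normr_gt0 => Sv; rewrite -(ler_pM2l Sv) -expr2 norm_inner -SP.
rewrite -[leLHS]ger0_norm ?SP ?inner_ge0 // -SP.
apply: le_trans (cauchy_schwarz _ _) _.
by rewrite mulrCA mulrA ler_wpM2r.
Qed.

(** Extension by continuity to the closure of the domain, and by zero on its
    orthogonal complement.  The data is a relation because in the applications
    each pair is given by parameters that are not determined by its first
    component; that it is a function follows from the bound. *)
Lemma bounded_extension (H K : hilbert R) (G : H -> K -> Prop) :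
  G 0 0 -> (forall a u v u' v', G u v -> G u' v' -> G (a *: u + u') (a *: v + v')) ->
  (exists c, forall u v, G u v -> `|v| <= c * `|u|) ->
  exists W : H -> K, [/\ bounded_map W, forall u v, G u v -> W u = v &
    forall u, (forall x y, G x y -> '[u, x] = 0) -> W u = 0].
Proof.
move=> G0 GP [c' cP']; pose c := `|c'| + 1; have c0 : 0 < c by rewrite ltr_wpDl.
have cP u v : G u v -> `|v| <= c * `|u|.
  move=> /cP' h; apply: le_trans (_ : `|c'| * `|u| <= _); last by rewrite ler_wpM2r ?lerDl.
  exact: ler_mul_norm.
have GZ a u v : G u v -> G (a *: u) (a *: v).
  by move=> Guv; rewrite -[a *: u]addr0 -[a *: v]addr0; exact: GP.
have GB u v u' v' : G u v -> G u' v' -> G (u - u') (v - v').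
  move=> Guv Guv'; have -> : u - u' = -1 *: u' + u by rewrite scaleN1r addrC.
  have -> : v - v' = -1 *: v' + v by rewrite scaleN1r addrC.
  exact: (GP (-1) u' v' u v Guv' Guv).
pose D := [set x | exists y, G x y].
have sD : subspace_of D.
  split; first by exists 0.
  by move=> a u u' [v Gv] [v' Gv']; exists (a *: v + v'); exact: GP.
(* Gc is the closure of G, and Wr composes it with the projection onto the
   closure of the domain. *)
pose Gc u v := forall e, 0 < e -> exists x y, [/\ G x y, `|u - x| < e & `|v - y| < e].
have GcD a u v u' v' : Gc u v -> Gc u' v' -> Gc (a *: u + u') (a *: v + v').
  move=> h h' e e0; have d0 : 0 < `|a| + 1 by rewrite ltr_wpDl.
  have [|x [y [Gxy ux vy]]] := h (e / 2 / (`|a| + 1)); first by rewrite !divr_gt0.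
  have [|x' [y' [Gxy' ux' vy']]] := h' (e / 2); first by rewrite divr_gt0.
  exists (a *: x + x'), (a *: y + y'); split; first exact: GP.
  - rewrite opprD addrACA -scalerBr; apply: le_lt_trans (ler_normD _ _) _.
    rewrite [ltRHS](splitr e) ler_ltD // normrZ.
    apply: le_trans (_ : (`|a| + 1) * `|u - x| <= _); first by rewrite ler_wpM2r // lerDl.
    by rewrite mulrC -ler_pdivlMr // ltW.
  - rewrite opprD addrACA -scalerBr; apply: le_lt_trans (ler_normD _ _) _.
    rewrite [ltRHS](splitr e) ler_ltD // normrZ.
    apply: le_trans (_ : (`|a| + 1) * `|v - y| <= _); first by rewrite ler_wpM2r // lerDl.
    by rewrite mulrC -ler_pdivlMr // ltW.
have GcN u v : Gc u v -> `|v| <= c * `|u|.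
  move=> h; apply/ler_addgt0Pl => e e0.
  have d0 : 0 < c + 1 by rewrite ltr_wpDl // ltW.
  have [x [y [Gxy ux vy]]] := h (e / (c + 1)) (divr_gt0 e0 d0).
  rewrite -[v](subrK y); apply: le_trans (ler_normD _ _) _.
  apply: le_trans (_ : `|v - y| + c * (`|x - u| + `|u|) <= _).
    rewrite lerD2l; apply: le_trans (cP _ _ Gxy) _; rewrite ler_wpM2l ?(ltW c0) //.
    by rewrite -{1}[x](subrK u) ler_normD.
  rewrite mulrDr addrA lerD2r distrC in ux *.
  have -> : e = e / (c + 1) + c * (e / (c + 1)) by field; rewrite lt0r_neq0.
  by rewrite lerD ?ler_wpM2l // ltW.
have GcE e : closure D e -> exists v, Gc e v.
  move=> /closureP De.
  pose B (k : R[i]) := [set y | exists x, G x y /\ `|e - x| < k].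
  have [|i j i0 j0|i i0|k k0|v vP] := @cantor_intersection R K _ [set k | 0 < k] B.
  - by exists 1 => /=.
  - have /orP[ij|ji] : (i <= j) || (j <= i) by exact: ge0_lec_total (ltW i0) (ltW j0).
      by exists i => // y [x [Gxy ex]]; split; exists x; split => //; exact: lt_le_trans ij.
    by exists j => // y [x [Gxy ex]]; split; exists x; split => //; exact: lt_le_trans ji.
  - by have [x [y Gxy] ex] := De i i0; exists y, x.
  - exists (k / 2 / c); first by rewrite /= !divr_gt0.
    move=> y y' [x [Gxy ex]] [x' [Gxy' ex']].
    apply: le_lt_trans (cP _ _ (GB _ _ _ _ Gxy Gxy')) _.
    rewrite mulrC -ltr_pdivlMr // -[x](subrK e) -addrA.
    apply: le_lt_trans (ler_normD _ _) _; rewrite distrC.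
    have -> : k / c = k / 2 / c + k / 2 / c by rewrite -mulrDl -splitr.
    exact: ltrD.
  exists v => k k0; have /closureP/(_ k k0)[y [x [Gxy ex]] vy] := vP k k0.
  by exists x, y; split.
pose Wr u v := exists e, [/\ closure D e, forall x, D x -> '[u - e, x] = 0 & Gc e v].
have Wtot u : exists v, Wr u v.
  have [e De eP] := projection_theorem u (subspace_closure sD) (@closed_closure _ D).
  have [v Gv] := GcE e De; exists v, e; split => // x Dx.
  by apply: eP; exact: subset_closure.
have orth w : (forall x, D x -> '[w, x] = 0) -> forall x, closure D x -> '[x, w] = 0.
  move=> h; apply: closure_sub_closed; first exact: closed_inner.
  by move=> x /h /= wx; rewrite innerC wx rmorph0.
have WrD a u v u' v' : Wr u v -> Wr u' v' -> Wr (a *: u + u') (a *: v + v').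
  move=> [e [De eP Ge]] [e' [De' eP' Ge']]; exists (a *: e + e'); split.
  - by apply: (subspace_closure sD).2.
  - move=> x Dx; rewrite opprD addrACA -scalerBr innerDl innerZl.
    by rewrite eP // eP' // mulr0 addr0.
  - exact: GcD.
have WrN u v : Wr u v -> `|v| <= c * `|u|.
  move=> [e [De eP Ge]]; apply: le_trans (GcN _ _ Ge) _; rewrite ler_wpM2l ?(ltW c0) //.
  have ee : '[e, e] = '[u, e].
    by apply/eqP; rewrite eq_sym -subr_eq0 -innerBl innerC orth ?rmorph0.
  have [->|] := eqVneq e 0; first by rewrite normr0.
  rewrite -normr_gt0 => e0; rewrite -(ler_pM2r e0) -expr2 norm_inner ee.
  rewrite -[leLHS]ger0_norm -?ee ?inner_ge0 // ee.
  exact: cauchy_schwarz.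
have [W WP] := choice Wtot.
have Wuniq u v : Wr u v -> W u = v.
  move=> h; apply/eqP; rewrite -subr_eq0 -normr_le0.
  have := WrD (-1) _ _ _ _ h (WP u); rewrite !scaleN1r addNr => /WrN.
  by rewrite normr0 mulr0 addrC.
exists W; split.
- split; last by exists c => u; exact: WrN (WP u).
  by move=> a u v; apply: Wuniq; apply: WrD.
- move=> u v Guv; apply: Wuniq; exists u; split.
  + by apply: subset_closure; exists v.
  + by move=> x _; rewrite subrr inner0l.
  + by move=> e e0; exists u, v; rewrite !subrr !normr0.
- move=> u h; apply: Wuniq; exists 0; split.
  + exact: (subspace_closure sD).1.
  + by move=> x [y Gxy]; rewrite subr0; exact: h Gxy.
  + by move=> e e0; exists 0, 0; rewrite !subrr !normr0.
Qed.

Lemma bmap_eq_on_dense (H K : hilbert R) (S T : H -> K) (X : set H) :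
  bounded_map S -> bounded_map T -> closure X = setT ->
  (forall u, X u -> S u = T u) -> S = T.
Proof.
move=> bS bT X1 XST; apply/funext => u.
have : closure X u by rewrite X1.
exact: closure_sub_closed (closed_eq_bmap bS bT) _ _.
Qed.

End Riesz.

Local Open Scope complex_scope.

(** * Order and commutants of operators, Vigier's theorem *)

Section ScalarLimits.
Variable R : realType.
Implicit Types x y : R[i].

Lemma ge0_approx x :
  (forall e : R[i], 0 < e -> exists2 y, 0 <= y & `|x - y| <= e) -> 0 <= x.
Proof.
move=> h; have im_le (z : R[i]) : `|complex.Im z| <= complex.Re `|z|.
  by rewrite normc_def /= -sqrtr_sqr ler_wsqrtr // lerDr sqr_ge0.
have re_le' (z : R[i]) : `|complex.Re z| <= complex.Re `|z| := re_le (normc_ge_Re z).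
rewrite lecE; apply/andP; split.
  rewrite -normr_le0; apply/ler_addgt0Pl => e e0; rewrite addr0.
  have [|y y0 xy] := h e%:C; first by rewrite ltcR.
  have -> : complex.Im x = complex.Im (x - y).
    by move: y0; rewrite lecE => /andP[/eqP]; case: (x) (y) => a b [c d] /= ->; rewrite subr0.
  exact: le_trans (im_le _) (re_le xy).
rewrite -oppr_le0; apply/ler_addgt0Pl => e e0; rewrite addr0.
have [|y y0 xy] := h e%:C; first by rewrite ltcR.
have := re_le xy; have := re_le y0; have := re_le' (x - y).
by rewrite reB ler_norml /= => /andP[]; lra.
Qed.

Lemma lec_addgt0 x y : (forall e : R, 0 < e -> x <= y + e%:C) -> x <= y.
Proof.
move=> h; apply/ler_addgt0Pl => e e0; rewrite addrC -(reK (ltW e0)).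
by apply: h; exact: (re_lt e0).
Qed.

End ScalarLimits.

Section OperatorAlgebra.
Variables (R : realType) (H : hilbert R).
Implicit Types (S T U : H -> H) (X M D : set (H -> H)).

Lemma adjC S T : is_adjoint S T -> is_adjoint T S.
Proof.
move=> [bS [bT ST]]; split=> //; split=> // u v.
by rewrite innerC -ST -innerC.
Qed.

Lemma adj_exists S : bounded_op S -> exists T, is_adjoint S T.
Proof. by move=> bS; have [T bT ST] := adjoint_exists bS; exists T. Qed.

Lemma adj_uniq S T T' : is_adjoint S T -> is_adjoint S T' -> T = T'.
Proof.
move=> /adjC[_ [_ h]] /adjC[_ [_ h']]; apply/funext => u; apply: inner_extl => v.
by rewrite h h'.
Qed.

Lemma adj_comp S S' T T' : is_adjoint S S' -> is_adjoint T T' ->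
  is_adjoint (S \o T) (T' \o S').
Proof.
move=> [bS [bS' h]] [bT [bT' k]]; split; first exact: bmap_comp.
by split=> [|u v /=]; [exact: bmap_comp | rewrite h k].
Qed.

Lemma adj_add S S' T T' : is_adjoint S S' -> is_adjoint T T' ->
  is_adjoint (S \+ T) (S' \+ T').
Proof.
move=> [bS [bS' h]] [bT [bT' k]]; split; first exact: bmap_add.
by split=> [|u v /=]; [exact: bmap_add | rewrite innerDl innerDr h k].
Qed.

Lemma adj_id : is_adjoint (id : H -> H) id.
Proof. by split; [|split=> //]; exact: bmap_id. Qed.

(** Over the complex numbers the quadratic form determines the operator: compare
    its values at u + v and at u + i v. *)
Lemma polarization S : bounded_op S -> (forall u, '[S u, u] = 0) -> S = cst 0.
Proof.
move=> bS S0; apply/funext => u; apply: inner_extl => v; rewrite inner0l.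
have h1 := S0 (u + v); have h2 := S0 (u + ('i%C : R[i]) *: v).
move: h1 h2; rewrite !(bmapD bS) (bmapZ bS) !innerDl !innerDr !innerZl !innerZr !S0.
rewrite !(mulr0, add0r, addr0) => h1.
have -> : ('i%C : R[i])^*%R = - 'i%C by apply/eqP; rewrite eq_complex /= oppr0 !eqxx.
rewrite mulNr => h2.
have /eqP : 'i%C * (('[S v, u] - '[S u, v]) : R[i]) = 0 by rewrite mulrBr addrC.
rewrite mulf_eq0 => /orP[|].
  by rewrite eq_complex /= oner_eq0 andbF.
rewrite subr_eq0 => /eqP e; move: h1; rewrite e -mulr2n => /eqP.
by rewrite mulrn_eq0 /= => /eqP.
Qed.

Lemma op_ge0_adj S : bounded_op S -> (forall u, 0 <= '[S u, u]) -> is_adjoint S S.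
Proof.
move=> bS S0; have [T ST] := adj_exists bS; have [_ [bT h]] := ST.
suff TS : S = T by rewrite -TS in ST.
have TS : S \- T = cst 0.
  apply: polarization; first exact: bmap_sub.
  move=> u /=; rewrite innerBl [X in _ - X]innerC -h.
  by rewrite [X in _ - X](geC0_conj (S0 u)) subrr.
by apply/funext => u; apply/eqP; rewrite -subr_eq0; have := congr1 (@^~ u) TS => /= ->.
Qed.

Lemma op_le_refl S : op_le S S. Proof. by move=> u. Qed.

Lemma op_le_trans S T U : op_le S T -> op_le T U -> op_le S U.
Proof. by move=> ST TU u; exact: le_trans (TU u). Qed.

Lemma op_le_anti S T : bounded_op S -> bounded_op T -> op_le S T -> op_le T S -> S = T.
Proof.
move=> bS bT ST TS; have h : S \- T = cst 0.
  apply: polarization; first exact: bmap_sub.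
  by move=> u /=; rewrite innerBl; apply/eqP; rewrite subr_eq0 eq_le ST TS.
by apply/funext => u; apply/eqP; rewrite -subr_eq0; have := congr1 (@^~ u) h => /= ->.
Qed.

Lemma sa_real T u : is_adjoint T T -> '[T u, u] \is Num.real.
Proof. by move=> [_ [_ h]]; apply/CrealP; rewrite -innerC -h. Qed.

Lemma form_cauchy_schwarz S u v : bounded_op S -> (forall u, 0 <= '[S u, u]) ->
  `|'[S u, v]| ^+ 2 <= '[S u, u] * '[S v, v].
Proof.
move=> bS S0; have [_ [_ sS]] := op_ge0_adj bS S0; apply: discriminant => // s t.
have := S0 (s *: u + t *: v).
rewrite (bmapD bS) !(bmapZ bS) !(innerDl, innerDr, innerZl, innerZr).
rewrite -(innerC v) -sS.
by congr (0 <= _); ring.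
Qed.

(** Cauchy-Schwarz for the form of S, at u and S u. *)
Lemma norm_positive_op S (c : R[i]) u : bounded_op S -> (forall u, 0 <= '[S u, u]) ->
  (forall v, '[S v, v] <= c * '[v, v]) -> `|S u| ^+ 2 <= c * '[S u, u].
Proof.
move=> bS S0 Sc; have [->|] := eqVneq (S u) 0.
  by rewrite normr0 inner0l expr0n mulr0.
rewrite -normr_gt0 => Su; have Su2 : 0 < `|S u| ^+ 2 by rewrite exprn_gt0.
rewrite -(ler_pM2r Su2); have := form_cauchy_schwarz u (S u) bS S0.
rewrite -norm_inner ger0_norm ?exprn_ge0 // expr2 => /le_trans; apply.
by rewrite mulrAC mulrC norm_inner ler_wpM2r.
Qed.

Section Commutant.
Variable X : set (H -> H).
Hypothesis Xb : X `<=` @bounded_op R H.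

Lemma commutantP S T u : commutant X T -> X S -> S (T u) = T (S u).
Proof. by move=> [_ h] /h /(congr1 (@^~ u)). Qed.

Lemma commutant_intro T : bounded_op T -> (forall S u, X S -> S (T u) = T (S u)) ->
  commutant X T.
Proof. by move=> bT h; split=> // S XS; apply/funext => u; exact: h. Qed.

Lemma commutant_id : commutant X id.
Proof. by split=> //; exact: bmap_id. Qed.

Lemma commutant_cst0 : commutant X (cst 0).
Proof.
by apply: commutant_intro; [exact: bmap_cst0 | move=> S u /Xb bS /=; rewrite bmap0].
Qed.

Lemma commutant_comp S T : commutant X S -> commutant X T -> commutant X (S \o T).
Proof.
move=> cS cT; apply: commutant_intro; first exact: bmap_comp cT.1 cS.1.
by move=> U u XU /=; rewrite (commutantP _ cS) // (commutantP _ cT).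
Qed.

Lemma commutant_add S T : commutant X S -> commutant X T -> commutant X (S \+ T).
Proof.
move=> cS cT; apply: commutant_intro; first exact: bmap_add cS.1 cT.1.
move=> U u XU /=; rewrite -(commutantP _ cS) // -(commutantP _ cT) //.
by rewrite (bmapD (Xb XU)).
Qed.

Lemma commutant_scale (a : R[i]) S : commutant X S -> commutant X (fun u => a *: S u).
Proof.
move=> cS; apply: commutant_intro; first exact: bmap_scale cS.1.
by move=> U u XU /=; rewrite -(commutantP _ cS) // (bmapZ (Xb XU)).
Qed.

Lemma commutant_sub S T : commutant X S -> commutant X T -> commutant X (S \- T).
Proof.
move=> cS cT; have -> : S \- T = S \+ (fun u => (-1) *: T u).
  by apply/funext => u /=; rewrite scaleN1r.
by apply/commutant_add/commutant_scale.
Qed.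

Lemma commutant_adj S T : (forall S T, X S -> is_adjoint S T -> X T) ->
  commutant X S -> is_adjoint S T -> commutant X T.
Proof.
move=> Xadj cS ST; have [_ [bT h]] := ST; apply: commutant_intro => // U u XU.
have [U' UU'] := adj_exists (Xb XU); have XU' := Xadj _ _ XU UU'.
apply: inner_extl => v; have [_ [_ k]] := UU'; have [_ [_ h']] := adjC ST.
by rewrite k h' h' k (commutantP _ cS).
Qed.

End Commutant.

Lemma commutant_set0 : commutant set0 = @bounded_op R H.
Proof. by apply/seteqP; split => T; [case | split]. Qed.

(** For a directed set D of self-adjoint operators, s is its limit in the weak
    operator topology. *)
Definition weak_sup D s := (forall T, D T -> op_le T s) /\
  forall u (e : R), 0 < e -> exists2 T, D T & '[s u, u] <= '[T u, u] + e%:C.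

Lemma weak_sup_is_lub M D s : M s -> weak_sup D s -> is_lub M D s.
Proof.
move=> Ms [ub appr]; split=> //; split=> // U MU DU u; apply: lec_addgt0 => e e0.
have [T DT Ts] := appr u e e0; apply: le_trans Ts _.
by rewrite lerD2r; exact: DU.
Qed.

Lemma positive_bound (V : H -> H) : bounded_op V -> (forall u, 0 <= '[V u, u]) ->
  exists2 c : R, 0 < c & forall u, '[V u, u] <= c%:C * '[u, u].
Proof.
move=> bV V0; have [c c0 cP] := bmap_bound bV.
exists (complex.Re c); first exact: (re_lt c0).
move=> u; rewrite (reK (ltW c0)) -[leLHS]ger0_norm //.
by apply: le_trans (cauchy_schwarz _ _) _; rewrite -norm_inner expr2 mulrA ler_wpM2r.
Qed.

Section Vigier.
Variables (X D : set (H -> H)) (U : H -> H).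
Hypotheses (Xb : X `<=` @bounded_op R H) (dD : directed_sa (commutant X) D).
Hypotheses (bU : bounded_op U) (DU : forall T, D T -> op_le T U).

Let DX T : D T -> commutant X T. Proof. by move=> /dD.2.1[]. Qed.
Let Db T : D T -> bounded_op T. Proof. by move=> /DX[]. Qed.
Let Dsa T : D T -> is_adjoint T T. Proof. by move=> /dD.2.1[]. Qed.

(** Beyond T0 the positive operators T' - T lie below U - T0, so that one constant
    c bounds the vectors T' u - T u in terms of the quadratic forms. *)
Let control : exists T0 (c : R), [/\ D T0, 0 < c & forall T T' u, D T -> D T' ->
  op_le T0 T -> op_le T T' ->
  `|T' u - T u| ^+ 2 <= c%:C * ('[T' u, u] - '[T u, u]) /\
  `|T' u - T u| ^+ 2 <= (c%:C * `|u|) ^+ 2].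
Proof.
have [[T0 DT0] _] := dD.
have bV : bounded_op (U \- T0) by apply: bmap_sub => //; exact: Db.
have [|c c0 cP] := positive_bound bV.
  by move=> u /=; rewrite innerBl subr_ge0; exact: DU.
exists T0, c; split=> // T T' u DT DT' T0T TT'.
have bS : bounded_op (T' \- T) by apply: bmap_sub; exact: Db.
have S0 v : 0 <= '[(T' \- T) v, v] by rewrite /= innerBl subr_ge0; exact: TT'.
have Sc v : '[(T' \- T) v, v] <= c%:C * '[v, v].
  apply: le_trans (cP v); rewrite /= !innerBl lerB //; first exact: DU.
have h := norm_positive_op u bS S0 Sc; split; first by move: h; rewrite /= innerBl.
apply: le_trans h _; rewrite exprMn expr2 -mulrA ler_wpM2l ?ler0c ?(ltW c0) //.
by rewrite norm_inner.
Qed.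

Let limit u : exists l, forall e : R[i], 0 < e ->
  exists2 T, D T & forall T', D T' -> op_le T T' -> `|l - T' u| < e.
Proof.
have [T0 [c [DT0 c0 cP]]] := control.
pose q (T : H -> H) := complex.Re '[T u, u].
have [_ [_ Ddir]] := dD.
have hE : has_sup [set q T | T in D].
  split; first by exists (q T0), T0.
  by exists (q U) => _ [T DT <-]; apply: re_le; exact: DU.
pose B T := [set T' u | T' in [set T' | D T' /\ op_le T T']].
have small (e : R[i]) : 0 < e -> exists2 T, D T & forall T', D T' -> op_le T T' ->
    `|T' u - T u| < e.
  move=> e0; have re0 : 0 < complex.Re e := re_lt e0.
  have d0 : 0 < complex.Re e ^+ 2 / c by rewrite divr_gt0 ?exprn_gt0.
  have [_ [T1 DT1 <-] T1s] := sup_adherent d0 hE.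
  have [T [DT [T0T T1T]]] := Ddir _ _ DT0 DT1.
  exists T => // T' DT' TT'; rewrite -(reK (ltW e0)).
  apply: nsq_lt; first exact: ltW.
  rewrite -ltcR nsqE; apply: le_lt_trans (cP T T' u DT DT' T0T TT').1 _.
  have -> : '[T' u, u] - '[T u, u] = (q T' - q T)%:C.
    by rewrite rmorphB /= !RRe_real // sa_real //; exact: Dsa.
  rewrite -rmorphM ltcR mulrC -ltr_pdivlMr //.
  have h1 : q T1 <= q T by exact: (re_le (T1T u)).
  have h2 : q T' <= sup [set q T | T in D] by apply: ub_le_sup; [exact: hE.2|exists T'].
  by lra.
have [||||l lP] := @cantor_intersection R H _ D B.
- by exists T0.
- move=> T T' DT DT'; have [V [DV [TV TV']]] := Ddir _ _ DT DT'.
  exists V => // _ [W [DW VW] <-].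
  by split; exists W => //; split=> //; apply: op_le_trans VW.
- by move=> T DT; exists (T u), T => //; split.
- move=> e e0; have [|T DT TP] := small (e / 2); first by rewrite divr_gt0.
  exists T => // _ _ [T1 [D1 T1T] <-] [T2 [D2 T2T] <-].
  rewrite (splitr e) -[T1 u](subrK (T u)) -addrA; apply: le_lt_trans (ler_normD _ _) _.
  by rewrite ltrD ?TP // distrC TP.
exists l => e e0; have e2 : 0 < e / 2 / 2 by rewrite !divr_gt0.
have [T DT TP] := small _ e2; exists T => // T' DT' TT'.
have /closureP/(_ _ e2)[_ [V [DV TV] <-] lV] := lP T DT.
have -> : l - T' u = (l - V u) + ((V u - T u) + (T u - T' u)) by rewrite subrKA subrKA.
apply: le_lt_trans (ler_normD _ _) _; rewrite [ltRHS]splitr ltrD //.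
  apply: lt_trans lV _; rewrite ltr_pdivrMr // ltr_pMr ?divr_gt0 //.
  by rewrite -[1]/(1%:R) ltr_nat.
apply: le_lt_trans (ler_normD _ _) _; rewrite [ltRHS]splitr ltrD ?TP //.
by rewrite distrC TP.
Qed.

(** The limits of the nets T u define the operator s.  Its properties are checked
    at finitely many vectors at a time, for which D has a common index. *)
Lemma vigier : exists2 s, commutant X s & weak_sup D s.
Proof.
have [T0 [c [DT0 c0 cP]]] := control; have [_ [_ Ddir]] := dD.
have [t tP] := choice limit.
have tlin a u v : t (a *: u + v) = a *: t u + t v.
  apply/eqP; rewrite -subr_eq0 -normr_le0; apply/ler_addgt0Pl => e e0; rewrite addr0.
  have a1 : 0 < `|a| + 1 by rewrite ltr_wpDl.
  have e1 : 0 < e / 2 / (`|a| + 1) by rewrite !divr_gt0.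
  have e2 : 0 < e / 2 / 2 by rewrite !divr_gt0.
  have [T1 D1 P1] := tP (a *: u + v) _ e2.
  have [T2 D2 P2] := tP u _ e1; have [T3 D3 P3] := tP v _ e2.
  have [V [DV [VT1 VT2]]] := Ddir _ _ D1 D2.
  have [W [DW [WV W3]]] := Ddir _ _ DV D3.
  have W1 := op_le_trans VT1 WV; have W2 := op_le_trans VT2 WV.
  have -> : t (a *: u + v) - (a *: t u + t v) =
    (t (a *: u + v) - W (a *: u + v)) + (W v - t v) + a *: (W u - t u).
    rewrite (bmapP (Db DW)) scalerBr -[RHS]addrA [(W v - t v) + _]addrACA -opprD.
    by rewrite [W v + _]addrC [t v + _]addrC addrA subrK.
  apply: le_trans (ler_normD _ _) _; rewrite (splitr e) lerD //; last first.
    rewrite normrZ distrC; apply: le_trans (_ : (`|a| + 1) * `|t u - W u| <= _).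
      by rewrite ler_wpM2r // lerDl.
    by rewrite mulrC -ler_pdivlMr // ltW // P2.
  apply: le_trans (ler_normD _ _) _; rewrite (splitr (e / 2)) lerD // ltW ?P1 //.
  by rewrite distrC P3.
have [k k0 kP] := bmap_bound (Db DT0).
have bt : bounded_op t.
  split=> //; exists (1 + (c%:C + k)) => u.
  have [->|] := eqVneq u 0.
    rewrite normr0 mulr0; have := tlin (-1) 0 0.
    by rewrite scaler0 addr0 scaleN1r addNr => ->; rewrite normr0.
  rewrite -normr_gt0 => u0.
  have [T DT TP] := tP u _ u0; have [V [DV [TV T0V]]] := Ddir _ _ DT DT0.
  have -> : t u = (t u - V u) + ((V u - T0 u) + T0 u).
    by rewrite [X in _ + X]subrK subrK.
  apply: le_trans (ler_normD _ _) _; rewrite mulrDl mul1r lerD ?(ltW (TP _ _ _)) //.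
  apply: le_trans (ler_normD _ _) _; rewrite mulrDl lerD //.
  have := (cP T0 V u DT0 DV (@op_le_refl _) T0V).2.
  by rewrite ler_pXn2r ?nnegrE ?mulr_ge0 ?ler0c // ltW.
have form_close u (e : R) : 0 < e -> exists2 T, D T & forall T', D T' -> op_le T T' ->
    `|'[t u, u] - '[T' u, u]| <= e%:C.
  move=> e0; have u1 : 0 < `|u| + 1 by rewrite ltr_wpDl.
  have [|T DT TP] := tP u (e%:C / (`|u| + 1)); first by rewrite divr_gt0 ?ltcR.
  exists T => // T' DT' TT'; rewrite -innerBl; apply: le_trans (cauchy_schwarz _ _) _.
  apply: le_trans (_ : `|t u - T' u| * (`|u| + 1) <= _); first by rewrite ler_wpM2l // lerDl.
  by rewrite -ler_pdivlMr // ltW // TP.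
have ub T : D T -> op_le T t.
  move=> DT u; rewrite -subr_ge0; apply: ge0_approx => e e0.
  have [|T1 D1 P1] := form_close u (complex.Re e); first exact: (re_lt e0).
  have [V [DV [TV T1V]]] := Ddir _ _ DT D1.
  exists ('[V u, u] - '[T u, u]); first by rewrite subr_ge0; exact: TV.
  rewrite opprB addrA subrK; have := P1 V DV T1V.
  by rewrite (reK (ltW e0)).
have tsa : is_adjoint t t.
  have -> : t = (t \- T0) \+ T0 by apply/funext => u /=; rewrite subrK.
  apply: adj_add (Dsa DT0); apply: op_ge0_adj.
    by apply: bmap_sub => //; exact: Db.
  by move=> u /=; rewrite innerBl subr_ge0; exact: ub.
exists t; last first.
  split=> // u e e0; have [T DT TP] := form_close u e e0; exists T => //.
  rewrite -lerBlDl; apply: le_trans (TP T DT (@op_le_refl _)).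
  by apply: real_ler_norm; rewrite rpredB // sa_real //; exact: Dsa.
apply: commutant_intro => // S u XS; have bS := Xb XS.
have [d d0 dP] := bmap_bound bS.
apply/eqP; rewrite -subr_eq0 -normr_le0; apply/ler_addgt0Pl => e e0; rewrite addr0.
have e2 : 0 < e / 2 by rewrite divr_gt0.
have [T1 D1 P1] := tP (S u) _ e2.
have [|T2 D2 P2] := tP u (e / 2 / d); first by rewrite divr_gt0.
have [V [DV [V1 V2]]] := Ddir _ _ D1 D2.
have -> : S (t u) - t (S u) = S (t u - V u) + (V (S u) - t (S u)).
  by rewrite (bmapB bS) (commutantP _ (DX DV) XS) subrKA.
apply: le_trans (ler_normD _ _) _; rewrite (splitr e) lerD //.
  by apply: le_trans (dP _) _; rewrite mulrC -ler_pdivlMr // ltW // P2.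
by rewrite distrC ltW // P1.
Qed.

(** A supremum in the order of a commutant is a limit, because the limit given by
    Vigier's theorem belongs to the commutant and is an upper bound. *)
Lemma is_lub_weak_sup s : is_lub (commutant X) D s -> weak_sup D s.
Proof.
move=> [Xs [ub least]]; have [t Xt [tub tappr]] := vigier.
have st : op_le s t := least _ Xt tub.
have ts : op_le t s.
  move=> u; apply: lec_addgt0 => e e0; have [T DT h] := tappr u e e0.
  by apply: le_trans h _; rewrite lerD2r; exact: ub.
split=> // u e e0; have [T DT h] := tappr u e e0; exists T => //.
exact: le_trans (st u) h.
Qed.

End Vigier.

End OperatorAlgebra.

(** * Normal homomorphisms and intertwiners *)

Section WeakSup.
Variables (R : realType) (H : hilbert R).
Implicit Types (S T U : H -> H) (X M D : set (H -> H)).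

Lemma op_ge0P T : op_le (cst 0) T <-> forall u, 0 <= '[T u, u].
Proof. by split=> h u; have := h u; rewrite /= inner0l. Qed.

Lemma op_ge0_sa T : bounded_op T -> op_le (cst 0) T -> is_adjoint T T.
Proof. by move=> bT /op_ge0P; exact: op_ge0_adj. Qed.

Lemma op_le_subr S T : op_le (cst 0) (T \- S) <-> op_le S T.
Proof. by split=> h u; have := h u; rewrite /= inner0l innerBl subr_ge0. Qed.

Lemma addop_eq0 S T : S \+ T = S -> T = cst 0.
Proof.
by move=> ST; apply/funext => u; apply: (addrI (S u)); rewrite addr0; exact: (congr1 (@^~ u) ST).
Qed.

Lemma weak_sup_le D s U : weak_sup D s -> (forall T, D T -> op_le T U) -> op_le s U.
Proof.
move=> [_ appr] DU u; apply: lec_addgt0 => e e0; have [T DT h] := appr u e e0.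
by apply: le_trans h _; rewrite lerD2r; exact: DU.
Qed.

(** Chains are directed, so Vigier's theorem provides their upper bounds. *)
Lemma maximal_op X (F : set (H -> H)) U : X `<=` @bounded_op R H -> F !=set0 ->
  bounded_op U ->
  (forall T, F T -> [/\ commutant X T, is_adjoint T T & op_le T U]) ->
  (forall D s, D `<=` F -> directed_sa (commutant X) D -> commutant X s ->
     weak_sup D s -> F s) ->
  exists2 T, F T & forall S, F S -> op_le T S -> S = T.
Proof.
move=> Xb [T0 FT0] bU FP Fsup.
pose le (s t : {T | F T}) := `[< op_le (sval s) (sval t) >].
have Fb T : F T -> bounded_op T by move=> /FP[[]].
have [||||t tmax] := @Zorn {T | F T} le.
- by move=> t; apply/asboolP; exact: op_le_refl.
- by move=> r s t /asboolP rs /asboolP st; apply/asboolP; exact: op_le_trans st.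
- move=> [S FS] [T FT] /asboolP /= ST /asboolP /= TS; apply: eq_exist => /=.
  by apply: op_le_anti ST TS; exact: Fb.
- move=> A Atot; have [[[T1 F1] A1]|A0] := pselect (A !=set0); last first.
    by exists (exist _ T0 FT0) => s As; case: A0; exists s.
  pose D := [set sval s | s in A].
  have DF : D `<=` F by move=> _ [[S FS] _ <-].
  have dD : directed_sa (commutant X) D.
    split; first by exists T1, (exist _ T1 F1).
    split; first by move=> T /DF /FP[].
    move=> _ _ [s As <-] [t At <-].
    have [/asboolP st|/asboolP ts] := Atot _ _ As At.
      exists (sval t); split; first by exists t.
      by split=> //; exact: op_le_refl.
    exists (sval s); split; first by exists s.
    by split=> //; exact: op_le_refl.
  have [|s Xs supD] := vigier Xb dD bU; first by move=> T /DF /FP[].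
  have Fs := Fsup _ _ DF dD Xs supD.
  exists (exist _ s Fs) => t At; apply/asboolP; apply: supD.1.
  by exists t.
exists (sval t); first exact: (svalP t).
by move=> S FS tS; rewrite -(tmax (exist _ S FS)) //; apply/asboolP.
Qed.

End WeakSup.

Section NormalHom.
Variables (R : realType) (H K : hilbert R) (op : bool).
Variables (X : set (H -> H)) (Y : set (K -> K)) (f : (H -> H) -> (K -> K)).
Hypotheses (Xb : X `<=` @bounded_op R H) (Yb : Y `<=` @bounded_op R K).
Hypothesis nf : normal_hom op (commutant X) (commutant Y) f.
Local Notation M := (commutant X).

Lemma hom_in S : M S -> commutant Y (f S). Proof. by case: nf => h _; exact: h. Qed.
Lemma homD S T : M S -> M T -> f (S \+ T) = f S \+ f T.
Proof. by case: nf => _ [h _]; exact: h. Qed.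
Lemma homZ (c : R[i]) S : M S -> f (fun u => c *: S u) = (fun u => c *: f S u).
Proof. by case: nf => _ [_ [h _]]; exact: h. Qed.
Lemma hom1 : f id = id. Proof. by case: nf => _ [_ [_ [h _]]]; exact: h. Qed.
Lemma homM S T : M S -> M T -> f (mulo op S T) = f S \o f T.
Proof. by case: nf => _ [_ [_ [_ [h _]]]]; exact: h. Qed.
Lemma hom_adj S T : M S -> is_adjoint S T -> is_adjoint (f S) (f T).
Proof. by case: nf => _ [_ [_ [_ [_ [h _]]]]]; exact: h. Qed.

Lemma hom0 : f (cst 0) = cst 0.
Proof.
have -> : cst 0 = (fun u : H => 0 *: id u) by apply/funext => u; rewrite scale0r.
by rewrite homZ ?hom1; [apply/funext => u; rewrite scale0r | exact: commutant_id].
Qed.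

Lemma homB S T : M S -> M T -> f (S \- T) = f S \- f T.
Proof.
move=> MS MT; have -> : S \- T = S \+ (fun u => (-1) *: T u).
  by apply/funext => u /=; rewrite scaleN1r.
rewrite homD ?homZ //; last exact: commutant_scale.
by apply/funext => u /=; rewrite scaleN1r.
Qed.

(** T is the supremum of {S, T}, and f preserves suprema. *)
Lemma hom_mono S T : M S -> M T -> is_adjoint S S -> is_adjoint T T ->
  op_le S T -> op_le (f S) (f T).
Proof.
move=> MS MT sS sT ST; pose D := [set U | U = S \/ U = T].
have dD : directed_sa M D.
  split; first by exists S; left.
  split; first by move=> _ [|] ->.
  move=> _ _ [|] -> [|] ->; [exists S | exists T | exists T | exists T];
  by split; [by [left|right] | split=> //; exact: op_le_refl].
have wD : weak_sup D T.
  split; first by move=> _ [|] -> //; exact: op_le_refl.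
  by move=> u e e0; exists T; [right | rewrite lerDl ler0c ltW].
have [_ [_ [_ [_ [_ [_ flub]]]]]] := nf.
have [_ [ub _]] := flub _ _ dD (weak_sup_is_lub MT wD).
by apply: ub; exists S => //; left.
Qed.

Lemma hom_directed D : directed_sa M D -> directed_sa (commutant Y) (f @` D).
Proof.
move=> [[T DT] [DM Ddir]]; split; first by exists (f T), T.
split; first by move=> _ [S /DM[MS sS] <-]; split; [exact: hom_in | exact: hom_adj].
move=> _ _ [S DS <-] [S' DS' <-]; have [U [DU [SU S'U]]] := Ddir _ _ DS DS'.
have [[MS sS] [MS' sS'] [MU sU]] := And3 (DM _ DS) (DM _ DS') (DM _ DU).
by exists (f U); split; [exists U | split; exact: hom_mono].
Qed.

Lemma hom_weak_sup D s : directed_sa M D -> M s -> weak_sup D s ->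
  weak_sup (f @` D) (f s).
Proof.
move=> dD Ms wD; have [_ [_ [_ [_ [_ [_ flub]]]]]] := nf.
have lubf := flub _ _ dD (weak_sup_is_lub Ms wD).
apply: (is_lub_weak_sup Yb (hom_directed dD) _ _ lubf); first exact: (hom_in Ms).1.
by have [_ []] := lubf.
Qed.

End NormalHom.

Section Intertwiners.
Variables (R : realType) (H K : hilbert R).
Variables (X : set (K -> K)) (l : (K -> K) -> (H -> H)).
Hypotheses (Xb : X `<=` @bounded_op R K).
Hypothesis Xadj : forall S T, X S -> is_adjoint S T -> X T.
Hypothesis nl : normal_hom false (commutant X) (@bounded_op R H) l.
Local Notation M := (commutant X).

Let nl' : normal_hom false (commutant X) (commutant set0) l.
Proof. by rewrite commutant_set0. Qed.

Let set0b : set0 `<=` @bounded_op R H. Proof. by []. Qed.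

Let Madj S T : M S -> is_adjoint S T -> M T.
Proof. exact: commutant_adj. Qed.

(** Both exhaustion arguments in the construction of intertwiners are instances,
    one with q = 0 and one with p a vector functional. *)
Lemma maximal_dominated (p q : (K -> K) -> R[i]) U : M U -> op_le (cst 0) U ->
  p (cst 0) <= q (cst 0) ->
  (forall D s, directed_sa M D -> M s -> weak_sup D s -> forall e : R, 0 < e ->
     exists2 T, D T & p s <= p T + e%:C) ->
  (forall S T, M S -> M T -> op_le (cst 0) S -> op_le S T -> q S <= q T) ->
  exists T, [/\ M T, op_le (cst 0) T, op_le T U, p T <= q T &
    forall S, M S -> op_le T S -> op_le S U -> p S <= q S -> S = T].
Proof.
move=> MU U0 p0 pnorm qmono.
pose F := [set T | [/\ M T, op_le (cst 0) T, op_le T U & p T <= q T]].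
have [||||T [MT T0 TU pq] Tmax] := @maximal_op R K X F U Xb.
- by exists (cst 0); split=> //; exact: commutant_cst0.
- exact: MU.1.
- by move=> T [MT T0 TU _]; split=> //; apply: op_ge0_sa T0; exact: MT.1.
- move=> D s DF dD Ms wD; split=> //.
  + have [[T DT] _] := dD; have [_ T0 _ _] := DF _ DT.
    exact: op_le_trans T0 (wD.1 _ DT).
  + by apply: weak_sup_le wD _ => T /DF[].
  + apply: lec_addgt0 => e e0; have [T DT h] := pnorm _ _ dD Ms wD e e0.
    have [MT T0 _ pq] := DF _ DT; apply: le_trans h _; rewrite lerD2r.
    by apply: le_trans pq _; apply: qmono => //; exact: wD.1.
exists T; split=> // S MS TS SU pqS; apply: Tmax => //; split=> //.
exact: op_le_trans TS.
Qed.

(** Dixmier's argument.  Let w be the vector functional of zeta, pulled back along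
    l.  Removing from the identity a maximal positive operator that w annihilates
    leaves b1, below which w is faithful.  Choose eta with <b1 eta, eta> > w b1.
    Removing from b1 a maximal x with <x eta, eta> <= w x leaves b such that
    w a <= <a eta, eta> for 0 <= a <= b.  Since b T* T b lies below a multiple of b,
    T (b eta) |-> l T (l b zeta) is contractive; V extends it. *)
Lemma intertwiner_exists (zeta : H) : zeta <> 0 ->
  exists V : K -> H, [/\ bounded_map V,
    forall T u, M T -> V (T u) = l T (V u) & exists k, '[V k, zeta] <> 0].
Proof.
move=> zeta0; pose w T := '[l T zeta, zeta].
have MB S T : M S -> M T -> M (S \- T) by exact: commutant_sub.
have M0 : M (cst 0) by exact: commutant_cst0.
have M1 : M id by exact: commutant_id.
have sa T : M T -> op_le (cst 0) T -> is_adjoint T T.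
  by move=> MT; apply: op_ge0_sa; exact: MT.1.
have wB S T : M S -> M T -> w (S \- T) = w S - w T.
  by move=> MS MT; rewrite /w (homB Xb nl') //= innerBl.
have wD S T : M S -> M T -> w (S \+ T) = w S + w T.
  by move=> MS MT; rewrite /w (homD nl') //= innerDl.
have w0 : w (cst 0) = 0 by rewrite /w (hom0 nl') inner0l.
have wmono S T : M S -> M T -> op_le (cst 0) S -> op_le S T -> w S <= w T.
  move=> MS MT S0 ST; apply: (hom_mono nl') => //; apply: sa => //.
  exact: op_le_trans ST.
have wge0 T : M T -> op_le (cst 0) T -> 0 <= w T.
  by move=> MT T0; rewrite -w0; apply: wmono => //; exact: op_le_refl.
have wnorm D s : directed_sa M D -> M s -> weak_sup D s -> forall e : R, 0 < e ->
    exists2 T, D T & w s <= w T + e%:C.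
  move=> dD Ms wkD e e0.
  have [_ /(_ zeta e e0)[_ [T DT <-] h]] := hom_weak_sup set0b nl' dD Ms wkD.
  by exists T.
have id0 : op_le (cst 0) (id : K -> K) by apply/op_ge0P => u; exact: inner_ge0.
have [b1 [Mb1 b10 b11 wb1 faith]] : exists b1, [/\ M b1, op_le (cst 0) b1,
    op_le b1 id, 0 < w b1 &
    forall a, M a -> op_le (cst 0) a -> op_le a b1 -> w a <= 0 -> a = cst 0].
  have [||T [MT T0 T1 wT Tmax]] := @maximal_dominated w (fun=> 0) id M1 id0 _ wnorm.
  - by rewrite w0.
  - by [].
  exists (id \- T); split.
  - exact: MB.
  - exact/op_le_subr.
  - by move=> u /=; rewrite innerBl gerBl; move/op_ge0P: T0; exact.
  - rewrite wB //; have /eqP -> : w T == 0 by rewrite eq_le wT wge0.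
    rewrite subr0 /w (hom1 nl') lt_def inner_ge0 andbT.
    by apply/eqP => /inner_eq0.
  - move=> a Ma a0 aT wa; have MTa : M (T \+ a) by exact: commutant_add.
    suff : T \+ a = T by exact: addop_eq0.
    apply: Tmax => //.
    + by move=> u /=; rewrite innerDl lerDl; move/op_ge0P: a0; exact.
    + by move=> u; have := aT u; rewrite /= innerBl innerDl lerBrDl.
    + by rewrite wD // -[leRHS](addr0 0) lerD.
have b1_neq0 : exists u, 0 < '[b1 u, u].
  apply: contrapT => /forallNP h; have b1E : b1 = cst 0.
    apply: polarization; first exact: Mb1.1.
    move=> u; apply/eqP; have /op_ge0P/(_ u) := b10; rewrite le0r => /orP[//|/h].
    by [].
  by move: wb1; rewrite b1E w0 ltxx.
(* A multiple t u of a vector with <b1 u, u> > 0, where t >= 1 is such that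
   t <b1 u, u> > w b1. *)
have [eta eta_large] : exists eta, w b1 < '[b1 eta, eta].
  have [u u0] := b1_neq0; pose x := complex.Re '[b1 u, u]; pose y := complex.Re (w b1).
  have x0 : 0 < x := re_lt u0; have y0 : 0 < y := re_lt wb1.
  pose t := 1 + y / x; have t1 : 1 <= t by rewrite lerDl divr_ge0 // ltW.
  exists (t%:C *: u); rewrite (bmapZ Mb1.1) innerZl innerZr.
  have -> : (t%:C)^*%R = t%:C by exact: conjc_real.
  rewrite -(reK (ltW wb1)) -(reK (ltW u0)) -!rmorphM /= ltcR -/x -/y.
  have tx : t * x = x + y by rewrite /t mulrDl mul1r divfK // gt_eqF.
  rewrite tx; apply: lt_le_trans (_ : 1 * (x + y) <= _); first by rewrite mul1r ltrDr.
  by rewrite ler_wpM2r // addr_ge0 // ltW.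
have [|||x [Mx x0 xb1 wx xmax]] :=
    @maximal_dominated (fun T => '[T eta, eta]) w b1 Mb1 b10.
- by rewrite w0 inner0l.
- by move=> D s _ _ [_ appr] e e0; exact: appr.
- exact: wmono.
pose b := b1 \- x; have Mb : M b := MB _ _ Mb1 Mx.
have b0 : op_le (cst 0) b by exact/op_le_subr.
have bb1 : op_le b b1 by move=> u; rewrite /b /= innerBl gerBl; move/op_ge0P: x0; exact.
have b_le1 := op_le_trans bb1 b11.
have b0P u : 0 <= '[b u, u] by move/op_ge0P: b0; exact.
have wb : '[l b zeta, zeta] <> 0.
  move=> wb0; have bE : b = cst 0 by apply: faith => //; rewrite /w wb0.
  have xE : x = b1.
    apply/funext => u; apply/esym/eqP; rewrite -subr_eq0.
    by have := congr1 (@^~ u) bE; rewrite /b /= => ->.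
  by move: eta_large; rewrite -xE => /(le_lt_trans wx); rewrite ltxx.
have dom a : M a -> op_le (cst 0) a -> op_le a b -> w a <= '[a eta, eta].
  move=> Ma a0 ab; have aeta : 0 <= '[a eta, eta] by move/op_ge0P: a0; exact.
  have [//|lt] := real_leP (ger0_real (wge0 _ Ma a0)) (ger0_real aeta).
  have : x \+ a = x.
    apply: xmax.
    - exact: commutant_add.
    - by move=> u /=; rewrite innerDl lerDl; move/op_ge0P: a0; exact.
    - by move=> u; have := ab u; rewrite /b /= innerBl innerDl lerBrDl.
    - by rewrite wD //= innerDl lerD // ltW.
  move=> /addop_eq0 aE; move: lt; rewrite aE w0 inner0l ltxx //.
have bsa := sa _ Mb b0.
have Mcomp S T : M S -> M T -> M (S \o T) by exact: commutant_comp.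
have lcomp S T : M S -> M T -> l (S \o T) = l S \o l T.
  by move=> MS MT; rewrite -(homM nl').
(* Apply dom to a = b T* T b / c, where c bounds T* T: indeed b^2 <= b. *)
have contract T : M T -> `|l T (l b zeta)| <= `|T (b eta)|.
  move=> MT; have [T' TT'] := adj_exists MT.1; have MT' := Madj MT TT'.
  have [_ [_ hT]] := adjC TT'; have [_ [_ hb]] := bsa.
  have [||c c0 cP] := @positive_bound _ _ (T' \o T).
  - exact: (Mcomp _ _ MT' MT).1.
  - by move=> u /=; rewrite hT; exact: inner_ge0.
  pose a0 := b \o (T' \o (T \o b)).
  have MTb := Mcomp _ _ MT Mb; have MTTb := Mcomp _ _ MT' MTb.
  have Ma0 : M a0 := Mcomp _ _ Mb MTTb.
  have a0E u : '[a0 u, u] = '[T (b u), T (b u)].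
    by rewrite /a0 /= hb hT.
  pose a u := (c^-1)%:C *: a0 u; have Ma : M a by exact: commutant_scale.
  have ic0 : 0 <= (c^-1)%:C :> R[i] by rewrite ler0c invr_ge0 ltW.
  have ic0' : 0 < (c^-1)%:C :> R[i] by rewrite ltcR invr_gt0.
  have := dom a Ma; rewrite /w (homZ nl') // /a !innerZl.
  rewrite ler_pM2l //.
  have -> : '[l a0 zeta, zeta] = `|l T (l b zeta)| ^+ 2.
    have [_ [_ lhb]] := hom_adj nl' Mb bsa.
    have [_ [_ lhT]] := adjC (hom_adj nl' MT TT').
    rewrite /a0 (lcomp _ _ Mb MTTb) (lcomp _ _ MT' MTb) (lcomp _ _ MT Mb).
    by rewrite /= lhb lhT norm_inner.
  rewrite a0E -norm_inner ler_pXn2r ?nnegrE //; apply.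
  - apply/op_ge0P => u; rewrite innerZl a0E mulr_ge0 ?inner_ge0 //.
  - move=> u; rewrite innerZl a0E.
    have h1 : '[T (b u), T (b u)] <= c%:C * '[b u, b u].
      by have := cP (b u); rewrite /= hT.
    apply: le_trans (_ : '[b u, b u] <= _).
      rewrite -(ler_pM2l (_ : 0 < c%:C)) ?ltcR // mulrA -rmorphM /= mulfV ?mul1r //.
      by rewrite gt_eqF.
    have := norm_positive_op u Mb.1 b0P (c := 1).
    by rewrite norm_inner mul1r; apply => v; rewrite mul1r; exact: b_le1.
pose G x y := exists T, [/\ M T, x = T (b eta) & y = l T (l b zeta)].
have G0 : G 0 0 by exists (cst 0); rewrite (hom0 nl').
have GP : forall c u v u' v', G u v -> G u' v' -> G (c *: u + u') (c *: v + v').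
  move=> c u v u' v' [T [MT -> ->]] [T' [MT' -> ->]].
  exists ((fun u => c *: T u) \+ T').
  have McT : M (fun u => c *: T u) by exact: commutant_scale.
  by split; [exact: commutant_add | | rewrite (homD nl' McT MT') (homZ nl' c MT)].
have [|V [bV VG V0]] := @bounded_extension _ K H G G0 GP.
  by exists 1 => u v [T [MT -> ->]]; rewrite mul1r; exact: contract.
exists V; split=> //; last first.
  exists (b eta); rewrite (VG _ (l b zeta)) //.
  by exists id; rewrite (hom1 nl').
move=> S u MS; have [S' SS'] := adj_exists MS.1; have MS' := Madj MS SS'.
pose D := [set x | exists y, G x y].
pose Delta := (V \o S) \- (l S \o V).
have blS : bounded_op (l S) := (hom_in nl' MS).1.
have bDelta : bounded_map Delta.
  by apply: bmap_sub; apply: bmap_comp => //; exact: MS.1.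
have sD : subspace_of D.
  split; first by exists 0.
  by move=> c z z' [y Gzy] [y' Gzy']; exists (c *: y + y'); exact: GP.
have GS U z y : M U -> G z y -> G (U z) (l U y).
  move=> MU [T [MT -> ->]]; exists (U \o T).
  by split=> //; [exact: Mcomp | rewrite lcomp].
have [e De eP] := projection_theorem u (subspace_closure sD) (@closed_closure _ D).
have De0 : Delta e = 0.
  apply: (closure_sub_closed (closed_eq_bmap bDelta (bmap_cst0 K H))) De.
  by move=> z [y Gxy]; rewrite /Delta /= (VG _ _ Gxy) (VG _ _ (GS _ _ _ MS Gxy)) subrr.
have Due : Delta (u - e) = 0.
  have orth z : D z -> '[u - e, z] = 0 by move=> Dz; apply: eP; exact: subset_closure.
  have V1 : V (u - e) = 0 by apply: V0 => z y Gzy; apply: orth; exists y.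
  have V2 : V (S (u - e)) = 0.
    apply: V0 => z y Gzy; have [_ [_ ->]] := SS'.
    by apply: orth; exists (l S' y); exact: GS.
  by rewrite /Delta /= V1 V2 (bmap0 blS) subrr.
apply/eqP; rewrite -subr_eq0; apply/eqP.
by rewrite -[LHS]/(Delta u) -[u](subrK e) (bmapD bDelta) De0 Due addr0.
Qed.

End Intertwiners.

Section NormalImage.
Variables (R : realType) (H K : hilbert R).
Variables (X : set (K -> K)) (l : (K -> K) -> (H -> H)).
Hypotheses (Xb : X `<=` @bounded_op R K).
Hypothesis Xadj : forall S T, X S -> is_adjoint S T -> X T.
Hypothesis nl : normal_hom false (commutant (commutant X)) (@bounded_op R H) l.

(** The image under l of X is as large as the image of X'', up to weak closure.
    If F commutes with l X and D = F (l T) - (l T) F is not zero, then D is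
    detected by two intertwiners V and W, as <D V k', W k> is not zero; but
    W* F V commutes with X, hence with T. *)
Lemma commutant_normal_image :
  commutant (l @` X) `<=` commutant (l @` commutant (commutant X)).
Proof.
have X'b : commutant X `<=` @bounded_op R K by move=> T [].
have X'adj S T : commutant X S -> is_adjoint S T -> commutant X T by exact: commutant_adj.
have XM : X `<=` commutant (commutant X).
  move=> S XS; apply: commutant_intro; first exact: Xb.
  by move=> T u cT; rewrite (commutantP _ cT XS).
move=> F cF; have bF := cF.1; split=> // _ [T MT <-].
have blT : bounded_op (l T) by case: nl => h _; exact: h.
have [T' TT'] := adj_exists MT.1.
have MT' : commutant (commutant X) T' by exact: commutant_adj TT'.
have ladj S S' : commutant (commutant X) S -> is_adjoint S S' -> is_adjoint (l S) (l S').
  by case: nl => _ [_ [_ [_ [_ [h _]]]]]; exact: h.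
pose D := (F \o l T) \- (l T \o F).
have bD : bounded_map D by apply: bmap_sub; apply: bmap_comp.
apply/esym/funext => h; apply/eqP; rewrite -subr_eq0; apply/eqP; rewrite -[LHS]/(D h).
apply: contrapT => Dh.
have [W [bW WP [k Wk]]] := intertwiner_exists X'b X'adj nl Dh.
have [D' bD' DD'] := adjoint_exists bD.
have DWk : D' (W k) <> 0.
  by move=> D0; apply: Wk; rewrite innerC DD' D0 inner0r rmorph0.
have [V [bV VP [k' Vk']]] := intertwiner_exists X'b X'adj nl DWk.
apply: Vk'; rewrite -DD' /D /= innerBl.
have [W' bW' WW'] := adjoint_exists bW.
pose G := W' \o (F \o V).
have cG : commutant X G.
  apply: commutant_intro; first exact: bmap_comp (bmap_comp bV bF) bW'.
  move=> x u Xx; have [x' xx'] := adj_exists (Xb Xx); have Xx' := Xadj Xx xx'.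
  have [_ [_ hx]] := xx'; have [_ [_ lx]] := ladj _ _ (XM _ Xx) xx'.
  apply: inner_extl => v; rewrite hx /G /=.
  rewrite innerC -WW' -innerC WP; last exact: XM.
  rewrite [RHS]innerC -WW' -[RHS]innerC VP; last exact: XM.
  by rewrite -lx (commutantP _ cF) //; exists x.
have [_ [_ hT]] := TT'; have [_ [_ lT]] := ladj _ _ MT TT'.
rewrite -VP // lT -WP // innerC WW' -innerC [X in _ - X]innerC WW' -[X in _ - X]innerC.
rewrite -[W' (F (V (T k')))]/(G (T k')) -[W' (F (V k'))]/(G k').
by rewrite (commutantP _ MT cG) hT subrr.
Qed.

End NormalImage.

(** * Closed subspaces as Hilbert spaces *)

Definition closed_subspace (R : realType) (H : hilbert R) (X : set H) :=
  subspace_of X /\ closed X.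

(** The type is indexed by the proof cX so that the vector space operations, which
    use it, can be inferred from the type. *)
Record subhilbert (R : realType) (H : hilbert R) (X : set H)
    (cX : closed_subspace X) := SubHilbert {
  emb : H;
  emb_in : X emb }.

Section SubHilbertSpace.
Variables (R : realType) (H : hilbert R) (X : set H) (cX : closed_subspace X).
Local Notation L := (subhilbert cX).

HB.instance Definition _ := gen_eqMixin L.
HB.instance Definition _ := gen_choiceMixin L.

Lemma emb_inj : injective (@emb R H X cX).
Proof. by move=> [u Xu] [v Xv] /= uv; subst v; congr SubHilbert; exact: Prop_irrelevance. Qed.

Definition sub_zero : L := SubHilbert cX cX.1.1.
Definition sub_add (u v : L) : L :=
  SubHilbert cX (subspaceD cX.1 (emb_in u) (emb_in v)).
Definition sub_scale (a : R[i]) (u : L) : L :=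
  SubHilbert cX (subspaceZ cX.1 a (emb_in u)).
Definition sub_opp (u : L) : L := sub_scale (-1) u.

Lemma sub_addA : associative sub_add.
Proof. by move=> u v w; apply: emb_inj; exact: addrA. Qed.
Lemma sub_addC : commutative sub_add.
Proof. by move=> u v; apply: emb_inj; exact: addrC. Qed.
Lemma sub_add0 : left_id sub_zero sub_add.
Proof. by move=> u; apply: emb_inj; exact: add0r. Qed.
Lemma sub_addN : left_inverse sub_zero sub_opp sub_add.
Proof. by move=> u; apply: emb_inj; rewrite /= scaleN1r addNr. Qed.

HB.instance Definition _ := GRing.isZmodule.Build L sub_addA sub_addC sub_add0 sub_addN.

Lemma sub_scaleA a b (v : L) : sub_scale a (sub_scale b v) = sub_scale (a * b) v.
Proof. by apply: emb_inj; exact: scalerA. Qed.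
Lemma sub_scale1 : left_id 1 sub_scale.
Proof. by move=> u; apply: emb_inj; exact: scale1r. Qed.
Lemma sub_scaleDr : right_distributive sub_scale +%R.
Proof. by move=> a u v; apply: emb_inj; exact: scalerDr. Qed.
Lemma sub_scaleDl (v : L) : {morph sub_scale^~ v : a b / a + b}.
Proof. by move=> a b; apply: emb_inj; exact: scalerDl. Qed.

HB.instance Definition _ := GRing.Zmodule_isLmodule.Build R[i] L
  sub_scaleA sub_scale1 sub_scaleDr sub_scaleDl.

Lemma embD (u v : L) : emb (u + v) = emb u + emb v. Proof. by []. Qed.
Lemma embZ a (u : L) : emb (a *: u) = a *: emb u. Proof. by []. Qed.
Lemma embB (u v : L) : emb (u - v) = emb u - emb v.
Proof. by rewrite embD -scaleN1r embZ scaleN1r. Qed.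
Definition sub_norm (u : L) : R[i] := `|emb u|.

Lemma sub_norm_triangle (u v : L) : sub_norm (u + v) <= sub_norm u + sub_norm v.
Proof. exact: ler_normD. Qed.
Lemma sub_normZ a (u : L) : sub_norm (a *: u) = `|a| * sub_norm u.
Proof. exact: normrZ. Qed.
Lemma sub_norm0_eq0 (u : L) : sub_norm u = 0 -> u = 0.
Proof. by move=> /normr0_eq0 u0; apply: emb_inj. Qed.

HB.instance Definition _ := Lmodule_isNormed.Build R[i] L
  sub_norm_triangle sub_normZ sub_norm0_eq0.

Lemma emb_norm (u : L) : `|emb u| = `|u|. Proof. by []. Qed.

Lemma sub_complete (F : set_system L) : ProperFilter F -> cauchy F -> cvg F.
Proof.
move=> FF cF.
have : cauchy (@emb _ _ _ cX @ F).
  apply/cauchy_ballP => e e0; have /cauchy_ballP/(_ e e0)[[P Q] [/= FP FQ] PQ] := cF.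
  exists (@emb _ _ _ cX @` P, @emb _ _ _ cX @` Q).
    by split; [apply: filterS FP | apply: filterS FQ] => u Pu; exists u.
  move=> [_ _] [/= [u Pu <-] [v Qv <-]]; have := PQ (u, v) (conj Pu Qv).
  by rewrite /= -!ball_normE /ball_ /= -embB.
move=> /cauchy_cvg; set l := lim _ => Fl.
have Xl : X l by apply: closed_cvg Fl; [exact: cX.2 | near=> u; exact: emb_in].
apply/cvg_ex; exists (SubHilbert cX Xl); apply/cvgrPdist_lt => e e0.
move/cvgrPdist_lt: Fl => /(_ e e0); apply: filterS => u.
by rewrite -emb_norm embB.
Unshelve. all: by end_near. Qed.

HB.instance Definition _ := Uniform_isComplete.Build L sub_complete.

Definition sub_inner (u v : L) : R[i] := '[emb u, emb v].

Lemma sub_inner_bilinear : bilinear_for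
  (GRing.Scale.Law.clone _ _ ( *%R ) _) (GRing.Scale.Law.clone _ _ (Num.conj \; *%R ) _)
  sub_inner.
Proof.
split=> [u'|u] a x y; rewrite /sub_inner embD embZ.
  by rewrite innerDl innerZl.
by rewrite innerDr innerZr.
Qed.

HB.instance Definition _ :=
  bilinear_isBilinear.Build R[i] L L R[i] _ _ sub_inner sub_inner_bilinear.

Lemma sub_inner_herm (u v : L) : sub_inner u v = (-1) ^+ false * Num.conj (sub_inner v u).
Proof. by rewrite expr0 mul1r; exact: innerC. Qed.

HB.instance Definition _ :=
  isHermitianSesquilinear.Build R[i] L false Num.conj sub_inner sub_inner_herm.

Lemma sub_inner_pos (u : L) : u != 0 -> 0 < sub_inner u u.
Proof.
move=> u0; rewrite lt_def inner_ge0 andbT; apply: contraNneq u0 => /inner_eq0 h.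
exact/eqP/emb_inj.
Qed.

HB.instance Definition _ := isDotProduct.Build R[i] L sub_inner sub_inner_pos.

Lemma sub_norm_inner (u : L) : `|u| ^+ 2 = sub_inner u u.
Proof. exact: norm_inner. Qed.

Definition subspace_hilbert : hilbert R := @Hilbert R L sub_inner sub_norm_inner.

End SubHilbertSpace.

(** * Tracial algebras and their representations *)

Section TracialAlgebra.
Variables (R : realType) (A : tracial_von_neumann R).
Implicit Types (S T : tspace A -> tspace A).
Local Notation Y := (commutant (talg A)).

Lemma talgE : talg A = commutant Y.
Proof. by rewrite (talg_vn A).2. Qed.

Let Yb : Y `<=` @bounded_op R (tspace A). Proof. by move=> T []. Qed.

Lemma talg_bounded S : talg A S -> bounded_op S.
Proof. by rewrite talgE => -[]. Qed.
Lemma talg_id : talg A id. Proof. rewrite talgE; exact: commutant_id. Qed.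
Lemma talg_cst0 : talg A (cst 0). Proof. rewrite talgE; exact: commutant_cst0. Qed.
Lemma talg_comp S T : talg A S -> talg A T -> talg A (S \o T).
Proof. rewrite talgE; exact: commutant_comp. Qed.
Lemma talg_mulo op S T : talg A S -> talg A T -> talg A (Defs.mulo op S T).
Proof. by case: op => AS AT; exact: talg_comp. Qed.
Lemma talg_add S T : talg A S -> talg A T -> talg A (S \+ T).
Proof. rewrite talgE; exact: commutant_add. Qed.
Lemma talg_scale (a : R[i]) S : talg A S -> talg A (fun u => a *: S u).
Proof. rewrite talgE; exact: commutant_scale. Qed.
Lemma talg_sub S T : talg A S -> talg A T -> talg A (S \- T).
Proof. rewrite talgE; exact: commutant_sub. Qed.
Lemma talg_adj S T : talg A S -> is_adjoint S T -> talg A T.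
Proof. exact: (talg_vn A).1. Qed.
Lemma talg_adj_exists S : talg A S -> exists2 T, talg A T & is_adjoint S T.
Proof.
move=> AS; have [T ST] := adj_exists (talg_bounded AS).
by exists T => //; exact: talg_adj ST.
Qed.

End TracialAlgebra.

(** A representation of A, or of its opposite, without the normality condition. *)
Definition star_rep (R : realType) (H : hilbert R) (op : bool)
    (A : tracial_von_neumann R) (f : (tspace A -> tspace A) -> (H -> H)) :=
  (forall S, talg A S -> bounded_op (f S)) /\
  (forall S T, talg A S -> talg A T -> f (S \+ T) = f S \+ f T) /\
  (forall (c : R[i]) S, talg A S -> f (fun u => c *: S u) = (fun u => c *: f S u)) /\
  f id = id /\
  (forall S T, talg A S -> talg A T -> f (Defs.mulo op S T) = f S \o f T) /\
  (forall S T, talg A S -> is_adjoint S T -> is_adjoint (f S) (f T)).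

Section StarRep.
Variables (R : realType) (H : hilbert R) (op : bool) (A : tracial_von_neumann R).
Variable f : (tspace A -> tspace A) -> (H -> H).
Hypothesis rf : star_rep op f.

Lemma rep_bounded S : talg A S -> bounded_op (f S).
Proof. by case: rf => h _; exact: h. Qed.
Lemma repD S T : talg A S -> talg A T -> f (S \+ T) = f S \+ f T.
Proof. by case: rf => _ [h _]; exact: h. Qed.
Lemma repZ (c : R[i]) S : talg A S -> f (fun u => c *: S u) = (fun u => c *: f S u).
Proof. by case: rf => _ [_ [h _]]; exact: h. Qed.
Lemma rep1 : f id = id. Proof. by case: rf => _ [_ [_ [h _]]]; exact: h. Qed.
Lemma repM S T : talg A S -> talg A T -> f (Defs.mulo op S T) = f S \o f T.
Proof. by case: rf => _ [_ [_ [_ [h _]]]]; exact: h. Qed.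
Lemma rep_adj S T : talg A S -> is_adjoint S T -> is_adjoint (f S) (f T).
Proof. by case: rf => _ [_ [_ [_ [_ h]]]]; exact: h. Qed.
Lemma rep0 : f (cst 0) = cst 0.
Proof.
have -> : cst 0 = (fun u : tspace A => 0 *: id u) by apply/funext => u; rewrite scale0r.
by rewrite repZ ?rep1; [apply/funext => u; rewrite scale0r | exact: talg_id].
Qed.
Lemma repB S T : talg A S -> talg A T -> f (S \- T) = f S \- f T.
Proof.
move=> MS MT; have -> : S \- T = S \+ (fun u => (-1) *: T u).
  by apply/funext => u /=; rewrite scaleN1r.
rewrite repD ?repZ //; last exact: talg_scale.
by apply/funext => u /=; rewrite scaleN1r.
Qed.

End StarRep.

Lemma normal_hom_star_rep (R : realType) (H : hilbert R) op
    (A : tracial_von_neumann R) (N : set (H -> H)) f :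
  N `<=` @bounded_op R H -> normal_hom op (talg A) N f -> star_rep op f.
Proof.
move=> Nb [fin [fD [fZ [f1 [fM [fadj _]]]]]].
by split=> [S /fin/Nb|]//; do 4![split=> //].
Qed.

(** * Orthonormal families and ampliations *)

Definition fcons (T : Type) n (x : T) (f : 'I_n -> T) (i : 'I_n.+1) : T :=
  if unlift ord0 i is Some j then f j else x.

Lemma fcons0 T n x (f : 'I_n -> T) : fcons x f ord0 = x.
Proof. by rewrite /fcons unlift_none. Qed.

Lemma fconsS T n x (f : 'I_n -> T) i : fcons x f (lift ord0 i) = f i.
Proof. by rewrite /fcons liftK. Qed.


Section MoreHilbert.
Variables (R : realType) (K : hilbert R).

Lemma closure_form_ge0 (X : set K) (W : K -> K) u : bounded_op W ->
  (forall x, X x -> 0 <= '[W x, x]) -> closure X u -> 0 <= '[W u, u].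
Proof.
move=> bW h /closureP Xu; apply: ge0_approx => e e0.
(* For |u - x| = e / (e + k) <= 1 the forms at u and x differ by at most
   k |u - x| <= e. *)
have [c c0 cP] := bmap_bound bW; pose k := c * (`|u| + (`|u| + 1)).
have k0 : 0 <= k by rewrite mulr_ge0 ?(ltW c0) // !addr_ge0.
have ek : 0 < e + k by rewrite ltr_pwDl.
have [x Xx ux] := Xu (e / (e + k)) (divr_gt0 e0 ek).
exists '[W x, x]; first exact: h.
have ux1 : `|u - x| <= 1.
  by apply: le_trans (ltW ux) _; rewrite ler_pdivrMr // mul1r lerDl.
have xu : `|x| <= `|u| + 1.
  rewrite -[x](subrK u) addrC; apply: le_trans (ler_normD _ _) _.
  by rewrite lerD2l distrC.
have -> : '[W u, u] - '[W x, x] = '[W (u - x), u] + '[W x, u - x].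
  by rewrite (bmapB bW) innerBl innerBr addrA subrK.
apply: le_trans (ler_normD _ _) _.
apply: le_trans (_ : c * `|u - x| * `|u| + c * (`|u| + 1) * `|u - x| <= _).
  rewrite lerD //; apply: le_trans (cauchy_schwarz _ _) _; rewrite ler_wpM2r //.
  by apply: le_trans (cP _) _; rewrite ler_wpM2l // ltW.
have -> : c * `|u - x| * `|u| + c * (`|u| + 1) * `|u - x| = k * `|u - x|.
  by rewrite /k; ring.
apply: le_trans (_ : k * (e / (e + k)) <= _); first by rewrite ler_wpM2l // ltW.
by rewrite mulrA ler_pdivrMr // mulrC ler_wpM2l ?(ltW e0) // lerDr ltW.
Qed.

Lemma inner_subop (S T : K -> K) u v : '[(S \- T) u, v] = '[S u, v] - '[T u, v].
Proof. exact: innerBl. Qed.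

Lemma form_add_le (W : K -> K) u v : bounded_op W -> (forall x, 0 <= '[W x, x]) ->
  '[W (u + v), u + v] <= 2 * '[W u, u] + 2 * '[W v, v].
Proof.
move=> bW W0; rewrite -subr_ge0; have := W0 (u - v).
rewrite (bmapB bW) (bmapD bW) !(innerBl, innerBr, innerDl, innerDr).
by congr (0 <= _); ring.
Qed.

(** The indices found for the single vectors are merged by directedness. *)
Lemma weak_sup_seq (M D : set (K -> K)) s T0 (l : seq K) (e : R) :
  directed_sa M D -> weak_sup D s -> D T0 -> 0 < e ->
  exists T, [/\ D T, op_le T0 T & forall v, v \in l -> '[s v, v] <= '[T v, v] + e%:C].
Proof.
move=> [_ [_ Ddir]] [_ appr] DT0 e0; elim: l => [|u l [T [DT T0T Tl]]].
  by exists T0; split=> //; exact: op_le_refl.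
have [T1 DT1 T1u] := appr u e e0; have [V [DV [TV T1V]]] := Ddir _ _ DT DT1.
exists V; split=> //; first exact: op_le_trans TV.
move=> v; rewrite inE => /orP[/eqP ->|/Tl h].
  by apply: le_trans T1u _; rewrite lerD2r; exact: T1V.
by apply: le_trans h _; rewrite lerD2r; exact: TV.
Qed.

Definition orthonormal_vectors n (z : 'I_n -> K) := forall i j, '[z i, z j] = (i == j)%:R.

Lemma gram_schmidt (X : set K) (l : seq K) : subspace_of X ->
  (forall v, v \in l -> X v) ->
  exists n (z : 'I_n -> K), [/\ orthonormal_vectors z, forall i, X (z i) &
    forall v, v \in l -> v = \sum_i '[v, z i] *: z i].
Proof.
move=> sX; elim: l => [_|u l IH Xul].
  by exists 0, (fun=> 0); split=> // -[].
have [v vl|n [z [zz Xz zl]]] := IH; first by apply: Xul; rewrite inE vl orbT.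
pose p := \sum_i '[u, z i] *: z i; pose q := u - p.
have Xp : X p by exact: subspace_sum.
have Xq : X q by apply: subspaceB => //; apply: Xul; rewrite inE eqxx.
have qz j : '[q, z j] = 0.
  rewrite innerBl inner_suml (bigD1 j) //= innerZl zz eqxx mulr1 big1 ?addr0 ?subrr //.
  by move=> i ij; rewrite innerZl zz (negbTE ij) mulr0.
have [q0|q0] := eqVneq q 0.
  exists n, z; split=> // v; rewrite inE => /orP[/eqP ->|/zl //].
  by apply/eqP; rewrite -subr_eq0 -/p -/q q0.
have nq : `|q| != 0 by rewrite normr_eq0.
pose r := `|q|^-1 *: q; have Xr : X r by exact: subspaceZ.
have rr : '[r, r] = 1.
  rewrite innerZl innerZr -norm_inner fmorphV /= (geC0_conj (normr_ge0 _)).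
  by rewrite mulrA -invfM -expr2 mulVf // expf_neq0.
have rz j : '[r, z j] = 0 by rewrite innerZl qz mulr0.
exists n.+1, (fcons r z); split.
- move=> i j; case: (unliftP ord0 i) => [k ->|->]; case: (unliftP ord0 j) => [m ->|->];
    rewrite ?fconsS ?fcons0 ?eqxx //.
  by rewrite innerC rz rmorph0 eq_sym (negbTE (neq_lift _ _)).
- by move=> i; case: (unliftP ord0 i) => [k ->|->]; rewrite ?fconsS ?fcons0.
- move=> v; rewrite big_ord_recl fcons0 inE => /orP[/eqP ->|vl].
    under eq_bigr do rewrite fconsS.
    have -> : '[u, r] = `|q|.
      have -> : u = q + p by rewrite subrK.
      rewrite innerDl /p inner_suml big1 ?addr0.
        rewrite innerZr -norm_inner fmorphV /= (geC0_conj (normr_ge0 _)).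
        by rewrite expr2 mulrA mulVf ?mul1r.
      by move=> i _; rewrite innerZl (innerC (z i)) rz rmorph0 mulr0.
    by rewrite scalerA mulfV // scale1r -/p subrK.
  under eq_bigr do rewrite fconsS.
  have -> : '[v, r] = 0.
    rewrite (zl v vl) inner_suml big1 // => i _.
    by rewrite innerZl (innerC (z i)) rz rmorph0 mulr0.
  by rewrite scale0r add0r -zl.
Qed.

(** Gram-Schmidt for the images under p of a spanning family. *)
Lemma finite_rank_basis (p : K -> K) : is_projection p -> finite_rank p ->
  exists n (z : 'I_n -> K), [/\ orthonormal_vectors z, forall i, p (z i) = z i &
    forall u, p u = \sum_i '[u, z i] *: z i].
Proof.
move=> [[bp [_ sp]] pp] [m [e eP]].
have ppE u : p (p u) = p u := congr1 (@^~ u) pp.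
pose X := [set u | p u = u].
have sX : subspace_of X.
  split; first exact: bmap0.
  by move=> a u v /= pu pv; rewrite /X /= (bmapP bp) pu pv.
have [|n [z [zz Xz zl]]] := @gram_schmidt X [seq p (e i) | i <- enum 'I_m] sX.
  by move=> _ /mapP[i _ ->]; exact: ppE.
exists n, z; split=> // u; have [c uE] := eP u.
have puE : p u = \sum_i c i *: p (e i).
  by rewrite -[LHS]ppE uE (bmap_sum bp); apply: eq_bigr => i _; rewrite (bmapZ bp).
have inz (i : 'I_m) : p (e i) = \sum_j '[p (e i), z j] *: z j.
  by apply: zl; apply/mapP; exists i; rewrite ?mem_enum.
pose Y := [set w | w = \sum_j '[w, z j] *: z j].
have sY : subspace_of Y.
  split; first by rewrite /Y /= big1 // => j _; rewrite inner0l scale0r.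
  move=> a x y Yx Yy; rewrite /Y /=.
  under eq_bigr do rewrite innerDl innerZl scalerDl -scalerA.
  by rewrite big_split -scaler_sumr -Yx -Yy.
have -> : p u = \sum_j '[p u, z j] *: z j.
  by rewrite -/(Y (p u)) puE; exact: (subspace_sum c sY inz).
by apply: eq_bigr => i _; rewrite sp Xz.
Qed.

Lemma projection_le_id (p : K -> K) u : is_projection p -> '[p u, u] <= '[u, u].
Proof.
move=> [[_ [_ sp]] pp]; have := inner_ge0 (u - p u).
rewrite innerBl !innerBr -sp -[in X in _ - X]sp -[p (p u)]/((p \o p) u) pp.
by rewrite subrr subr0 subr_ge0.
Qed.

Lemma rank_one_projection (x : K) : '[x, x] = 1 ->
  is_projection (fun u => '[u, x] *: x) /\ finite_rank (fun u => '[u, x] *: x).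
Proof.
move=> xx; have bp : bounded_op (fun u : K => '[u, x] *: x).
  split; first by move=> a u v; rewrite innerDl innerZl scalerDl scalerA.
  exists (`|x| * `|x|) => u; rewrite normrZ mulrAC ler_wpM2r // mulrC.
  exact: cauchy_schwarz.
split; last by exists 1, (fun=> x) => u; exists (fun=> '[u, x]); rewrite big_ord1.
split.
  by split=> //; split=> // u v; rewrite innerZl innerZr -innerC mulrC.
by apply/funext => u /=; rewrite innerZl xx mulr1.
Qed.

End MoreHilbert.

(** Maps theta such as S |-> S (x) 1: on a dense set of vectors the quadratic form
    of theta S is a finite sum of values of the quadratic form of S, since
    such a vector is a sum of f_i (x) z_i with orthonormal z_i. *)
Section Ampliation.
Variables (R : realType) (L H : hilbert R).
Variables (theta : (L -> L) -> (H -> H)) (Z : set H).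
Hypothesis Zdense : closure Z = setT.
Hypothesis theta_b : forall T, bounded_op T -> bounded_op (theta T).
Hypothesis thetaB : forall S T, bounded_op S -> bounded_op T ->
  theta (S \- T) = theta S \- theta T.
Hypothesis Zform : forall x, Z x -> exists n (f : 'I_n -> L),
  forall T, bounded_op T -> '[theta T x, x] = \sum_i '[T (f i), f i].

Lemma ampliation_ge0 T : bounded_op T -> (forall e, 0 <= '[T e, e]) ->
  forall u, 0 <= '[theta T u, u].
Proof.
move=> bT T0 u; have : closure Z u by rewrite Zdense.
apply: (closure_form_ge0 (theta_b bT)) => x Zx.
by have [n [f ->]] := Zform Zx; rewrite // sumr_ge0.
Qed.

Lemma ampliation_mono S T : bounded_op S -> bounded_op T -> op_le S T ->
  op_le (theta S) (theta T).
Proof.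
move=> bS bT ST; apply/op_le_subr/op_ge0P; rewrite -thetaB //.
apply: ampliation_ge0; first exact: bmap_sub.
by move=> e; rewrite inner_subop subr_ge0; exact: ST.
Qed.

(** A vector u is approximated by x in Z.  At x, finitely many vectors f_i have to
    be taken care of; the form at u - x is controlled by the fixed operator
    theta (t - T0), as soon as T >= T0. *)
Lemma ampliation_weak_sup D t : directed_sa (@bounded_op R L) D -> bounded_op t ->
  weak_sup D t -> weak_sup (theta @` D) (theta t).
Proof.
move=> dD bs wD; have Db T : D T -> bounded_op T by move=> /dD.2.1[].
split; first by move=> _ [T DT <-]; apply: ampliation_mono (wD.1 _ DT) => //; exact: Db.
move=> u e e0; have [[T0 DT0] _] := dD.
have gap0 T : D T -> forall v, 0 <= '[(theta t \- theta T) v, v].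
  move=> DT v; rewrite /= innerBl subr_ge0.
  by apply: ampliation_mono (wD.1 _ DT) _ => //; exact: Db.
have bgap T : D T -> bounded_op (theta t \- theta T).
  by move=> DT; apply: bmap_sub; [exact: theta_b | exact: theta_b (Db _ DT)].
have [c c0 cP] := positive_bound (bgap _ DT0) (gap0 _ DT0).
have := closureP Z u; rewrite Zdense => -[/(_ I) uappr _].
pose d := e / (e + c *+ 4).
have ec : 0 < e + c *+ 4 by rewrite addr_gt0 // pmulrn_lgt0.
have d0 : 0 < d by rewrite divr_gt0.
have d1 : d <= 1 by rewrite ler_pdivrMr // mul1r lerDl mulrn_wge0 // ltW.
have cd : c * d ^+ 2 <= e / 4.
  apply: le_trans (_ : c * d <= _).
    by rewrite ler_wpM2l ?(ltW c0) // expr2 ger_pMr.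
  rewrite /d mulrA ler_pdivrMr //.
  by have := mulr_ge0 (ltW e0) (ltW e0); rewrite -mulr_natr; nra.
have [|x Zx ux] := uappr d%:C; first by rewrite ltcR.
have [n [f xE]] := Zform Zx.
pose k := e / (4 * n.+1%:R).
have k0 : 0 < k by rewrite divr_gt0 // mulr_gt0 // ltr0n.
have [T [DT T0T Tf]] := weak_sup_seq [seq f i | i <- enum 'I_n] dD wD DT0 k0.
exists (theta T); first by exists T.
rewrite -lerBlDl -innerBl.
pose W := theta t \- theta T; rewrite -[theta t u - theta T u]/(W u).
have -> : u = x + (u - x) by rewrite addrC subrK.
apply: le_trans (form_add_le _ _ (bgap _ DT) (gap0 _ DT)) _.
have h1 : '[W x, x] <= (k *+ n)%:C.
  have bsT : bounded_op (t \- T) by apply: bmap_sub => //; exact: Db.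
  rewrite /W -thetaB //; last exact: Db.
  rewrite xE // rmorphMn -[X in _ *+ X](card_ord n) -sumr_const.
  rewrite ler_sum // => i _; rewrite inner_subop lerBlDl; apply: Tf.
  by apply/mapP; exists i; rewrite ?mem_enum.
have h2 : '[W (u - x), u - x] <= (c * d ^+ 2)%:C.
  apply: le_trans (_ : '[(theta t \- theta T0) (u - x), u - x] <= _).
    rewrite /W !inner_subop lerB //.
    by apply: ampliation_mono T0T _; exact: Db.
  apply: le_trans (cP _) _; rewrite rmorphM rmorphXn /= ler_wpM2l ?ler0c ?(ltW c0) //.
  by rewrite -norm_inner ler_pXn2r ?nnegrE ?ler0c ?(ltW d0) // ltW.
apply: le_trans (_ : 2 * (k *+ n)%:C + 2 * (c * d ^+ 2)%:C <= _).
  by rewrite lerD // ler_wpM2l.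
have -> : 2 * (k *+ n)%:C + 2 * (c * d ^+ 2)%:C = (2 * (k *+ n) + 2 * (c * d ^+ 2))%:C.
  by rewrite rmorphD (rmorphM _ 2 (k *+ n)) (rmorphM _ 2 (c * _)) rmorph_nat.
rewrite lecR.
have kn : k *+ n <= e / 4.
  rewrite /k -mulr_natr mulrAC ler_pdivrMr ?mulr_gt0 ?ltr0n //.
  by rewrite mulrA divfK // ler_wpM2l ?(ltW e0) // ler_nat.
lra.
Qed.


End Ampliation.

(** * The coupling algebra and its fundamental domains *)

(** The situation of A, or of the opposite of B, in an orbit equivalence: pi and
    rho are commuting representations of C and Q, and the state of xi on them is
    the product of the traces.  The algebra of the coupling is the commutant of
    Q. *)
Section Coupling.
Variables (R : realType) (H : hilbert R) (op : bool) (C Q : tracial_von_neumann R).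
Variables (pi : (tspace C -> tspace C) -> (H -> H)).
Variables (rho : (tspace Q -> tspace Q) -> (H -> H)) (xi : H).
Hypotheses (rpi : star_rep op pi) (rrho : star_rep false rho).
Hypothesis rho_pi : forall y c u, talg Q y -> talg C c ->
  rho y (pi c u) = pi c (rho y u).
Hypothesis state : forall y c, talg Q y -> talg C c ->
  '[rho y (pi c xi), xi] = trace Q y * trace C c.
Hypothesis total : closure (lspan [set u | exists y c, talg Q y /\ talg C c /\
  u = rho y (pi c xi)]) = setT.

Definition orbit : set H := [set pi c xi | c in talg C].

Lemma orbit_subspace : subspace_of orbit.
Proof.
split; first by exists (cst 0); [exact: talg_cst0 | rewrite (rep0 rpi)].
move=> a _ _ [c Cc <-] [d Cd <-]; exists ((fun u => a *: c u) \+ d).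
  by apply: talg_add => //; exact: talg_scale.
by rewrite (repD rpi) ?(repZ rpi) //; exact: talg_scale.
Qed.

Lemma closed_orbit : closed_subspace (closure orbit).
Proof. by split; [exact: subspace_closure orbit_subspace | exact: closed_closure]. Qed.

Definition standard_space : hilbert R := subspace_hilbert closed_orbit.
Arguments standard_space : simpl never.
Local Notation L := standard_space.
Local Notation emb := (@emb R H (closure orbit) closed_orbit).

Lemma std_embB (e f : L) : emb (e - f) = emb e - emb f. Proof. exact: embB. Qed.
Lemma emb_sum m (F : 'I_m -> L) : emb (\sum_i F i) = \sum_i emb (F i).
Proof. exact: (big_morph emb (fun x y => erefl) erefl). Qed.
Lemma inner_emb (e f : L) : '[e, f] = '[emb e, emb f]. Proof. by []. Qed.

Lemma rhoM x y u : talg Q x -> talg Q y -> rho (x \o y) u = rho x (rho y u).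
Proof. by move=> Qx Qy; rewrite -[x \o y]/(Defs.mulo false x y) (repM rrho). Qed.

Lemma piM c d u : talg C c -> talg C d -> pi (Defs.mulo op c d) u = pi c (pi d u).
Proof. by move=> Cc Cd; rewrite (repM rpi). Qed.

Lemma inner_rho_pi y z z' c d d' : talg Q y -> talg Q z -> is_adjoint z z' ->
  talg C c -> talg C d -> is_adjoint d d' ->
  '[rho y (pi c xi), rho z (pi d xi)] = trace Q (z' \o y) * trace C (Defs.mulo op d' c).
Proof.
move=> Qy Qz zz' Cc Cd dd'; have Qz' := talg_adj Qz zz'; have Cd' := talg_adj Cd dd'.
have [_ [_ hz]] := adjC (rep_adj rrho Qz zz').
have [_ [_ hd]] := adjC (rep_adj rpi Cd dd').
rewrite -hz -hd -rho_pi // -rho_pi // -piM // -rhoM //.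
rewrite state //; [exact: talg_comp | exact: talg_mulo].
Qed.

Lemma trace_mulo c : trace C (Defs.mulo op id c) = trace C c.
Proof. by case: op. Qed.

Lemma inner_rho_xi y z z' : talg Q y -> talg Q z -> is_adjoint z z' ->
  '[rho y xi, rho z xi] = trace Q (z' \o y).
Proof.
move=> Qy Qz zz'; have := inner_rho_pi Qy Qz zz' (talg_id C) (talg_id C) (adj_id _).
by rewrite !(rep1 rpi) trace_mulo trace1 mulr1.
Qed.

Lemma inner_pi_xi c d d' : talg C c -> talg C d -> is_adjoint d d' ->
  '[pi c xi, pi d xi] = trace C (Defs.mulo op d' c).
Proof.
move=> Cc Cd dd'; have := inner_rho_pi (talg_id Q) (talg_id Q) (adj_id _) Cc Cd dd'.
by rewrite !(rep1 rrho) trace1 mul1r.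
Qed.

Lemma inner_rho_flip y y' z z' : talg Q y -> talg Q z -> is_adjoint y y' ->
  is_adjoint z z' -> '[rho y xi, rho z xi] = '[rho z' xi, rho y' xi].
Proof.
move=> Qy Qz yy' zz'; have Qy' := talg_adj Qy yy'; have Qz' := talg_adj Qz zz'.
rewrite (inner_rho_xi Qy Qz zz') (inner_rho_xi Qz' Qy' (adjC yy')).
exact: trace_tracial.
Qed.

(** H is the tensor product of the completion of Q with L, where rho y e is the
    tensor product of y and e.  For e and f in the orbit of xi this is the product
    formula for the state; both sides are continuous in e and in f. *)
Lemma inner_tensor y z (e f : L) : talg Q y -> talg Q z ->
  '[rho y (emb e), rho z (emb f)] = '[rho y xi, rho z xi] * '[e, f].
Proof.
move=> Qy Qz; set k := '[rho y xi, rho z xi].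
have [y' Qy' yy'] := talg_adj_exists Qy; have [z' Qz' zz'] := talg_adj_exists Qz.
have [_ [_ hy]] := rep_adj rrho Qy yy'; have [_ [_ hz]] := rep_adj rrho Qz zz'.
pose w v := rho y' (rho z v) - k^*%R *: v.
have wP u v : '[u, w v] = '[rho y u, rho z v] - k * '[u, v].
  by rewrite innerBr -hy innerZr conjCK.
pose w' u := rho z' (rho y u) - k *: u.
have w'P u v : '[v, w' u] = ('[rho y u, rho z v] - k * '[u, v])^*%R.
  rewrite innerBr innerZr -hz rmorphB rmorphM /=.
  by rewrite -!(innerC _ (rho _ _)) -(innerC v u).
have step1 u d : closure orbit u -> talg C d -> '[u, w (pi d xi)] = 0.
  move=> Xu Cd; apply: closure_inner0 Xu => _ [c Cc <-].
  have [d' Cd' dd'] := talg_adj_exists Cd.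
  rewrite wP (inner_rho_pi Qy Qz zz' Cc Cd dd') (inner_pi_xi Cc Cd dd').
  by rewrite /k (inner_rho_xi Qy Qz zz') subrr.
have step2 u v : closure orbit u -> closure orbit v -> '[v, w' u] = 0.
  move=> Xu Xv; apply: closure_inner0 Xv => _ [d Cd <-].
  by rewrite w'P -wP step1 // rmorph0.
apply/eqP; rewrite -subr_eq0 -conjC_eq0 -w'P; apply/eqP.
by apply: step2; exact: emb_in.
Qed.


(* The elements of H in play are sums of tensors rho y e.  They are represented by
   lists of pairs (y, e), because the action of an operator T of L on the second
   factors is to be described before it is known to depend on the sum only. *)
Implicit Types s : seq ((tspace Q -> tspace Q) * L).

Fixpoint coeffs_in s : Prop := if s is p :: s' then talg Q p.1 /\ coeffs_in s' else True.

Definition ev (T : L -> L) s : H := \sum_(p <- s) rho p.1 (emb (T p.2)).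

Lemma coeffs_in_cat s t : coeffs_in s -> coeffs_in t -> coeffs_in (s ++ t).
Proof. by elim: s => //= p s IH [Qp /IH h] /h. Qed.

Lemma ev_nil T : ev T [::] = 0. Proof. exact: big_nil. Qed.
Lemma ev_cons T p s : ev T (p :: s) = rho p.1 (emb (T p.2)) + ev T s.
Proof. exact: big_cons. Qed.
Lemma ev_cat T s t : ev T (s ++ t) = ev T s + ev T t.
Proof. exact: big_cat. Qed.

Lemma rho_bounded y : talg Q y -> bounded_op (rho y).
Proof. exact: (rep_bounded rrho). Qed.

Lemma formal_scale (a : R[i]) s : coeffs_in s -> exists2 t, coeffs_in t &
  forall T, bounded_op T -> ev T t = a *: ev T s.
Proof.
elim: s => [_|p s IH /= [Qp /IH[t Qt tE]]].
  by exists [::] => // T _; rewrite !ev_nil scaler0.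
exists ((p.1, a *: p.2) :: t) => // T bT.
by rewrite !ev_cons /= tE // (bmapZ bT) embZ (bmapZ (rho_bounded Qp)) scalerDr.
Qed.

Lemma formal_act y s : talg Q y -> coeffs_in s -> exists2 t, coeffs_in t &
  forall T, ev T t = rho y (ev T s).
Proof.
move=> Qy; elim: s => [_|p s IH /= [Qp /IH[t Qt tE]]].
  by exists [::] => // T; rewrite !ev_nil (bmap0 (rho_bounded Qy)).
exists ((y \o p.1, p.2) :: t) => [|T /=]; first by split=> //; exact: talg_comp.
by rewrite !ev_cons /= tE rhoM // (bmapD (rho_bounded Qy)).
Qed.

Definition orthonormal_family n (z : 'I_n -> tspace Q -> tspace Q) :=
  (forall i, talg Q (z i)) /\
  forall i j, '[rho (z i) xi, rho (z j) xi] = (i == j)%:R.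

Lemma rho_eq0 y : talg Q y -> rho y xi = 0 -> forall e : L, rho y (emb e) = 0.
Proof.
by move=> Qy y0 e; apply: inner_eq0; rewrite inner_tensor // y0 inner0l mul0r.
Qed.

(** Gram-Schmidt for the first factors and the inner product of the vectors
    rho y xi; the second factors absorb the coefficients, simultaneously for all
    T. *)
Lemma orthonormal_form s : coeffs_in s -> exists n z (f : 'I_n -> L),
  orthonormal_family z /\
  forall T, bounded_op T -> ev T s = \sum_i rho (z i) (emb (T (f i))).
Proof.
elim: s => [_|[y e] s IH /= [Qy /IH[n [z [f [[Qz zz] sE]]]]]].
  exists 0, (fun=> id), (fun=> 0); split; first by split=> -[].
  by move=> T _; rewrite ev_nil big_ord0.
pose c i := '[rho y xi, rho (z i) xi].
pose p := fun u => \sum_i c i *: z i u.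
have Qsum (I : Type) (r : seq I) (d : I -> R[i]) (g : I -> tspace Q -> tspace Q) :
    (forall i, talg Q (g i)) -> talg Q (fun u => \sum_(i <- r) d i *: g i u) /\
    forall v, rho (fun u => \sum_(i <- r) d i *: g i u) v = \sum_(i <- r) d i *: rho (g i) v.
  move=> Qg; elim: r => [|i r [IH1 IH2]].
    have -> : (fun u => \sum_(i <- [::]) d i *: g i u) = cst 0.
      by apply/funext => u; rewrite big_nil.
    split; first exact: talg_cst0.
    by move=> v; rewrite (rep0 rrho) big_nil.
  have -> : (fun u => \sum_(j <- i :: r) d j *: g j u) =
      (fun u => d i *: g i u) \+ (fun u => \sum_(j <- r) d j *: g j u).
    by apply/funext => u; rewrite big_cons.
  have Qi := talg_scale (d i) (Qg i).
  split; first exact: talg_add.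
  by move=> v; rewrite (repD rrho) // (repZ rrho) //= IH2 big_cons.
have [Qp pE] := Qsum _ (index_enum 'I_n) c z Qz.
pose q := y \- p; have Qq : talg Q q by exact: talg_sub.
have qE v : rho q v = rho y v - \sum_i c i *: rho (z i) v.
  by rewrite (repB rrho) //= pE.
have qz j : '[rho q xi, rho (z j) xi] = 0.
  rewrite qE innerBl inner_suml (bigD1 j) //= innerZl zz eqxx mulr1 big1 ?addr0 ?subrr //.
  by move=> i ij; rewrite innerZl zz (negbTE ij) mulr0.
have yE v : rho y v = rho q v + \sum_i c i *: rho (z i) v by rewrite qE subrK.
pose f' i := f i + c i *: e.
have redistribute T : bounded_op T -> ev T ((y, e) :: s) =
    rho q (emb (T e)) + \sum_i rho (z i) (emb (T (f' i))).
  move=> bT; rewrite ev_cons /= sE // yE -addrA -big_split /=; congr (_ + _).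
  apply: eq_bigr => i _; rewrite (bmapD bT) (bmapZ bT) embD embZ.
  by rewrite (bmapD (rho_bounded (Qz i))) (bmapZ (rho_bounded (Qz i))) addrC.
have [q0|q0] := eqVneq (rho q xi) 0.
  exists n, z, f'; split=> // T bT; rewrite redistribute //.
  by rewrite (rho_eq0 Qq q0) add0r.
have nq : `|rho q xi| != 0 by rewrite normr_eq0.
pose r u := `|rho q xi|^-1 *: q u; have Qr : talg Q r by exact: talg_scale.
have rE v : rho r v = `|rho q xi|^-1 *: rho q v by rewrite (repZ rrho).
have rr : '[rho r xi, rho r xi] = 1.
  rewrite rE innerZl innerZr -norm_inner fmorphV /= (geC0_conj (normr_ge0 _)).
  by rewrite mulrA -invfM -expr2 mulVf // expf_neq0.
have rz j : '[rho r xi, rho (z j) xi] = 0 by rewrite rE innerZl qz mulr0.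
exists n.+1, (fcons r z), (fcons (`|rho q xi| *: e) f'); split.
  split=> [i|i j].
    by case: (unliftP ord0 i) => [k ->|->]; rewrite ?fconsS ?fcons0.
  case: (unliftP ord0 i) => [k ->|->]; case: (unliftP ord0 j) => [m ->|->];
    rewrite ?fconsS ?fcons0 ?eqxx //.
  by rewrite innerC rz rmorph0 eq_sym (negbTE (neq_lift _ _)).
move=> T bT; rewrite redistribute // big_ord_recl !fcons0; congr (_ + _).
  by rewrite rE (bmapZ bT) embZ (bmapZ (rho_bounded Qq)) scalerA mulVf // scale1r.
by apply: eq_bigr => i _; rewrite !fconsS.
Qed.

Lemma orthonormal_inner n z (f g : 'I_n -> L) : orthonormal_family z ->
  '[\sum_i rho (z i) (emb (f i)), \sum_i rho (z i) (emb (g i))] = \sum_i '[f i, g i].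
Proof.
move=> [Qz zz]; rewrite inner_suml; apply: eq_bigr => i _.
rewrite inner_sumr (bigD1 i) //= big1 ?addr0.
  by rewrite inner_tensor // zz eqxx mul1r.
by move=> j ji; rewrite inner_tensor // zz eq_sym (negbTE ji) mul0r.
Qed.

Definition coupling_algebra : set (H -> H) := commutant (rho @` talg Q).
Local Notation M := coupling_algebra.

Lemma rho_image_bounded : rho @` talg Q `<=` @bounded_op R H.
Proof. by move=> _ [y Qy <-]; exact: rho_bounded. Qed.

Lemma rho_image_adj S T : (rho @` talg Q) S -> is_adjoint S T -> (rho @` talg Q) T.
Proof.
move=> [y Qy <-] yT; have [y' Qy' yy'] := talg_adj_exists Qy.
by exists y' => //; exact: adj_uniq (rep_adj rrho Qy yy') yT.
Qed.

Lemma tensors_dense : closure [set u | exists2 s, coeffs_in s & u = ev id s] = setT.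
Proof.
set Z := [set u | _].
have sZ : subspace_of Z.
  split; first by exists [::] => //; rewrite ev_nil.
  move=> a _ _ [s Qs ->] [t Qt ->]; have [s' Qs' s'E] := formal_scale a Qs.
  exists (s' ++ t); first exact: coeffs_in_cat.
  by rewrite ev_cat s'E //; exact: bmap_id.
apply/seteqP; split=> // u _.
have : closure (lspan [set u | exists y c, talg Q y /\ talg C c /\
  u = rho y (pi c xi)]) u by rewrite total.
apply: closureS; apply: lspan_sub sZ _ => _ [y [c [Qy [Cc ->]]]].
have Xc : closure orbit (pi c xi) by apply: subset_closure; exists c.
by exists [:: (y, SubHilbert closed_orbit Xc)] => //; rewrite ev_cons ev_nil addr0.
Qed.

(** Operators that commute with rho are determined by their values on L, because
    the tensors rho y e are total. *)
Lemma coupling_ext S T : M S -> M T -> (forall e : L, S (emb e) = T (emb e)) -> S = T.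
Proof.
move=> MS MT ST; apply: (bmap_eq_on_dense MS.1 MT.1 tensors_dense) => _ [s Qs ->].
elim: s Qs => [_|p s IH /= [Qp /IH sE]]; first by rewrite ev_nil (bmap0 MS.1) (bmap0 MT.1).
rewrite ev_cons (bmapD MS.1) (bmapD MT.1) sE; congr (_ + _).
have rp : (rho @` talg Q) (rho p.1) by exists p.1.
by rewrite -(commutantP _ MS rp) -(commutantP _ MT rp) ST.
Qed.

(** When the first factors are orthonormal, T acts on the orthogonal components of
    a sum of tensors, which gives the bound. *)
Lemma amplification_exists (T : L -> L) : bounded_op T ->
  exists2 W, M W & forall e : L, W (emb e) = emb (T e).
Proof.
move=> bT; pose G u v := exists s, [/\ coeffs_in s, u = ev id s & v = ev T s].
have G0 : G 0 0 by exists [::]; rewrite !ev_nil.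
have GP : forall a u v u' v', G u v -> G u' v' -> G (a *: u + u') (a *: v + v').
  move=> a _ _ _ _ [s [Qs -> ->]] [t [Qt -> ->]].
  have [s' Qs' s'E] := formal_scale a Qs; exists (s' ++ t).
  by split; [exact: coeffs_in_cat|rewrite ev_cat s'E //; exact: bmap_id|rewrite ev_cat s'E].
have [c c0 cP] := bmap_bound bT.
have [|W [bW WG _]] := @bounded_extension _ H H G G0 GP.
  exists c => _ _ [s [Qs -> ->]]; have [n [z [f [zz sE]]]] := orthonormal_form Qs.
  rewrite !sE //; last exact: bmap_id.
  rewrite -(@ler_pXn2r _ 2) ?nnegrE ?mulr_ge0 ?(ltW c0) // exprMn !norm_inner.
  rewrite !orthonormal_inner // mulr_sumr ler_sum // => i _.
  by rewrite -!norm_inner -exprMn ler_pXn2r ?nnegrE ?mulr_ge0 ?(ltW c0).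
exists W; last first.
  move=> e; apply: WG; exists [:: (id, e)]; split; first by split=> //; exact: talg_id.
  - by rewrite ev_cons ev_nil addr0 (rep1 rrho).
  - by rewrite ev_cons ev_nil addr0 (rep1 rrho).
apply: commutant_intro => // _ u [y Qy <-].
have : closure [set u | exists2 s, coeffs_in s & u = ev id s] u by rewrite tensors_dense.
apply: (@closure_bmap_eq _ _ _ _ (rho y \o W) (W \o rho y)).
- by apply: bmap_comp => //; exact: rho_bounded.
- by apply: bmap_comp => //; exact: rho_bounded.
move=> _ [s Qs ->] /=; have [t Qt tE] := formal_act Qy Qs.
rewrite (WG _ (ev T s)); last by exists s.
by rewrite (WG _ (ev T t)) ?tE //; exists t; rewrite tE.
Qed.


(** The operator T (x) 1.  On unbounded T, where the value is arbitrary, it is the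
    identity. *)
Definition amplification : (L -> L) -> (H -> H) :=
  projT1 (choice (fun T : L -> L =>
    match pselect (bounded_op T) return
      (exists W, bounded_op T -> M W /\ forall e : L, W (emb e) = emb (T e)) with
    | left bT => let: ex_intro2 W MW WE := amplification_exists bT in
        ex_intro _ W (fun=> conj MW WE)
    | right nT => ex_intro _ id (fun bT => False_ind _ (nT bT))
    end)).
Local Notation theta := amplification.

Lemma amplificationP T : bounded_op T -> M (theta T) /\ forall e : L, theta T (emb e) = emb (T e).
Proof. by rewrite /theta; case: choice => f fP /= bT; exact: fP. Qed.

Lemma amp_in T : bounded_op T -> M (theta T).
Proof. by move=> /amplificationP[]. Qed.

Lemma ampE T (e : L) : bounded_op T -> theta T (emb e) = emb (T e).
Proof. by move=> /amplificationP[]. Qed.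

Lemma amp_uniq W T : bounded_op T -> M W -> (forall e : L, W (emb e) = emb (T e)) ->
  theta T = W.
Proof.
by move=> bT MW WE; apply: coupling_ext => // [|e]; [exact: amp_in | rewrite ampE // WE].
Qed.

Let Mb := rho_image_bounded.

Lemma ampD S T : bounded_op S -> bounded_op T -> theta (S \+ T) = theta S \+ theta T.
Proof.
move=> bS bT; apply: amp_uniq; first exact: bmap_add.
  exact: (commutant_add Mb (amp_in bS) (amp_in bT)).
by move=> e /=; rewrite !ampE.
Qed.

Lemma ampZ (c : R[i]) S : bounded_op S ->
  theta (fun u => c *: S u) = (fun u => c *: theta S u).
Proof.
move=> bS; apply: amp_uniq; first exact: bmap_scale.
  exact: (commutant_scale Mb c (amp_in bS)).
by move=> e /=; rewrite !ampE.
Qed.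

Lemma ampB S T : bounded_op S -> bounded_op T -> theta (S \- T) = theta S \- theta T.
Proof.
move=> bS bT; apply: amp_uniq; first exact: bmap_sub.
  exact: (commutant_sub Mb (amp_in bS) (amp_in bT)).
by move=> e; rewrite -[(S \- T) e]/(S e - T e) std_embB /= !ampE.
Qed.

Lemma amp1 : theta id = id.
Proof. by apply: amp_uniq => //; [exact: bmap_id | exact: commutant_id]. Qed.

Lemma ampM S T : bounded_op S -> bounded_op T -> theta (S \o T) = theta S \o theta T.
Proof.
move=> bS bT; apply: amp_uniq; first exact: bmap_comp.
  exact: (commutant_comp (amp_in bS) (amp_in bT)).
by move=> e /=; rewrite !ampE.
Qed.

Lemma amp_tensor T y (e : L) : bounded_op T -> talg Q y ->
  theta T (rho y (emb e)) = rho y (emb (T e)).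
Proof.
move=> bT Qy; have ry : (rho @` talg Q) (rho y) by exists y.
by rewrite -(commutantP _ (amp_in bT) ry) ampE.
Qed.

Lemma amp_ev T s : bounded_op T -> coeffs_in s -> theta T (ev id s) = ev T s.
Proof.
move=> bT; have bW := (amp_in bT).1.
elim: s => [_|p s IH /= [Qp /IH sE]]; first by rewrite !ev_nil (bmap0 bW).
by rewrite !ev_cons (bmapD bW) sE amp_tensor.
Qed.

Lemma amp_adj T T' : is_adjoint T T' -> is_adjoint (theta T) (theta T').
Proof.
move=> [bT [bT' h]]; have [W WW] := adj_exists (amp_in bT).1; have [_ [_ hW]] := WW.
suff <- : W = theta T' by [].
apply/esym/amp_uniq => //.
  exact: (commutant_adj Mb (fun S T => @rho_image_adj S T) (amp_in bT) WW).
move=> e; apply/eqP; rewrite -subr_eq0; apply/eqP; set g := _ - _.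
apply: inner_extl => v; rewrite inner0l innerC.
suff -> : '[v, g] = 0 by rewrite rmorph0.
have : closure [set u | exists2 s, coeffs_in s & u = ev id s] v by rewrite tensors_dense.
apply: closure_inner0 => _ [s Qs ->].
elim: s Qs => [_|p s IH /= [Qp /IH sE]]; first by rewrite ev_nil inner0l.
rewrite ev_cons innerDl sE addr0 innerBr -hW amp_tensor //.
have one (f : L) : emb f = rho id (emb f) by rewrite (rep1 rrho).
rewrite [in X in X - _](one e) [in X in _ - X](one (T' e)).
rewrite !inner_tensor //; try exact: talg_id.
by rewrite h subrr.
Qed.

Lemma amp_form x : [set u | exists2 r, coeffs_in r & u = ev id r] x ->
  exists n (f : 'I_n -> L), forall T, bounded_op T ->
    '[theta T x, x] = \sum_i '[T (f i), f i].
Proof.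
move=> [r Qr ->]; have [n [z [f [zz rE]]]] := orthonormal_form Qr.
exists n, f => T bT; rewrite amp_ev // !rE //; last exact: bmap_id.
exact: orthonormal_inner.
Qed.

Lemma amp_weak_sup D t : directed_sa (@bounded_op R L) D -> bounded_op t ->
  weak_sup D t -> weak_sup (theta @` D) (theta t).
Proof.
exact: (ampliation_weak_sup tensors_dense (fun T bT => (amp_in bT).1) ampB amp_form).
Qed.

Lemma amp_embedding : vn_embedding false (@bounded_op R L) M theta.
Proof.
split; last first.
  move=> S T bS bT ST; apply/funext => e; apply: emb_inj.
  by rewrite -!ampE // ST.
split; first exact: amp_in.
split; first exact: ampD.
split; first exact: ampZ.
split; first exact: amp1.
split; first exact: ampM.
split; first by move=> S T _; exact: amp_adj.
move=> D t dD lubt; have bt : bounded_op t by case: lubt.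
apply: weak_sup_is_lub (amp_in bt) _; apply: amp_weak_sup => //.
rewrite -commutant_set0 in dD lubt.
have tub : forall T, D T -> op_le T t by case: lubt => _ [].
exact: (is_lub_weak_sup _ dD bt tub lubt).
Qed.

Lemma pi_coupling c : talg C c -> M (pi c).
Proof.
move=> Cc; apply: commutant_intro; first exact: (rep_bounded rpi).
by move=> _ u [y Qy <-]; exact: rho_pi.
Qed.

Lemma pi_orbit c (e : L) : talg C c -> closure orbit (pi c (emb e)).
Proof.
move=> Cc; apply/closureP => k k0; have bc := rep_bounded rpi Cc.
have [d d0 dP] := bmap_bound bc; have := emb_in e.
move=> /closureP/(_ (k / d) (divr_gt0 k0 d0))[_ [b Cb <-] eb].
exists (pi c (pi b xi)).
  by exists (Defs.mulo op c b); [exact: talg_mulo | exact: piM].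
by rewrite -(bmapB bc); apply: le_lt_trans (dP _) _; rewrite mulrC -ltr_pdivlMr.
Qed.

Definition std_vec (c : tspace C -> tspace C) : L :=
  match pselect (talg C c) with
  | left Cc => SubHilbert closed_orbit (subset_closure (ex_intro2 _ _ c Cc erefl))
  | right _ => 0
  end.

Lemma std_vecE c : talg C c -> emb (std_vec c) = pi c xi.
Proof. by rewrite /std_vec; case: pselect. Qed.

Definition std_left (c : tspace C -> tspace C) : L -> L :=
  match pselect (talg C c) with
  | left Cc => fun e => SubHilbert closed_orbit (@pi_orbit c e Cc)
  | right _ => id
  end.

Lemma std_leftE c (e : L) : talg C c -> emb (std_left c e) = pi c (emb e).
Proof. by rewrite /std_left; case: pselect. Qed.

Lemma std_vecD a b : talg C a -> talg C b -> std_vec (a \+ b) = std_vec a + std_vec b.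
Proof.
move=> Ca Cb; apply: emb_inj; rewrite embD !std_vecE //; last exact: talg_add.
by rewrite (repD rpi).
Qed.

Lemma std_vecZ (c : R[i]) a : talg C a -> std_vec (fun u => c *: a u) = c *: std_vec a.
Proof.
move=> Ca; apply: emb_inj; rewrite embZ !std_vecE //; last exact: talg_scale.
by rewrite (repZ rpi).
Qed.

Lemma std_inner a b b' : talg C a -> talg C b -> is_adjoint b b' ->
  '[std_vec a, std_vec b] = trace C (Defs.mulo op b' a).
Proof. by move=> Ca Cb bb'; rewrite inner_emb !std_vecE //; exact: inner_pi_xi. Qed.

Lemma std_dense : closure [set std_vec a | a in talg C] = setT.
Proof.
apply/seteqP; split=> // e _; apply/closureP => k k0.
have := emb_in e => /closureP/(_ k k0)[_ [c Cc <-] h].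
by exists (std_vec c); [exists c | rewrite -emb_norm std_embB std_vecE].
Qed.

Lemma std_left_bounded a : talg C a -> bounded_op (std_left a).
Proof.
move=> Ca; have ba := rep_bounded rpi Ca; split.
  by move=> c u v; apply: emb_inj; rewrite embD embZ !std_leftE // embD embZ (bmapP ba).
have [d d0 dP] := bmap_bound ba; exists d => u.
by rewrite -!emb_norm std_leftE.
Qed.

Lemma std_left_vec a b : talg C a -> talg C b ->
  std_left a (std_vec b) = std_vec (Defs.mulo op a b).
Proof.
move=> Ca Cb; apply: emb_inj; rewrite std_leftE // !std_vecE // ?piM //.
exact: talg_mulo.
Qed.

Definition coupling_standard_rep : standard_rep op C :=
  StandardRep std_vecD std_vecZ std_inner std_dense std_left_bounded std_left_vec.

Lemma amp_left a : talg C a -> theta (std_left a) = pi a.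
Proof.
move=> Ca; apply: amp_uniq; [exact: std_left_bounded | exact: pi_coupling |].
by move=> e; rewrite std_leftE.
Qed.

(** The corner of the coupling algebra under G = p (x) 1, where p is the projection
    on the span of the orthonormal vectors eta i. *)
Section FiniteCorner.
Variables (m : nat) (p : L -> L) (eta : 'I_m -> L).
Hypotheses (bp : bounded_op p) (etaP : orthonormal_vectors eta).
Hypothesis pE : forall u, p u = \sum_i '[u, eta i] *: eta i.
Local Notation G := (theta p).
Local Notation h i := (emb (eta i)).

Lemma amp_range_form r : coeffs_in r -> exists2 y : 'I_m -> tspace Q -> tspace Q,
  (forall j, talg Q (y j)) & ev p r = \sum_j rho (y j) (h j).
Proof.
elim: r => [_|[z e] r IH /= [Qz /IH[y Qy rE]]].
  exists (fun=> cst 0); first by move=> _; exact: talg_cst0.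
  by rewrite ev_nil big1 // => j _; rewrite (rep0 rrho).
exists (fun j => (fun u => '[e, eta j] *: z u) \+ y j).
  by move=> j; apply: talg_add => //; exact: talg_scale.
rewrite ev_cons rE pE emb_sum (bmap_sum (rho_bounded Qz)) -big_split.
apply: eq_bigr => j _; rewrite embZ (bmapZ (rho_bounded Qz)).
by rewrite (repD rrho) ?(repZ rrho) //; exact: talg_scale.
Qed.

Lemma amp_range_approx u (e : R) : 0 < e -> G u = u ->
  exists2 y : 'I_m -> tspace Q -> tspace Q, (forall j, talg Q (y j)) &
    nsq (u - \sum_j rho (y j) (h j)) <= e.
Proof.
move=> e0 Gu; have [c c0 cP] := bmap_bound (amp_in bp).1.
have c1 : 0 < complex.Re c := re_lt c0.
have := closureP _ u => /(_ [set u | exists2 r, coeffs_in r & u = ev id r]).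
rewrite tensors_dense => -[/(_ I) uappr _].
have se0 : 0 < Num.sqrt e by rewrite sqrtr_gt0.
have [|_ [r Qr ->] ur] := uappr ((Num.sqrt e)%:C / c); first by rewrite divr_gt0 // ltcR.
have [y Qy yE] := amp_range_form Qr; exists y => //.
rewrite -yE -amp_ev // -[u in u - _]Gu -(bmapB (amp_in bp).1).
rewrite -lecR nsqE -(sqr_sqrtr (ltW e0)) rmorphXn /= ler_pXn2r ?nnegrE ?ler0c ?(ltW se0) //.
by apply: le_trans (cP _) _; rewrite mulrC -ler_pdivlMr // ltW.
Qed.

Lemma inner_range (y z : 'I_m -> tspace Q -> tspace Q) :
  (forall j, talg Q (y j)) -> (forall j, talg Q (z j)) ->
  '[\sum_j rho (y j) (h j), \sum_j rho (z j) (h j)] =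
    \sum_j '[rho (y j) xi, rho (z j) xi].
Proof.
move=> Qy Qz; rewrite inner_suml; apply: eq_bigr => i _.
rewrite inner_sumr (bigD1 i) //= big1 ?addr0.
  by rewrite inner_tensor // etaP eqxx mulr1.
by move=> j ji; rewrite inner_tensor // etaP eq_sym (negbTE ji) mulr0.
Qed.

(** The sum of the vector functionals of the h i is a trace on the corner.  Put
    v h_i = x_i up to a small error, with x_i = sum_j rho y_ij h_j, and
    x'_j = sum_i rho y_ij* h_i.  As v commutes with rho, sum_i <v h_i, x_i> is
    sum_j <x'_j, w h_j>; as Q is tracial, the x_i and the x'_j have the same sum
    of squared norms.  Hence sum_i |v h_i|^2 is nearly
    2 Re sum_j <x'_j, w h_j> - sum_j |x'_j|^2, which is at most sum_j |w h_j|^2. *)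
Lemma corner_trace_le v w : M v -> is_adjoint v w -> (forall u, G (v u) = v u) ->
  \sum_i nsq (v (h i)) <= \sum_i nsq (w (h i)).
Proof.
move=> Mv vw Gv; have Mw : M w := commutant_adj Mb (fun S T => @rho_image_adj S T) Mv vw.
have [_ [_ hv]] := vw.
apply/ler_addgt0Pl => e e0; rewrite addrC.
have e1 : 0 < e / m.+1%:R by rewrite divr_gt0 // ltr0n.
have [y yP] := choice (fun i => let: ex_intro2 y Qy yE := amp_range_approx e1 (Gv (h i)) in
  ex_intro (fun y : 'I_m -> _ => (forall j, talg Q (y j)) /\ nsq (v (h i) - _) <= _) y (conj Qy yE)).
have Qy i j : talg Q (y i j) := (yP i).1 j.
have [y' y'P] : exists y' : 'I_m -> 'I_m -> tspace Q -> tspace Q,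
    forall i j, talg Q (y' i j) /\ is_adjoint (y i j) (y' i j).
  have ex ij : exists z, talg Q z /\ is_adjoint (y ij.1 ij.2) z.
    by have [z Qz yz] := talg_adj_exists (Qy ij.1 ij.2); exists z.
  by have [f fP] := choice ex; exists (fun i j => f (i, j)) => i j; exact: fP (i, j).
pose x i := \sum_j rho (y i j) (h j).
pose x' j := \sum_i rho (y' i j) (h i).
have cross : \sum_i '[v (h i), x i] = \sum_j '[x' j, w (h j)].
  transitivity (\sum_i \sum_j '[v (h i), rho (y i j) (h j)]).
    by apply: eq_bigr => i _; rewrite inner_sumr.
  rewrite exchange_big; apply: eq_bigr => j _; rewrite inner_suml.
  apply: eq_bigr => i _ /=; have [Qy' yy'] := y'P i j.
  have [_ [_ hy]] := adjC (rep_adj rrho (Qy i j) yy').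
  have ry : (rho @` talg Q) (rho (y' i j)) by exists (y' i j).
  by rewrite -hy (commutantP _ Mv ry) hv.
have norms : \sum_i nsq (x i) = \sum_j nsq (x' j).
  rewrite /nsq -!re_sum; congr complex.Re.
  transitivity (\sum_i \sum_j '[rho (y i j) xi, rho (y i j) xi]).
    by apply: eq_bigr => i _; exact: inner_range.
  rewrite exchange_big; apply: eq_bigr => j _ /=.
  rewrite inner_range => [|i|i]; try exact: (y'P _ _).1.
  by apply: eq_bigr => i _; exact: inner_rho_flip (y'P i j).2 (y'P i j).2.
have lhs : \sum_i nsq (v (h i)) = \sum_i nsq (v (h i) - x i) +
    2 * complex.Re (\sum_i '[v (h i), x i]) - \sum_i nsq (x i).
  rewrite re_sum mulr_sumr -big_split -sumrB; apply: eq_bigr => i _ /=.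
  by rewrite nsqB; ring.
have rhs : 0 <= \sum_j nsq (x' j) - 2 * complex.Re (\sum_j '[x' j, w (h j)]) +
    \sum_j nsq (w (h j)).
  rewrite re_sum mulr_sumr -sumrB -big_split sumr_ge0 // => j _ /=.
  by rewrite -nsqB; exact: nsq_ge0.
have small : \sum_i nsq (v (h i) - x i) <= e.
  apply: le_trans (_ : \sum_(i < m) e / m.+1%:R <= _).
    by apply: ler_sum => i _; exact: (yP i).2.
  rewrite sumr_const card_ord -[_ *+ m]mulr_natr mulrAC ler_pdivrMr ?ltr0n //.
  by rewrite ler_wpM2l ?(ltW e0) // ler_nat.
by rewrite lhs cross norms; lra.
Qed.

Lemma amp_corner_ext x : M x -> (forall i, x (h i) = 0) -> forall u, x (G u) = 0.
Proof.
move=> Mx xh u; suff xG : x \o G = cst 0 by exact: (congr1 (@^~ u) xG).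
apply: coupling_ext.
- exact: (commutant_comp Mx (amp_in bp)).
- exact: (commutant_cst0 Mb).
move=> e /=; rewrite ampE // pE emb_sum (bmap_sum Mx.1) big1 // => i _.
by rewrite embZ (bmapZ Mx.1) xh scaler0.
Qed.

(** Let w v = q and v w <= q.  By the trace inequality the form of x = q - v w
    vanishes at the h i, so x vanishes there; as x commutes with rho, it vanishes
    on the range of G, which contains the range of q. *)
Lemma finite_below q : M q -> is_projection q -> (forall u, G (q u) = q u) ->
  finite_projection M q.
Proof.
move=> Mq [sq qq] Gq; split=> //; split=> // v w Mv vw wv_q vw_q.
have [_ [_ hq]] := sq; have [bv [bw hv]] := vw; have hw := (adjC vw).2.2.
have qqE u : q (q u) = q u := congr1 (@^~ u) qq.
have wvE u : w (v u) = q u := congr1 (@^~ u) wv_q.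
have Mw : M w := commutant_adj Mb (fun S T => @rho_image_adj S T) Mv vw.
have bq := Mq.1.
have vq u : v (q u) = v u.
  apply/esym/eqP; rewrite -subr_eq0 -(bmapB bv); apply/eqP/inner_eq0.
  by rewrite hv wvE (bmapB bq) qqE subrr inner0r.
have wq u : w (q u) = w u.
  apply/esym/eqP; rewrite -subr_eq0 -(bmapB bw); apply/eqP/inner_eq0.
  apply/eqP; rewrite eq_le inner_ge0 andbT.
  by have := vw_q (u - q u); rewrite /= hv [q (u - _)](bmapB bq) qqE subrr inner0l.
have qv u : q (v u) = v u.
  by apply: inner_extl => x; rewrite hq -[v u]/(v u) !hv wq.
have Gv u : G (v u) = v u by rewrite -qv Gq.
pose x := q \- (v \o w).
have x0 u : 0 <= '[x u, u] by rewrite /x inner_subop subr_ge0; exact: vw_q.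
have Mvw : M (v \o w) := commutant_comp Mv Mw.
have Mx : M x := commutant_sub Mb Mq Mvw.
have xE u : '[x u, u] = (nsq (v u) - nsq (w u))%:C.
  by rewrite /x inner_subop /= hv -wvE hw rmorphB /= !nsqE !norm_inner.
have vwle i : 0 <= nsq (v (h i)) - nsq (w (h i)).
  by have := x0 (h i); rewrite xE ler0c.
have vw0 i : nsq (v (h i)) - nsq (w (h i)) = 0.
  apply/eqP; rewrite eq_le vwle andbT.
  apply: le_trans (_ : \sum_j (nsq (v (h j)) - nsq (w (h j))) <= _).
    by rewrite (bigD1 i) //= lerDl sumr_ge0.
  by rewrite sumrB subr_le0; exact: corner_trace_le.
have xh i : x (h i) = 0.
  have [c c0 cP] := positive_bound Mx.1 x0.
  have := norm_positive_op (h i) Mx.1 x0 cP.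
  rewrite xE vw0 mulr0 => hh; apply/eqP.
  by rewrite -normr_eq0 -sqrf_eq0 eq_le hh exprn_ge0.
have xG := amp_corner_ext Mx xh.
apply/funext => u; apply/esym/eqP; rewrite -subr_eq0.
have -> : q u - (v \o w) u = x (q u) by rewrite /x /= qqE wq.
by rewrite -Gq xG.
Qed.

End FiniteCorner.


Lemma coupling_von_neumann : von_neumann M.
Proof.
have M'b : commutant M `<=` @bounded_op R H by move=> T [].
split; first by move=> S T; exact: (commutant_adj Mb (fun S T => @rho_image_adj S T)).
apply/seteqP; split=> T; last first.
  move=> MT; apply: commutant_intro; first exact: MT.1.
  by move=> S u M'S; rewrite (commutantP _ M'S MT).
move=> cT; apply: commutant_intro; first exact: cT.1.
move=> S u rS; rewrite (commutantP _ cT) //; apply: commutant_intro; first exact: Mb.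
by move=> U v MU; rewrite (commutantP _ MU rS).
Qed.

Lemma coupling_fundamental_domain : has_finite_fundamental_domain op M pi.
Proof.
exists coupling_standard_rep, theta; split; first exact: amp_embedding.
split; first exact: amp_left.
move=> p pp fp; have [m [eta [etaP _ pE]]] := finite_rank_basis pp fp.
have [sp p2] := pp; have bp := sp.1.
have pG : is_projection (theta p).
  split; first exact: amp_adj.
  by rewrite -ampM // p2.
apply: (finite_below bp etaP pE) => //; first exact: amp_in.
by move=> u; exact: (congr1 (@^~ u) pG.2).
Qed.

(** For a central projection z take z (p (x) 1), where p projects L onto the line
    of xi.  If it were zero, z would vanish at xi; but z commutes with pi and rho,
    for which xi is cyclic. *)
Lemma coupling_semifinite : semifinite M.
Proof.
move=> z Mz M'z pz z_neq0.
have Xxi : closure orbit xi.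
  by apply: subset_closure; exists id; [exact: talg_id | rewrite (rep1 rpi)].
pose xi0 : L := SubHilbert closed_orbit Xxi.
have xi1 : '[xi0, xi0] = 1.
  have := state (talg_id Q) (talg_id C); rewrite (rep1 rpi) (rep1 rrho) !trace1 mulr1.
  by [].
have [pp fp] := rank_one_projection xi1.
set p := (fun u => _) in pp fp.
have [m [eta [etaP _ pE]]] := finite_rank_basis pp fp.
have [sp p2] := pp; have bp := sp.1.
pose G := theta p; have MG : M G by exact: amp_in.
have GG u : G (G u) = G u by rewrite -[LHS]/((theta p \o theta p) u) -ampM // p2.
have sG : is_adjoint G G by exact: amp_adj.
have zG u : z (G u) = G (z u) by rewrite (commutantP _ M'z MG).
have [sz z2] := pz; have zz u : z (z u) = z u := congr1 (@^~ u) z2.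
have pq : is_projection (z \o G).
  split.
    have -> : z \o G = G \o z by apply/funext => u /=; rewrite zG.
    have := adj_comp sz sG; have -> : z \o G = G \o z by apply/funext => u /=; rewrite zG.
    by [].
  by apply/funext => u /=; rewrite zG zz -!zG GG.
exists (z \o G); split; [|split].
- apply: (finite_below bp etaP pE) => //; first exact: commutant_comp.
  by move=> u /=; rewrite -/G -zG GG.
- move=> zG0; apply: z_neq0.
  have zxi : z xi = 0.
    have := congr1 (@^~ xi) zG0; rewrite /= /G -[xi in theta p xi]/(emb xi0) ampE //.
    by rewrite /p xi1 scale1r.
  have dense0 : lspan [set u | exists y c, talg Q y /\ talg C c /\ u = rho y (pi c xi)]
      `<=` [set u | z u = 0].
    apply: lspan_sub; first split.
    + exact: bmap0 sz.1.
    + by move=> a u v /= zu zv; rewrite /= (bmapP sz.1) zu zv scaler0 addr0.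
    move=> _ [y [c [Qy [Cc ->]]]] /=; have ry : (rho @` talg Q) (rho y) by exists y.
    rewrite -(commutantP _ Mz ry) -(commutantP _ M'z (pi_coupling Cc)) zxi.
    by rewrite (bmap0 (rep_bounded rpi Cc)) (bmap0 (rho_bounded Qy)).
  by apply: (bmap_eq_on_dense sz.1 (bmap_cst0 H H) total) => u /dense0.
- move=> u /=; rewrite -[z (G u)]zz sz.2.2 zG.
  rewrite -[z u in leRHS]zz sz.2.2; apply: projection_le_id; split=> //.
  by apply/funext => v; exact: GG.
Qed.

End Coupling.

(** * Operators on a Hilbert space tensor product *)

Section TensorOperators.
Variables (R : realType) (H K : hilbert R) (L : hilbert_tensor H K).
Implicit Types (S : H -> H) (T : K -> K).
Local Notation simple := [set tens L p.1 p.2 | p in [set: H * K]].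

Lemma tens_ext (N : hilbert R) (V W : L -> N) : bounded_map V -> bounded_map W ->
  (forall u v, V (tens L u v) = W (tens L u v)) -> V = W.
Proof.
move=> bV bW VW; apply: (bmap_eq_on_dense bV bW (tens_dense L)).
apply: lspan_sub; first split.
- by rewrite /= (bmap0 bV) (bmap0 bW).
- by move=> a x y /= Vx Vy; rewrite (bmapP bV) (bmapP bW) Vx Vy.
- by move=> _ [[u v] _ <-]; exact: VW.
Qed.

Lemma tens_inner_ext (x y : L) :
  (forall u v, '[tens L u v, x] = '[tens L u v, y]) -> x = y.
Proof.
move=> h; apply/eqP; rewrite -subr_eq0; apply/eqP; apply: inner_extl => w.
rewrite inner0l innerC; suff -> : '[w, x - y] = 0 by rewrite rmorph0.
have : closure (lspan simple) w by rewrite tens_dense.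
apply: closure_inner0; apply: lspan_sub; first split.
- exact: inner0l.
- by move=> a u v /= ux vx; rewrite innerDl innerZl ux vx mulr0 addr0.
- by move=> _ [[u v] _ <-]; rewrite /= innerBr h subrr.
Qed.

Lemma tens_op_adj S S' T T' : is_adjoint S S' -> is_adjoint T T' ->
  is_adjoint (tens_op L S T) (tens_op L S' T').
Proof.
move=> [bS [bS' hS]] [bT [bT' hT]].
have bST := @tens_op_bounded R H K L S T bS bT.
have [W WW] := adj_exists bST; have [_ [bW hW]] := WW.
suff <- : W = tens_op L S' T' by [].
apply: tens_ext => //; first exact: tens_op_bounded.
move=> u v; apply: tens_inner_ext => u' v'.
by rewrite -hW !tens_opE // !tens_inner hS hT.
Qed.

Lemma tens_op_id : tens_op L id id = id.
Proof.
have bi := bmap_id H; have bj := bmap_id K.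
apply: tens_ext; [exact: tens_op_bounded | exact: bmap_id |].
by move=> u v; rewrite tens_opE.
Qed.

Lemma tens_op_comp S S' T T' : bounded_op S -> bounded_op S' -> bounded_op T ->
  bounded_op T' -> tens_op L (S \o S') (T \o T') = tens_op L S T \o tens_op L S' T'.
Proof.
move=> bS bS' bT bT'.
have bSS := bmap_comp bS' bS; have bTT := bmap_comp bT' bT.
apply: tens_ext; first exact: tens_op_bounded.
  by apply: bmap_comp; exact: tens_op_bounded.
by move=> u v; rewrite /= !tens_opE.
Qed.

Lemma tensDl u u' v : tens L (u + u') v = tens L u v + tens L u' v.
Proof. by have := tens_linearl L v 1 u u'; rewrite !scale1r. Qed.
Lemma tensDr u v v' : tens L u (v + v') = tens L u v + tens L u v'.
Proof. by have := tens_linearr L u 1 v v'; rewrite !scale1r. Qed.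
Lemma tens0l v : tens L 0 v = 0.
Proof. by have := tens_linearl L v (-1) 0 0; rewrite scaler0 addr0 scaleN1r addNr. Qed.
Lemma tens0r u : tens L u 0 = 0.
Proof. by have := tens_linearr L u (-1) 0 0; rewrite scaler0 addr0 scaleN1r addNr. Qed.
Lemma tensZl (a : R[i]) u v : tens L (a *: u) v = a *: tens L u v.
Proof. by have := tens_linearl L v a u 0; rewrite tens0l !addr0. Qed.
Lemma tensZr (a : R[i]) u v : tens L u (a *: v) = a *: tens L u v.
Proof. by have := tens_linearr L u a v 0; rewrite tens0r !addr0. Qed.

Lemma tens_opDl S S' T : bounded_op S -> bounded_op S' -> bounded_op T ->
  tens_op L (S \+ S') T = tens_op L S T \+ tens_op L S' T.
Proof.
move=> bS bS' bT; have bSS := bmap_add bS bS'.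
apply: tens_ext; first exact: tens_op_bounded.
  by apply: bmap_add; exact: tens_op_bounded.
by move=> u v; rewrite /= !tens_opE // tensDl.
Qed.

Lemma tens_opZl (a : R[i]) S T : bounded_op S -> bounded_op T ->
  tens_op L (fun u => a *: S u) T = (fun u => a *: tens_op L S T u).
Proof.
move=> bS bT; have baS := bmap_scale a bS.
apply: tens_ext; first exact: tens_op_bounded.
  by apply: bmap_scale; exact: tens_op_bounded.
by move=> u v; rewrite /= !tens_opE // tensZl.
Qed.

Lemma tens_opDr S T T' : bounded_op S -> bounded_op T -> bounded_op T' ->
  tens_op L S (T \+ T') = tens_op L S T \+ tens_op L S T'.
Proof.
move=> bS bT bT'; have bTT := bmap_add bT bT'.
apply: tens_ext; first exact: tens_op_bounded.
  by apply: bmap_add; exact: tens_op_bounded.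
by move=> u v; rewrite /= !tens_opE // tensDr.
Qed.

Lemma tens_opZr (a : R[i]) S T : bounded_op S -> bounded_op T ->
  tens_op L S (fun u => a *: T u) = (fun u => a *: tens_op L S T u).
Proof.
move=> bS bT; have baT := bmap_scale a bT.
apply: tens_ext; first exact: tens_op_bounded.
  by apply: bmap_scale; exact: tens_op_bounded.
by move=> u v; rewrite /= !tens_opE // tensZr.
Qed.

Local Notation theta S := (tens_op L S id).

Lemma tens_opBl S S' : bounded_op S -> bounded_op S' ->
  theta (S \- S') = theta S \- theta S'.
Proof.
move=> bS bS'; have -> : S \- S' = S \+ (fun u => (-1) *: S' u).
  by apply/funext => u /=; rewrite scaleN1r.
rewrite tens_opDl //; [|exact: bmap_scale|exact: bmap_id].
rewrite tens_opZl //; last exact: bmap_id.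
by apply/funext => u /=; rewrite scaleN1r.
Qed.

(** Gram-Schmidt for the second factors of a sum of simple tensors. *)
Lemma tens_op_form x : lspan simple x -> exists n (f : 'I_n -> H),
  forall S, bounded_op S -> '[theta S x, x] = \sum_i '[S (f i), f i].
Proof.
move=> [m [c [t [tP ->]]]].
have [p pE] := choice (fun k => let: ex_intro2 p _ E := tP k in
  ex_intro (fun p => tens L p.1 p.2 = t k) p E).
have sT : subspace_of [set: K] by [].
have [//|n [z [zz _ zE]]] := gram_schmidt (l := [seq (p k).2 | k <- enum 'I_m]) sT.
have pz k : (p k).2 = \sum_i '[(p k).2, z i] *: z i.
  by apply: zE; apply/mapP; exists k; rewrite ?mem_enum.
pose f i := \sum_k (c k * '[(p k).2, z i]) *: (p k).1.
have tens_suml (I : Type) (r : seq I) (F : I -> H) v :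
    tens L (\sum_(i <- r) F i) v = \sum_(i <- r) tens L (F i) v.
  exact: (big_morph (fun u => tens L u v) (fun u u' => tensDl u u' v) (tens0l v)).
have tens_sumr (I : Type) (r : seq I) (F : I -> K) u :
    tens L u (\sum_(i <- r) F i) = \sum_(i <- r) tens L u (F i).
  exact: (big_morph (tens L u) (fun v v' => tensDr u v v') (tens0r u)).
have xE : \sum_k c k *: t k = \sum_i tens L (f i) (z i).
  under [RHS]eq_bigr do rewrite tens_suml.
  rewrite exchange_big; apply: eq_bigr => k _ /=.
  rewrite -pE [in LHS](pz k) tens_sumr scaler_sumr; apply: eq_bigr => i _.
  by rewrite tensZr tensZl scalerA.
exists n, f => S bS; rewrite xE; have bi := bmap_id K.
have bS1 : bounded_op (theta S) by exact: tens_op_bounded.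
rewrite (bmap_sum bS1) inner_suml; apply: eq_bigr => i _.
rewrite inner_sumr (bigD1 i) //= big1 ?addr0 => [|j ji]; rewrite tens_opE // tens_inner zz.
  by rewrite eqxx mulr1.
by rewrite eq_sym (negbTE ji) mulr0.
Qed.

Lemma tens_op_weak_sup D s : directed_sa (@bounded_op R H) D -> bounded_op s ->
  weak_sup D s -> weak_sup ((fun S => theta S) @` D) (theta s).
Proof.
apply: (ampliation_weak_sup (tens_dense L) _ tens_opBl tens_op_form) => T bT.
exact: (@tens_op_bounded R H K L T id bT (bmap_id K)).
Qed.

Lemma tens_op_mono S S' : bounded_op S -> bounded_op S' -> op_le S S' ->
  op_le (theta S) (theta S').
Proof.
apply: (ampliation_mono (tens_dense L) _ tens_opBl tens_op_form) => T bT.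
exact: (@tens_op_bounded R H K L T id bT (bmap_id K)).
Qed.

End TensorOperators.

(** * From orbit equivalence to von Neumann equivalence *)

Section InvariantSubspaces.
Variables (R : realType) (H : hilbert R).

Lemma subspace_lspan (X : set H) : subspace_of (lspan X).
Proof.
split; first by exists 0, (fun=> 0), (fun=> 0); split=> [[]//|]; rewrite big_ord0.
move=> a _ _ [m [c [x [Xx ->]]]] [n [d [y [Xy ->]]]].
exists (m + n)%N, (fun i => match fintype.split i with inl j => a * c j | inr j => d j end).
exists (fun i => match fintype.split i with inl j => x j | inr j => y j end); split.
  by move=> i; case: (fintype.split i).
rewrite big_split_ord scaler_sumr; congr (_ + _); apply: eq_bigr => i _.
  by rewrite (unsplitK (inl i)) scalerA.
by rewrite (unsplitK (inr i)).
Qed.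

Lemma closure_bmap (X Y : set H) (S : H -> H) u : bounded_op S ->
  (forall x, X x -> closure Y (S x)) -> closure X u -> closure Y (S u).
Proof.
move=> bS XY /closureP Xu; apply/closureP => e e0.
have [c c0 cP] := bmap_bound bS; have e2 : 0 < e / 2 by rewrite divr_gt0.
have [x Xx ux] := Xu (e / 2 / c) (divr_gt0 e2 c0).
have /closureP/(_ _ e2)[y Yy Sxy] := XY x Xx; exists y => //.
have -> : S u - y = S (u - x) + (S x - y) by rewrite (bmapB bS) addrA subrK.
apply: le_lt_trans (ler_normD _ _) _; rewrite (splitr e) ler_ltD //.
by apply: le_trans (cP _) _; rewrite mulrC -ler_pdivlMr // ltW.
Qed.

(** The bounded extension of the identity of X. *)
Lemma orthogonal_projection (X : set H) : subspace_of X -> closed X ->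
  exists E : H -> H, [/\ bounded_op E, forall u, X (E u), forall u, X u -> E u = u &
    forall u, (forall x, X x -> '[u, x] = 0) -> E u = 0].
Proof.
move=> sX cX; have [X0 XP] := sX.
have [|||E [bE E1 E0]] := @bounded_extension R H H (fun u v => X u /\ u = v).
- by split.
- by move=> a u _ u' _ [Xu <-] [Xu' <-]; split=> //; exact: XP.
- by exists 1 => u _ [_ <-]; rewrite mul1r.
have EX u : X u -> E u = u by move=> Xu; exact: E1.
have E_orth u : (forall x, X x -> '[u, x] = 0) -> E u = 0.
  by move=> uX; apply: E0 => x _ [Xx _]; exact: uX.
exists E; split=> // u; have [e Xe eP] := projection_theorem u sX cX.
by rewrite -[u](subrK e) (bmapD bE) (E_orth _ eP) (EX _ Xe) add0r.
Qed.

Lemma projection_commutes (X : set H) (E S S' : H -> H) : subspace_of X -> closed X ->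
  bounded_op E -> (forall u, X u -> E u = u) ->
  (forall u, (forall x, X x -> '[u, x] = 0) -> E u = 0) ->
  is_adjoint S S' -> (forall u, X u -> X (S u)) -> (forall u, X u -> X (S' u)) ->
  forall u, S (E u) = E (S u).
Proof.
move=> sX cX bE EX E0 [bS [bS' hS]] XS XS' u.
have [e Xe eP] := projection_theorem u sX cX.
have E1 : E (u - e) = 0 := E0 _ eP.
have E2 : E (S (u - e)) = 0 by apply: E0 => x Xx; rewrite hS; apply: eP; exact: XS'.
rewrite -[u](subrK e) (bmapD bE) E1 add0r EX // (bmapD bS) (bmapD bE) E2 add0r.
by rewrite EX //; exact: XS.
Qed.

End InvariantSubspaces.

Section Embedding.
Variables (R : realType) (H : hilbert R) (op : bool) (C Q : tracial_von_neumann R).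
Variables (pi : (tspace C -> tspace C) -> (H -> H)).
Variables (rho : (tspace Q -> tspace Q) -> (H -> H)) (xi : H).
Hypotheses (npi : normal_hom op (talg C) (@bounded_op R H) pi).
Hypothesis (rrho : star_rep false rho).
Hypothesis rho_pi : forall y c u, talg Q y -> talg C c ->
  rho y (pi c u) = pi c (rho y u).
Hypothesis state : forall y c, talg Q y -> talg C c ->
  '[rho y (pi c xi), xi] = trace Q y * trace C c.

(** A supremum of bounded operators that lies in the coupling algebra is a supremum
    there; injectivity comes from the faithfulness of the trace, as the vector
    state of xi restricts to it. *)
Lemma coupling_embedding : vn_embedding op (talg C) (coupling_algebra rho) pi.
Proof.
have rpi : star_rep op pi := normal_hom_star_rep (fun T bT => bT) npi.
have [_ [fD [fZ [f1 [fM [fadj flub]]]]]] := npi.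
split.
  split; first exact: (pi_coupling rpi rho_pi).
  do 5![split=> //]; move=> D s dD lubs; have [_ [ub least]] := flub D s dD lubs.
  split; first by apply: (pi_coupling rpi rho_pi); case: lubs.
  by split=> // U MU; apply: least; exact: MU.1.
move=> S T CS CT ST; pose c := S \- T; have Cc : talg C c by exact: talg_sub.
have [c' Cc' cc'] := talg_adj_exists Cc.
have pc0 : pi c xi = 0 by rewrite (repB rpi) //= ST subrr.
have := inner_pi_xi rpi rrho rho_pi state Cc Cc cc'; rewrite pc0 inner0l => /esym tr0.
have c0 : c = cst 0.
  apply: trace_faithful (Cc) cc' _; move: tr0; case: (op) => //=.
  by move=> <-; exact: (trace_tracial Cc' Cc).
apply/funext => u; apply/eqP; rewrite -subr_eq0.
by have := congr1 (@^~ u) c0; rewrite /c /= => ->.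
Qed.

End Embedding.

Section OrbitEquivalence.
Variables (R : realType) (A Q : tracial_von_neumann R).
Variables (AQ : hilbert_tensor (tspace A) (tspace Q)) (H : hilbert R).
Variables (l : (AQ -> AQ) -> (H -> H)) (xi : H).
Local Notation X := [set T | exists x y, talg A x /\ talg Q y /\ T = tens_op AQ x y].
Local Notation P := (vn_tensor AQ (talg A) (talg Q)).
Hypothesis nl : normal_hom false P (@bounded_op R H) l.

Let Ab x : talg A x -> bounded_op x. Proof. exact: talg_bounded. Qed.
Let Qb y : talg Q y -> bounded_op y. Proof. exact: talg_bounded. Qed.

Lemma tensors_bounded : X `<=` @bounded_op R AQ.
Proof. by move=> _ [x [y [Ax [Qy ->]]]]; apply: tens_op_bounded; [exact: Ab|exact: Qb]. Qed.

Lemma tensors_adj S T : X S -> is_adjoint S T -> X T.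
Proof.
move=> [x [y [Ax [Qy ->]]]] ST.
have [x' Ax' xx'] := talg_adj_exists Ax; have [y' Qy' yy'] := talg_adj_exists Qy.
by exists x', y'; do 2![split=> //]; exact: adj_uniq ST (tens_op_adj AQ xx' yy').
Qed.

Lemma tensor_in x y : talg A x -> talg Q y -> P (tens_op AQ x y).
Proof.
move=> Ax Qy; have Xxy : X (tens_op AQ x y) by exists x, y.
apply: commutant_intro; first exact: tensors_bounded.
by move=> S u cS; rewrite (commutantP _ cS Xxy).
Qed.

Let lM S T u : P S -> P T -> l (S \o T) u = l S (l T u).
Proof.
by case: nl => _ [_ [_ [_ [h _]]]] PS PT; rewrite -[S \o T]/(Defs.mulo false S T) h.
Qed.

(** The actions of the two tensor factors; both act from the left. *)
Definition left_factor_rep (a : tspace A -> tspace A) : H -> H := l (tens_op AQ a id).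
Definition right_factor_rep (y : tspace Q -> tspace Q) : H -> H := l (tens_op AQ id y).

Lemma left_right_factor_rep a y u : talg A a -> talg Q y ->
  left_factor_rep a (right_factor_rep y u) = l (tens_op AQ a y) u.
Proof.
move=> Aa Qy; rewrite /left_factor_rep /right_factor_rep -lM;
  try exact: tensor_in (talg_id _) _; try exact: tensor_in.
  rewrite -tens_op_comp //; try exact: bmap_id; [exact: Ab | exact: Qb].
by apply: tensor_in => //; exact: talg_id.
Qed.

Lemma right_left_factor_rep a y u : talg A a -> talg Q y ->
  right_factor_rep y (left_factor_rep a u) = l (tens_op AQ a y) u.
Proof.
move=> Aa Qy; rewrite /left_factor_rep /right_factor_rep -lM;
  try exact: tensor_in (talg_id _) _; try exact: tensor_in.
  rewrite -tens_op_comp //; try exact: bmap_id; [exact: Ab | exact: Qb].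
by apply: tensor_in => //; exact: talg_id.
Qed.

Lemma right_factor_rep_star : star_rep false right_factor_rep.
Proof.
have [lin [lD [lZ [l1 [_ [ladj _]]]]]] := nl; have bi := bmap_id (tspace A).
have Ai := talg_id A; have inP y : talg Q y -> P (tens_op AQ id y) by exact: tensor_in.
split; first by move=> y Qy; apply: lin; exact: inP.
split; first by move=> x y Qx Qy; rewrite /right_factor_rep tens_opDr ?lD //; try exact: inP; exact: Qb.
split; first by move=> c y Qy; rewrite /right_factor_rep tens_opZr ?lZ //; try exact: inP; exact: Qb.
split; first by rewrite /right_factor_rep tens_op_id.
split.
  move=> x y Qx Qy; apply/funext => u; rewrite /right_factor_rep /Defs.mulo /= -lM; try exact: inP.
  by rewrite -tens_op_comp //; exact: Qb.
move=> x y Qx xy; apply: ladj; first exact: inP.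
exact: tens_op_adj (adj_id _) xy.
Qed.

(** A supremum in A is a weak limit, so its image under a |-> a (x) 1 is again a
    weak limit, and hence a supremum in the tensor product; l preserves it. *)
Lemma left_factor_rep_normal : normal_hom false (talg A) (@bounded_op R H) left_factor_rep.
Proof.
have [lin [lD [lZ [l1 [_ [ladj llub]]]]]] := nl; have bi := bmap_id (tspace Q).
have Qi := talg_id Q; have inP a : talg A a -> P (tens_op AQ a id) by move=> Aa; exact: tensor_in.
split; first by move=> a Aa; apply: lin; exact: inP.
split; first by move=> a b Aa Ab'; rewrite /left_factor_rep tens_opDl ?lD //; try exact: inP; exact: Ab.
split; first by move=> c a Aa; rewrite /left_factor_rep tens_opZl ?lZ //; try exact: inP; exact: Ab.
split; first by rewrite /left_factor_rep tens_op_id.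
split.
  move=> a b Aa Ab'; apply/funext => u; rewrite /left_factor_rep /Defs.mulo /= -lM; try exact: inP.
  by rewrite -tens_op_comp //; exact: Ab.
split.
  move=> a b Aa ab; apply: ladj; first exact: inP.
  exact: tens_op_adj ab (adj_id _).
move=> D s dD lubs; have [As [ub _]] := lubs.
have Y_b : commutant (talg A) `<=` @bounded_op R (tspace A) by move=> T [].
have wD : weak_sup D s.
  move: (dD) (lubs); rewrite talgE => dD' lubs'.
  exact: (is_lub_weak_sup Y_b dD' (Ab As) ub lubs').
have [D0 [Dsa Ddir]] := dD; have Db T : D T -> bounded_op T by move=> /Dsa[/Ab].
have dDb : directed_sa (@bounded_op R (tspace A)) D.
  by split=> //; split=> // T DT; split; [exact: Db | exact: (Dsa T DT).2].
pose th a := tens_op AQ a id.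
have -> : left_factor_rep @` D = l @` (th @` D) by rewrite image_comp.
apply: llub; last exact: weak_sup_is_lub (inP _ As) (tens_op_weak_sup AQ dDb (Ab As) wD).
split; first by case: D0 => T DT; exists (th T), T.
split.
  move=> _ [T DT <-]; split; first by apply: inP; exact: (Dsa T DT).1.
  exact: tens_op_adj (Dsa T DT).2 (adj_id _).
move=> _ _ [S DS <-] [T DT <-]; have [U [DU [SU TU]]] := Ddir _ _ DS DT.
by exists (th U); split; [exists U | split; apply: tens_op_mono => //; exact: Db].
Qed.

(** The projection onto the closure K0 of the orbit of xi under simple tensors
    commutes with the simple tensors, hence by normality with every l T.  As K0
    contains xi, it contains every l T xi. *)
Lemma algebraic_tensor_cyclic :
  closure (lspan [set l T xi | T in P]) = setT ->
  closure (lspan [set u | exists y a, talg Q y /\ talg A a /\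
    u = right_factor_rep y (left_factor_rep a xi)]) = setT.
Proof.
set Y := [set u | _]; move=> cyc.
have sY := subspace_lspan Y.
pose K0 := closure (lspan Y); have sK : subspace_of K0 := subspace_closure sY.
have cK : closed K0 := @closed_closure _ _.
have [lin [_ [_ [l1 [_ [ladj _]]]]]] := nl.
have XK S u : X S -> K0 u -> K0 (l S u).
  move=> XS; have PS : P S by case: (XS) => x [y [Ax [Qy ->]]]; exact: tensor_in.
  apply: closure_bmap; first exact: lin.
  suff : lspan Y `<=` [set x | lspan Y (l S x)].
    by move=> h x /h /= Sx; exact: (subset_closure Sx).
  apply: lspan_sub; first split.
  - by rewrite /= (bmap0 (lin _ PS)); exact: sY.1.
  - by move=> a x y /= Yx Yy; rewrite (bmapP (lin _ PS)); exact: sY.2.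
  move=> _ [y [a [Qy [Aa ->]]]] /=; apply: sub_lspan.
  case: XS => b [z [Ab' [Qz ->]]].
  exists (z \o y), (b \o a); split; first exact: talg_comp.
  split; first exact: talg_comp.
  rewrite !right_left_factor_rep ?talg_comp //; try exact: talg_comp.
  rewrite -lM; try exact: tensor_in.
  by rewrite -tens_op_comp //; try exact: Ab; exact: Qb.
have [E [bE EK EI E0]] := orthogonal_projection sK cK.
have cE : commutant (l @` X) E.
  apply: commutant_intro => // _ u [S XS <-].
  have [S' SS'] := adj_exists (tensors_bounded XS); have XS' := tensors_adj XS SS'.
  have PS : P S by case: (XS) => x [y [Ax [Qy ->]]]; exact: tensor_in.
  apply: (projection_commutes sK cK bE EI E0 (ladj _ _ PS SS')) => v; exact: XK.
have cE' := commutant_normal_image tensors_bounded tensors_adj nl cE.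
have Kxi : K0 xi.
  apply: subset_closure; apply: sub_lspan; exists id, id.
  split; first exact: talg_id.
  split; first exact: talg_id.
  by rewrite /right_factor_rep /left_factor_rep tens_op_id l1.
apply/seteqP; split=> // u _; have : closure (lspan [set l T xi | T in P]) u by rewrite cyc.
apply: closure_sub_closed cK _ _; apply: lspan_sub => // _ [T PT <-].
have lT : (l @` commutant (commutant X)) (l T) by exists T.
by rewrite -(EI _ Kxi) (commutantP _ cE' lT); exact: EK.
Qed.

End OrbitEquivalence.

Theorem proposition3p14 (R : realType) (A B : tracial_von_neumann R) :
  von_neumann_orbit_equivalent A B -> von_neumann_equivalent A B.
Proof.
move=> [Q [AQ [H [l [r [xi [[nl [nr lr]] [stA [stB [cycA cycB]]]]]]]]]].
pose pi := left_factor_rep l; pose rho := right_factor_rep l.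
have rrho : star_rep false rho := right_factor_rep_star nl.
have npi := left_factor_rep_normal nl.
have rpi : star_rep false pi := normal_hom_star_rep (fun T bT => bT) npi.
have rr : star_rep true r := normal_hom_star_rep (fun T bT => bT) nr.
have rho_pi y a u : talg Q y -> talg A a -> rho y (pi a u) = pi a (rho y u).
  by move=> Qy Aa; rewrite /rho /pi (right_left_factor_rep nl) // (left_right_factor_rep nl).
have rho_r y b u : talg Q y -> talg B b -> rho y (r b u) = r b (rho y u).
  move=> Qy Bb; have := lr _ _ (tensor_in AQ (talg_id A) Qy) Bb.
  by move=> /(congr1 (@^~ u)).
have stateA y a : talg Q y -> talg A a ->
    '[rho y (pi a xi), xi] = trace Q y * trace A a.
  by move=> Qy Aa; rewrite /rho /pi (right_left_factor_rep nl) // stA // mulrC.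
have totalA := algebraic_tensor_cyclic nl cycA.
exists H, (coupling_algebra rho), pi, r.
split; first exact: coupling_von_neumann.
split; first exact: (coupling_semifinite rpi rrho rho_pi stateA totalA).
split; first exact: (coupling_embedding npi rrho rho_pi stateA).
split; first exact: (coupling_embedding nr rrho rho_r stB).
split.
  move=> a b Aa Bb; exact: (lr _ _ (tensor_in AQ Aa (talg_id Q)) Bb).
split; first exact: (coupling_fundamental_domain rpi rrho rho_pi stateA totalA).
exact: (coupling_fundamental_domain rr rrho rho_r stB cycB).
Qed.
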